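(* Let $0<a<b<\infty$ and assign to the edges of the $\mathbb{Z}^2$ nearest-neighbour lattice independent weights, each uniformly distributed on $\{a,b\}$. Let $\alpha<1/10$ and let $(k_n)$ be positive integers with $k_n/n^\alpha\to0$. Then for any sequence $(x_n)$ with $x_n\to\infty$ and $x_n/n^{(1-10\alpha)/18}\to0$, $$\mathbb{P}\Big(t(n,k_n)-\mathbb{E}[t(n,k_n)]<-x_n\sqrt{\mathrm{Var}(t(n,k_n))}\Big)=\big[1-\Phi(x_n)\big]\Big[1+o\Big(\frac{x_n^3}{n^{(1-10\alpha)/6}}\Big)\Big],$$ and likewise $$\mathbb{P}\Big(t(n,k_n)-\mathbb{E}[t(n,k_n)]>x_n\sqrt{\mathrm{Var}(t(n,k_n))}\Big)=\big[1-\Phi(x_n)\big]\Big[1+o\Big(\frac{x_n^3}{n^{(1-10\alpha)/6}}\Big)\Big].$$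
   Context: For a path $\Gamma$, $T(\Gamma):=\sum_{e\in\Gamma}\omega_e$. $t(n,k)$ denotes the left-right crossing time of the rectangle $[0,n]\times[0,k-1]$: the infimum of $T(\Gamma)$ over nearest-neighbour paths $\Gamma$ contained in $[0,n]\times[0,k-1]$ connecting $\{0\}\times[0,k-1]$ to $\{n\}\times[0,k-1]$. $\Phi$ is the standard Gaussian distribution function. *)

(* Defs.v *)
From HB Require Import structures.
From mathcomp Require Import all_boot all_order all_algebra.
From mathcomp Require Import all_classical all_reals all_analysis.
Set Implicit Arguments. Unset Strict Implicit. Unset Printing Implicit Defensive.
Import Order.TTheory GRing.Theory Num.Theory.
Import numFieldNormedType.Exports.
Local Open Scope classical_set_scope.
Local Open Scope ring_scope.

(* Edges of the rectangle [0,n] x [0,k-1] of the Z^2 nearest-neighbour lattice: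
   horizontal edge (i,j) joins (i,j)-(i+1,j), 0<=i<n, 0<=j<k;
   vertical edge  (i,j) joins (i,j)-(i,j+1), 0<=i<=n, 0<=j<k-1. *)
Definition hedge (n k : nat) := ('I_n * 'I_k)%type.
Definition vedge (n k : nat) := ('I_n.+1 * 'I_k.-1)%type.
Definition edge (n k : nat) := (hedge n k + vedge n k)%type.

(* A configuration: for each edge, false = weight a, true = weight b.
   The product of independent uniform {a,b} weights is the uniform measure
   on these configurations. *)
Definition config (n k : nat) := {ffun edge n k -> bool}.

Section Weights.
Variables (R : realType) (a b : R) (n k : nat) (om : config n k).

Definition wt (e : edge n k) : R := if om e then b else a.

(* weight of the edge between lattice points u and v (0 if not an edge
   of the rectangle; only used on edges of the rectangle) *)
Definition edge_weight (u v : nat * nat) : R :=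
  if (u.2 == v.2) && ((v.1 == u.1.+1) || (u.1 == v.1.+1)) then
    match (insub (minn u.1 v.1) : option 'I_n), (insub u.2 : option 'I_k) with
    | Some i, Some j => wt (inl (i, j))
    | _, _ => 0
    end
  else if (u.1 == v.1) && ((v.2 == u.2.+1) || (u.2 == v.2.+1)) then
    match (insub u.1 : option 'I_n.+1), (insub (minn u.2 v.2) : option 'I_k.-1) with
    | Some i, Some j => wt (inr (i, j))
    | _, _ => 0
    end
  else 0.

Definition passage_time (x0 : nat * nat) (s : seq (nat * nat)) : R :=
  \sum_(e <- zip (x0 :: s) s) edge_weight e.1 e.2.
End Weights.

Definition nn_adj (u v : nat * nat) : bool :=
  (`|(u.1 : int) - v.1|%N + `|(u.2 : int) - v.2|%N == 1)%N.

Definition in_rect (n k : nat) (v : nat * nat) : bool := (v.1 <= n)%N && (v.2 < k)%N.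

Definition crossing_path (n k : nat) (x0 : nat * nat) (s : seq (nat * nat)) : Prop :=
  [/\ all (in_rect n k) (x0 :: s), path nn_adj x0 s,
      x0.1 = 0%N & (last x0 s).1 = n].

Definition tcross (R : realType) (a b : R) (n k : nat) (om : config n k) : R :=
  inf [set passage_time a b om p.1 p.2 | p in [set p | crossing_path n k p.1 p.2]].

Definition Prob (R : realType) (n k : nat) (E : pred (config n k)) : R :=
  #|[set om | E om]|%:R / #|{: config n k}|%:R.
Definition Expect (R : realType) (n k : nat) (X : config n k -> R) : R :=
  (\sum_(om : config n k) X om) / #|{: config n k}|%:R.
Definition Var (R : realType) (n k : nat) (X : config n k -> R) : R :=
  Expect (fun om => (X om - Expect X) ^+ 2).

Definition Phi (R : realType) (x : R) : R :=
  fine (\int[@lebesgue_measure R]_(t in `]-oo, x]) (expR (- (t ^+ 2) / 2))%:E)%E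
  / Num.sqrt (2 * pi).
Arguments Prob {R n k}.
Arguments Expect {R n k}.
Arguments Var {R n k}.

(* Main.v *)
(* Cut the strip into about [sqrt n] blocks of about [sqrt n] columns. The crossing time of the strip
   is the sum of the independent crossing times of the blocks plus a remainder [Rem], since a
   crossing of the strip contains crossings of the blocks, and conversely consecutive block crossings
   can be joined at cost at most [b k]. Resampling one column changes a crossing time, and resampling
   one block changes [Rem], by at most [2 b k]; so by McDiarmid's inequality the centered block times
   and the centered remainder are of order at most [k n^(1/4)], up to events of negligible probability.

   The variance of the crossing time is at least of order [n / k^3]. It is bounded below by the squared
   sum of the influences of the edges divided by the number of edges, and the influences sum to at
   least a multiple of the mean number of [b]-edges on an almost optimal crossing. By planar
   self-duality, each of about [n / k] disjoint blocks of [k + 1] columns has, with probability at least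
   one half, no crossing made of [a]-edges only, and then contributes such a [b]-edge.

   Finally Stein's method gives Cramer-type moderate deviations for [W = sum_i xi_i], with independent
   centered [|xi_i| <= dl] and unit variance. If [f' w = w f w + Q x - 1_{w > x}] and [g w = w f w],
   which is nondecreasing, a leave-one-out argument gives
   [P(W > x + 2 dl) <= Q x + E(g(W + 2 dl) - g(W))] and a matching lower bound, and the increments of
   [g] have mean [O(x^3 dl Q x)] by bounds on the moment generating function of [W]. *)
Require Import Defs.
From HB Require Import structures.
From mathcomp Require Import all_boot all_order all_algebra.
From mathcomp Require Import all_classical all_reals all_analysis.
From mathcomp Require Import measurable_realfun.
From mathcomp Require Import zify ring lra.
Import Order.TTheory GRing.Theory Num.Theory.
Import numFieldNormedType.Exports.
Local Open Scope classical_set_scope.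
Local Open Scope ring_scope.

Set Implicit Arguments.
Unset Strict Implicit.
Unset Printing Implicit Defensive.

(** * Gaussian tails *)

Section Gaussian.
Variable R : realType.
Implicit Types x w u : R.

(** The error must be small relative to [Q x], which itself tends to 0, so every discarded event has
    to be much rarer than [Q x]. Put [th = 1 - 10 * alpha] and [w = n ^ (th / 72)], so that
    eventually [x <= w ^ 4]. Truncating at [s = x * w] times the bounded-difference scale leaves
    tails of order [exp (- x ^ 2 * w ^ 2)], negligible against [Q x] times any power of [1 / n]. The
    relative error is then [x ^ 3] times the ratio of the truncation level to the standard
    deviation. With [s * k * n ^ (1/4)] over [n ^ (1/2) / k ^ (3/2)] this ratio is
    [s * k ^ (5/2) * n ^ (- 1/4)], and [k <= n ^ alpha] bounds it by
    [w ^ 5 * n ^ (- th / 4) = w ^ (- 13)]. The target is [n ^ (- th / 6) = w ^ (- 12)]; the spare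
    factor [1 / w] becomes the little o. Blocks of length [sqrt n] balance two errors: a block
    fluctuates like the root of its length, the remainder like the root of the number of blocks.
    Truncation also alters the variance, while the theorem normalises by the true one; this
    displaces the threshold, and the displacement must be small on the scale [1 / x] on which [Q]
    varies. *)

Definition gdens x : R := expR (- (x ^+ 2) / 2) / Num.sqrt (2 * pi).

Lemma gdens_gt0 x : 0 < gdens x.
Proof. by rewrite divr_gt0 ?expR_gt0// sqrtr_gt0 mulr_gt0// pi_gt0. Qed.

Lemma normal_pdf01 x : normal_pdf 0 1 x = gdens x.
Proof.
rewrite normal_pdfE ?oner_eq0// /normal_peak /normal_fun /gdens mulrC subr0.
by rewrite expr1n mul1r -[pi *+ 2]mulr_natl.
Qed.

Lemma gdens_continuous : continuous gdens.
Proof.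
have -> : gdens = normal_pdf 0 1 by apply/funext => x; rewrite normal_pdf01.
by apply: continuous_normal_pdf; rewrite oner_eq0.
Qed.

(** This identifies [Phi] with the distribution function of the library's normal law: its limits at
    both infinities then come from [cdf], and its derivative from the fundamental theorem of
    calculus on a half line. *)
Lemma Phi_normal_prob x : (Phi x)%:E = normal_prob 0 1 `]-oo, x]%classic.
Proof.
have c0 : (0 : R) <= (Num.sqrt (2 * pi))^-1 by rewrite invr_ge0 sqrtr_ge0.
have cn : 0 < (Num.sqrt (2 * pi) : R) by rewrite sqrtr_gt0 mulr_gt0 ?pi_gt0.
have nf : (normal_prob 0 1 `]-oo, x]%classic : \bar R) \is a fin_num.
  by rewrite fin_num_measure.
rewrite -[RHS]fineK//; congr EFin; rewrite /Phi /normal_prob.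
have -> : (\int[lebesgue_measure]_(t in `]-oo, x]) (normal_pdf 0 1 t)%:E =
  \int[lebesgue_measure]_(t in `]-oo, x])
    ((Num.sqrt (2 * pi))^-1%:E * (expR (- t ^+ 2 / 2))%:E) :> \bar R)%E.
  by apply: eq_integral => t _; rewrite normal_pdf01 /gdens mulrC EFinM.
rewrite ge0_integralZl//.
- set I := (\int[_]_(_ in _) _)%E.
  have I0 : (0 <= I)%E by apply: integral_ge0 => t _; rewrite lee_fin expR_ge0.
  have fI : I \is a fin_num.
    have -> : I = ((Num.sqrt (2 * pi))%:E * normal_prob 0 1 `]-oo, x]%classic)%E.
      rewrite /normal_prob -ge0_integralZl//.
      + apply: eq_integral => t _; rewrite normal_pdf01 /gdens -EFinM; congr EFin.
        by field; rewrite gt_eqF.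
      + by apply/measurable_EFinP; apply: measurable_funTS; exact: measurable_normal_pdf.
      + by move=> t _; rewrite lee_fin normal_pdf_ge0.
    by rewrite fin_numM// .
  by rewrite fineM// mulrC.
- apply/measurable_EFinP; apply: measurable_funTS.
  have -> : (fun t : R => expR (- t ^+ 2 / 2)) =
      (fun t => Num.sqrt (2 * pi) * normal_pdf 0 1 t).
    by apply/funext => t; rewrite normal_pdf01 /gdens; field; rewrite gt_eqF.
  by apply: measurable_funM; [exact: measurable_cst|exact: measurable_normal_pdf].
Qed.

Let idTR : measurableTypeR R -> R := idfun.

#[local] HB.instance Definition _ :=
  @isMeasurableFun.Build _ _ _ _ idTR (@measurable_id _ _ setT).

Lemma cdf_normal : cdf (idTR : {RV (@normal_prob R 0 1) >-> R}) = EFin \o @Phi R.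
Proof. by apply/funext => x; rewrite /= Phi_normal_prob. Qed.

Lemma Phi_cvgNy : @Phi R x @[x --> -oo] --> (0 : R).
Proof.
have := cvg_cdfNy0 (idTR : {RV (@normal_prob R 0 1) >-> R}).
by rewrite cdf_normal => /fine_cvg.
Qed.

Lemma Phi_cvgy : @Phi R x @[x --> +oo] --> (1 : R).
Proof.
have := cvg_cdfy1 (idTR : {RV (@normal_prob R 0 1) >-> R}).
by rewrite cdf_normal => /fine_cvg.
Qed.

Global Instance is_derive_Phi x : is_derive x 1 (@Phi R) (gdens x).
Proof.
have PhiE : @Phi R = fun y => (\int[lebesgue_measure]_(t in `]-oo, y]) gdens t).
  apply/funext => y; apply: EFin_inj; rewrite Phi_normal_prob.
  rewrite -[LHS]fineK ?fin_num_measure//; congr EFin; rewrite /Rintegral/normal_prob; congr fine.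
  by apply: eq_integral => t _; rewrite normal_pdf01.
have [||||dx fx] := @continuous_FTC1 R gdens -oo%O x (x + 1).
- by rewrite ltrDl.
- have := integrable_normal_pdf (0 : R) 1.
  rewrite (_ : (fun _ => _) = EFin \o gdens); last by apply/funext => t /=; rewrite normal_pdf01.
  by move/(integrableS _ _ (@subsetT _ _)); apply.
- by rewrite ltNyr.
- exact: gdens_continuous.
rewrite PhiE; split; first exact: dx.
by rewrite -derive1E.
Qed.

End Gaussian.

Lemma MVT_le (R : realType) (f df : R -> R) (a b : R) : a <= b ->
  (forall x, a <= x <= b -> is_derive x 1 f (df x)) ->
  exists2 c, a <= c <= b & f b - f a = df c * (b - a).
Proof.
move=> ab fd; have [||c] := @MVT_segment R f df a b ab.
- by move=> x /[!in_itv]/= /andP[ax xb]; apply: fd; rewrite !ltW.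
- apply: derivable_within_continuous => x /[!in_itv]/= xab.
  by have := fd x xab; case.
by rewrite in_itv/=; exists c.
Qed.

Lemma derive_noninc (R : realType) (f df : R -> R) (a b : R) : a <= b ->
  (forall x, a <= x <= b -> is_derive x 1 f (df x)) ->
  (forall x, a <= x <= b -> df x <= 0) -> f b <= f a.
Proof.
move=> ab fd df0; have [c cab e] := MVT_le ab fd.
by rewrite -subr_le0 e mulr_le0_ge0 ?df0// subr_ge0.
Qed.

Section Stein.
Variable R : realType.
Implicit Types x w u : R.

Definition Q x : R := 1 - Phi x.

Global Instance is_derive_Q x : is_derive x 1 Q (- gdens x).
Proof. by rewrite /Q; apply: is_derive_eq; rewrite add0r mul1r. Qed.

Global Instance is_derive_gdens x : is_derive x 1 (@gdens R) (- x * gdens x).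
Proof.
have -> : @gdens R = fun x => expR (- (1/2) * (x * x)) * (Num.sqrt (2 * pi))^-1.
  by apply/funext => y; rewrite /gdens; congr (expR _ / _); rewrite expr2; field.
apply: is_derive_eq; rewrite /GRing.scale/=; field.
by rewrite gt_eqF// sqrtr_gt0 mulr_gt0// pi_gt0.
Qed.

Lemma Q_noninc x w : x <= w -> Q w <= Q x.
Proof.
move=> xw; apply: (derive_noninc xw (fun t _ => is_derive_Q t)) => t _.
by rewrite oppr_le0 ltW// gdens_gt0.
Qed.

Lemma Q_cvgy : Q x @[x --> +oo] --> (0 : R).
Proof. by rewrite -(subrr (1 : R)); apply: cvgB; [exact: cvg_cst|exact: Phi_cvgy]. Qed.

(* lets one discard error terms bounded by [Q y] as [y] grows *)
Lemma Q_limit_ge0 (c y0 : R) : (forall y, y0 <= y -> - `|Q y| <= c) -> 0 <= c.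
Proof.
move=> h; rewrite leNgt; apply/negP => c0.
have [M [_ hM]] : \forall y \near +oo, `|0 - Q y| < - c.
  by move/cvgrPdist_lt : Q_cvgy; apply; rewrite oppr_gt0.
pose y := Num.max (M + 1) y0.
have yM : M < y by rewrite /y lt_max ltrDl ltr01.
have := hM y yM; have /h : y0 <= y by rewrite /y le_max lexx orbT.
by rewrite sub0r normrN; lra.
Qed.

Lemma Q_ge0 x : 0 <= Q x.
Proof.
apply: (@Q_limit_ge0 _ x) => y /Q_noninc; apply: le_trans.
by rewrite lerNl -normrN ler_norm.
Qed.

Lemma Q_gt0 x : 0 < Q x.
Proof.
have xx1 : x <= x + 1 by rewrite lerDl.
have [c _ e] := MVT_le xx1 (fun t _ => is_derive_Q t).
have := Q_ge0 (x + 1); have := gdens_gt0 c; move: e; lra.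
Qed.

Lemma Q_le1 x : Q x <= 1.
Proof.
rewrite /Q lerBlDl lerDr; have := @Phi_cvgNy R; rewrite leNgt => h; apply/negP => p0.
have [M [_ hM]] : \forall y \near -oo, `|0 - Phi y| < - Phi x.
  by move/cvgrPdist_lt : h; apply; rewrite oppr_gt0.
pose y := Num.min (M - 1) x.
have yM : y < M by rewrite /y gt_min gtrBl ltr01.
have := hM y yM; have /Q_noninc : y <= x by rewrite /y ge_min lexx orbT.
by rewrite sub0r normrN /Q => h1; have := ler_norm (- Phi y); rewrite normrN; lra.
Qed.

Lemma Phi_ge0 x : 0 <= Phi x :> R.
Proof. by have := Q_le1 x; rewrite /Q; lra. Qed.

Lemma Phi_le1 x : Phi x <= 1 :> R.
Proof. by have := Q_ge0 x; rewrite /Q; lra. Qed.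

Lemma gdensN x : gdens (- x) = gdens x :> R.
Proof. by rewrite /gdens sqrrN. Qed.

Lemma gdens_noninc x w : 0 <= x -> x <= w -> gdens w <= gdens x :> R.
Proof.
move=> x0 xw; rewrite ler_pM2r ?invr_gt0 ?sqrtr_gt0 ?mulr_gt0 ?pi_gt0// ler_expR.
by rewrite ler_pM2r ?invr_gt0// lerN2 ler_pXn2r// ?nnegrE// (le_trans x0).
Qed.

(** On the unit interval ending at [y] the density is at least [gdens y]. The density is thus
    dominated by a tail, which is the form of error that [Q_limit_ge0] accepts. *)
Lemma gdens_le_Q y : 1 <= y -> gdens y <= Q (y - 1) :> R.
Proof.
move=> y1; have yy : y - 1 <= y by rewrite gerBl.
have [c /andP[c1 c2] e] := MVT_le yy (fun t _ => is_derive_Q t).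
have : gdens y <= gdens c by apply: gdens_noninc => //; lra.
have := Q_ge0 y; move: e; lra.
Qed.

(** By evenness of the density both sides have the same derivative; their constant difference is
    read off at infinity, where both tend to 1. *)
Lemma Phi_Q x : Phi x = Q (- x) :> R.
Proof.
have cst y : Phi y - Q (- y) = Phi x - Q (- x) :> R.
  have d (t : R) : is_derive t 1 (fun z : R => Phi z - Q (- z)) 0.
    apply: is_derive_eq.
    by rewrite gdensN /GRing.scale/=; ring.
  have [yx|/ltW yx] := leP y x.
    have [t _] := MVT_le yx (fun t _ => d t); rewrite mul0r; lra.
  have [t _] := MVT_le yx (fun t _ => d t); rewrite mul0r; lra.
apply/eqP; rewrite -subr_eq0; apply/eqP.
suff : (fun y => Phi y - Q (- y) : R) y @[y --> +oo] --> (0 : R).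
  have -> : (fun y => Phi y - Q (- y) : R) = fun=> Phi x - Q (- x).
    by apply/funext.
  by move/cvg_lim => <-//; rewrite lim_cst.
rewrite -(subrr (1 : R)); apply: cvgB; first exact: Phi_cvgy.
rewrite -[X in _ --> X]subr0; apply: cvgB; first exact: cvg_cst.
exact: (@cvgNy_compNP _ _ (@Phi R) _).1 (@Phi_cvgNy R).
Qed.

(** [gdens t / t - Q t] has derivative [- gdens t / t ^+ 2]; it decreases and stays above [- Q t],
    which tends to 0, so it is nonnegative. *)
Lemma mills_upper w : 0 < w -> w * Q w <= gdens w.
Proof.
move=> w0; pose f t : R := gdens t / t - Q t.
have d t : w <= t -> is_derive t 1 f (- gdens t / t ^+ 2).
  move=> wt; have t0 : t != 0 by rewrite gt_eqF// (lt_le_trans w0).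
  have := is_deriveV t0 (is_derive_id t 1).
  move=> ?; rewrite /f; apply: is_derive_eq; rewrite /GRing.scale/=; field.
  by [].
suff f0 : 0 <= f w.
  by move: f0; rewrite /f subr_ge0 ler_pdivlMr// mulrC.
apply: (@Q_limit_ge0 _ w) => y wy.
have y0 : 0 < y by apply: lt_le_trans wy.
apply: (@le_trans _ _ (f y)).
  rewrite /f ger0_norm ?Q_ge0// lerDr divr_ge0// ltW// gdens_gt0//.
apply: (derive_noninc wy (fun t h => d t (andP h).1)) => t /andP[wt _].
by rewrite mulNr oppr_le0 divr_ge0 ?sqr_ge0// ltW// gdens_gt0.
Qed.

(** Same scheme for [Q t - t * gdens t / (1 + t ^+ 2)], of derivative
    [- 2 * gdens t / (1 + t ^+ 2) ^+ 2]. It is also applied at negative points, through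
    reflection. *)
Lemma mills_lower w : w * gdens w <= (1 + w ^+ 2) * Q w.
Proof.
have p (t : R) : 0 < 1 + t * t by rewrite ltr_pwDl// -expr2 sqr_ge0.
pose f t : R := Q t - t * gdens t / (1 + t * t).
have d (t : R) : is_derive t 1 f (- (2 * gdens t / (1 + t * t) ^+ 2)).
  have t0 : 1 + t * t != 0 by rewrite gt_eqF.
  have dt : is_derive t 1 (fun t : R => 1 + t * t) (2 * t).
    by apply: is_derive_eq; rewrite /GRing.scale/=; ring.
  have := @is_deriveV _ (fun t : R => 1 + t * t) t _ 1 t0 dt.
  move=> ?; rewrite /f; apply: is_derive_eq; rewrite /GRing.scale/=; field.
  by [].
suff f0 : 0 <= f w.
  by move: f0; rewrite /f subr_ge0 ler_pdivrMr// expr2 [X in _ -> _ <= X]mulrC.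
apply: (@Q_limit_ge0 _ (Num.max (w - 1) 0)) => y; rewrite ge_max => /andP[wy y0].
apply: (@le_trans _ _ (f (y + 1))).
  rewrite /f ger0_norm ?Q_ge0//.
  have : (y + 1) * gdens (y + 1) / (1 + (y + 1) * (y + 1)) <= Q y.
    have := @gdens_le_Q (y + 1); rewrite lerDr y0 addrK => /(_ isT) /(le_trans _); apply.
    by rewrite ler_pdivrMr// mulrC ler_pM2l ?gdens_gt0//; nra.
  by have := Q_ge0 (y + 1); lra.
have wy1 : w <= y + 1 by lra.
apply: (derive_noninc wy1 (fun t _ => d t)) => t _.
by rewrite oppr_le0 divr_ge0 ?sqr_ge0// mulr_ge0// ltW// gdens_gt0.
Qed.

End Stein.

(** * Stein's equation *)

Section SteinSolution.
Variable R : realType.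
Implicit Types x w u : R.

(** The Mills ratios of the two tails. They solve [f' = 1 + w * f] and [f' = w * f - 1]; multiplied
    by [Q x] and [Phi x] they form the two branches of [stein]. *)
Definition mills_left w : R := Phi w / gdens w.
Definition mills_right w : R := Q w / gdens w.

Let gn0 w : gdens w != 0. Proof. by rewrite gt_eqF// gdens_gt0. Qed.

Lemma is_derive_mills_left w : is_derive w 1 mills_left (1 + w * mills_left w).
Proof.
have := is_deriveV (gn0 w) (is_derive_gdens w).
move=> ?; rewrite /mills_left; apply: is_derive_eq; rewrite /GRing.scale/=; field.
exact: gn0.
Qed.

Lemma is_derive_mills_right w : is_derive w 1 mills_right (w * mills_right w - 1).
Proof.
have := is_deriveV (gn0 w) (is_derive_gdens w).
move=> ?; rewrite /mills_right; apply: is_derive_eq; rewrite /GRing.scale/=; field.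
exact: gn0.
Qed.

Lemma mills_leftE w : mills_left w = mills_right (- w).
Proof. by rewrite /mills_left /mills_right Phi_Q gdensN. Qed.

Lemma mills_left_ge0 w : 0 <= mills_left w.
Proof. by rewrite divr_ge0 ?Phi_ge0// ltW// gdens_gt0. Qed.

(** [(1 + w ^+ 2) * mills_right w - w] is the derivative of [w * mills_right w]; its sign makes
    [steinM] monotone. *)
Lemma mills_right_lower w : w <= (1 + w ^+ 2) * mills_right w.
Proof. by rewrite mulrA ler_pdivlMr ?gdens_gt0// mills_lower. Qed.

Lemma mills_right_upper w : 0 < w -> (1 + w ^+ 2) * mills_right w - w <= w^-1.
Proof.
move=> w0; have : mills_right w <= w^-1.
  by rewrite ler_pdivrMr ?gdens_gt0// mulrC ler_pdivlMr// mulrC mills_upper.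
move=> h; rewrite lerBlDr; apply: (@le_trans _ _ ((1 + w ^+ 2) * w^-1)).
  by rewrite ler_wpM2l// addr_ge0// sqr_ge0.
by rewrite mulrDl mul1r expr2 mulfK// gt_eqF.
Qed.

Lemma sqrt2pi_le3 : Num.sqrt (2 * pi) <= 3 :> R.
Proof.
have -> : (3 : R) = Num.sqrt (3 ^+ 2) by rewrite sqrtr_sqr ger0_norm.
rewrite ler_wsqrtr//; have /andP[_] := pihalf_02 R; lra.
Qed.

Lemma gdensV_le w : (gdens w)^-1 <= 3 * expR (w ^+ 2 / 2) :> R.
Proof.
rewrite /gdens invf_div mulNr expRN invrK ler_wpM2r ?expR_ge0//.
exact: sqrt2pi_le3.
Qed.

Lemma expR_half_le2 : expR (1 / 2) <= 2 :> R.
Proof.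
have := expR_ge1Dx (- (1 / 2) : R); have := expRxMexpNx_1 (1 / 2 : R).
have := expR_gt0 (1 / 2 : R); nra.
Qed.

Definition pos_part w : R := Num.max w 0.

(** The left-hand side is the derivative of [w * mills_left w]. Below -1, reflection and
    [mills_right_upper] bound it by 1; between -1 and 0 the density is bounded below; for positive
    [w], [Phi w <= 1] leaves [1 / gdens w]. Hence only the positive part of [w] enters the
    exponent. *)
Lemma mills_left_slope x w : 1 <= x -> w <= x ->
  (1 + w ^+ 2) * mills_left w + w <= 12 * (1 + x ^+ 2) * expR (pos_part w ^+ 2 / 2).
Proof.
move=> x1 wx.
have e1 : 1 <= expR (pos_part w ^+ 2 / 2).
  by rewrite -expR0 ler_expR divr_ge0 ?sqr_ge0.
have [w1|w1] := leP w (- 1).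
  have := @mills_right_upper (- w); rewrite -mills_leftE sqrrN => /(_ ltac:(lra)).
  have : (- w)^-1 <= 1 by rewrite invf_le1; lra.
  by move=> h1 h2; nra.
have l3 : mills_left w <= 3 * expR (w ^+ 2 / 2).
  apply: le_trans (gdensV_le w).
  by rewrite ler_piMl ?invr_ge0 ?Phi_le1// ltW// gdens_gt0.
have [w0|w0] := leP w 0.
  have : expR (w ^+ 2 / 2) <= 2.
    by apply: le_trans expR_half_le2; rewrite ler_expR; nra.
  move=> h; have : mills_left w <= 6 by lra.
  have := mills_left_ge0 w; nra.
have pw : pos_part w = w by rewrite /pos_part max_l// ltW.
rewrite pw in e1 *.
have ww : w ^+ 2 <= x ^+ 2 by nra.
have : (1 + w ^+ 2) * mills_left w <= (1 + x ^+ 2) * (3 * expR (w ^+ 2 / 2)).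
  by apply: ler_pM => //; [rewrite addr_ge0// sqr_ge0|exact: mills_left_ge0|lra].
have x2 : 0 <= 1 + x ^+ 2 by rewrite addr_ge0// sqr_ge0.
have : x <= (1 + x ^+ 2) * expR (w ^+ 2 / 2).
  by apply: (@le_trans _ _ (1 + x ^+ 2)); [nra|rewrite ler_peMr].
have : 0 <= (1 + x ^+ 2) * expR (w ^+ 2 / 2) by rewrite mulr_ge0// expR_ge0.
by rewrite -mulrA mulrCA; lra.
Qed.

(* Stein's equation [f' w = w * f w + Q x - 1_{w > x}] for the half line beyond [x] *)
Definition stein x w : R :=
  if w <= x then mills_left w * Q x else mills_right w * Phi x.
Definition steinM x w : R := w * stein x w.

Lemma stein_left x w : w <= x -> stein x w = mills_left w * Q x.
Proof. by rewrite /stein => ->. Qed.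

Lemma stein_right x w : x <= w -> stein x w = mills_right w * Phi x.
Proof.
rewrite le_eqVlt => /predU1P[<-|xw]; last by rewrite /stein leNgt xw.
by rewrite /stein lexx /mills_left /mills_right mulrAC [in RHS]mulrAC (mulrC (Phi x)).
Qed.

(** [stein x] has a corner at [x], so the mean value theorem is applied on each side separately;
    Stein's equation then expresses the slope through [steinM]. *)
Lemma stein_slope_left x w w' : w <= w' -> w' <= x ->
  exists2 c, w <= c <= w' & stein x w' - stein x w = (steinM x c + Q x) * (w' - w).
Proof.
move=> ww wx; have [c cw e] := MVT_le ww (fun t _ => is_derive_mills_left t).
exists c => //; rewrite /steinM !stein_left ?(le_trans _ wx)//; last by case/andP: cw.
by rewrite -mulrBl e; ring.
Qed.

Lemma stein_slope_right x w w' : w <= w' -> x <= w ->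
  exists2 c, w <= c <= w' & stein x w' - stein x w = (steinM x c + Q x - 1) * (w' - w).
Proof.
move=> ww wx; have [c cw e] := MVT_le ww (fun t _ => is_derive_mills_right t).
exists c => //; rewrite /steinM !stein_right ?(le_trans wx)//; last by case/andP: cw.
by rewrite -mulrBl e /Q; ring.
Qed.

Let is_derive_idM (f : R -> R) df w : is_derive w 1 f df ->
  is_derive w 1 (fun t => t * f t) (f w + w * df).
Proof. by move=> ?; apply: is_derive_eq; rewrite /GRing.scale/=; ring. Qed.

Lemma steinM_slope_left x w w' : w <= w' -> w' <= x ->
  exists2 c, w <= c <= w' &
    steinM x w' - steinM x w = ((1 + c ^+ 2) * mills_left c + c) * Q x * (w' - w).
Proof.
move=> ww wx; have [c cw e] :=
  MVT_le ww (fun t _ => is_derive_idM (is_derive_mills_left t)).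
exists c => //; rewrite /steinM !stein_left ?(le_trans _ wx)//.
transitivity ((w' * mills_left w' - w * mills_left w) * Q x); first by ring.
by rewrite e; ring.
Qed.

Lemma steinM_slope_right x w w' : w <= w' -> x <= w ->
  exists2 c, w <= c <= w' &
    steinM x w' - steinM x w = ((1 + c ^+ 2) * mills_right c - c) * Phi x * (w' - w).
Proof.
move=> ww wx; have [c cw e] :=
  MVT_le ww (fun t _ => is_derive_idM (is_derive_mills_right t)).
exists c => //; rewrite /steinM !stein_right ?(le_trans wx)//.
transitivity ((w' * mills_right w' - w * mills_right w) * Phi x); first by ring.
by rewrite e; ring.
Qed.

Lemma steinM_nondec x w w' : w <= w' -> steinM x w <= steinM x w'.
Proof.
have left a b : a <= b -> b <= x -> steinM x a <= steinM x b.
  move=> ab bx; have [c _ e] := steinM_slope_left ab bx.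
  rewrite -subr_ge0 e !mulr_ge0 ?Q_ge0 ?subr_ge0//.
  by have := mills_right_lower (- c); rewrite -mills_leftE sqrrN; lra.
have right a b : a <= b -> x <= a -> steinM x a <= steinM x b.
  move=> ab bx; have [c _ e] := steinM_slope_right ab bx.
  by rewrite -subr_ge0 e mulr_ge0 ?subr_ge0// mulr_ge0 ?Phi_ge0// subr_ge0 mills_right_lower.
move=> ww; have [|/ltW w'x] := leP w' x; first exact: left.
have [|/ltW wx] := leP x w; first exact: right.
by apply: le_trans (left _ _ wx (lexx x)) (right _ _ w'x (lexx x)).
Qed.

(** By Stein's equation the slope is [steinM x c + Q x] minus the indicator that [c] lies beyond
    [x]. Monotonicity of [steinM] moves [c] to the right end, and keeping the indicator only when
    the whole interval lies beyond [x] can only increase the bound. *)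
Let slope_le x w w' : w <= w' ->
  stein x w' - stein x w <= (steinM x w' + Q x - (x <= w)%R%:R) * (w' - w).
Proof.
have left a b : a <= b -> b <= x -> stein x b - stein x a <= (steinM x b + Q x) * (b - a).
  move=> ab bx; have [c /andP[_ cb] ->] := stein_slope_left ab bx.
  by rewrite ler_wpM2r ?subr_ge0// lerD2r steinM_nondec.
have right a b : a <= b -> x <= a ->
    stein x b - stein x a <= (steinM x b + Q x - 1) * (b - a).
  move=> ab bx; have [c /andP[_ cb] ->] := stein_slope_right ab bx.
  by rewrite ler_wpM2r ?subr_ge0// !lerD2r steinM_nondec.
move=> ww; have [xw|wx] := leP x w; first exact: right.
rewrite subr0; have [|/ltW w'x] := leP w' x; first exact: left.
have := left _ _ (ltW wx) (lexx x); have := right _ _ w'x (lexx x).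
have := steinM_nondec x w'x.
move: (steinM _ _) (steinM _ _) (stein x x) (Q x) => A B C D; nra.
Qed.

Let slope_ge x w w' : w <= w' ->
  (steinM x w + Q x - (x < w')%R%:R) * (w' - w) <= stein x w' - stein x w.
Proof.
have left a b : a <= b -> b <= x -> (steinM x a + Q x) * (b - a) <= stein x b - stein x a.
  move=> ab bx; have [c /andP[cb _] ->] := stein_slope_left ab bx.
  by rewrite ler_wpM2r ?subr_ge0// lerD2r steinM_nondec.
have right a b : a <= b -> x <= a ->
    (steinM x a + Q x - 1) * (b - a) <= stein x b - stein x a.
  move=> ab bx; have [c /andP[cb _] ->] := stein_slope_right ab bx.
  by rewrite ler_wpM2r ?subr_ge0// !lerD2r steinM_nondec.
move=> ww; have [w'x|xw'] := leP w' x; first by rewrite subr0; exact: left.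
have [|wx] := leP x w; first exact: right.
have := left _ _ (ltW wx) (lexx x); have := right _ _ (ltW xw') (lexx x).
have := steinM_nondec x (ltW wx).
move: (steinM _ _) (steinM _ _) (stein x x) (Q x) => A B C D /=; nra.
Qed.

(** Multiplication by [u] turns a slope bound into a multiple of [u ^+ 2] for either sign of [u],
    and both ends of the increment lie within [dl] of [w]. The indicator at [x + dl] guarantees that
    the whole segment lies beyond [x]. *)
Lemma stein_diff_upper x w u dl : `|u| <= dl ->
  u * (stein x (w + u) - stein x w) <=
  u ^+ 2 * (steinM x (w + dl) + Q x - (x + dl < w)%R%:R).
Proof.
rewrite ler_norml => /andP[ul uu].
have ind a : (x + dl < w -> x <= a) -> (x + dl < w)%R%:R <= (x <= a)%R%:R :> R.
  by have [_ ->|] := boolP (x + dl < w); rewrite ?ler0n.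
have [u0|/ltW u0] := leP 0 u.
  have wu : w <= w + u by rewrite lerDl.
  have := slope_le x wu; rewrite (_ : w + u - w = u); last by ring.
  have : steinM x (w + u) <= steinM x (w + dl) by apply: steinM_nondec; rewrite lerD2l.
  have : (x + dl < w)%R%:R <= (x <= w)%R%:R :> R.
    by apply: ind => h; lra.
  move: (steinM x (w + dl)) (steinM x (w + u)) (stein x (w + u)) (stein x w) (Q x) ((x + dl < w)%R%:R) ((x <= w)%R%:R)
  => A B C D E F G *; nra.
have wu : w + u <= w by rewrite gerDl.
have := slope_le x wu; rewrite (_ : w - (w + u) = - u); last by ring.
have : steinM x w <= steinM x (w + dl) by apply: steinM_nondec; lra.
have : (x + dl < w)%R%:R <= (x <= w + u)%R%:R :> R.
  by apply: ind => h; lra.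
move: (steinM x (w + dl)) (steinM x w) (stein x (w + u)) (stein x w) (Q x) ((x + dl < w)%R%:R) ((x <= w + u)%R%:R)
  => A B C D E F G *; nra.
Qed.

Lemma stein_diff_lower x w u dl : `|u| <= dl ->
  u ^+ 2 * (steinM x (w - dl) + Q x - (x - dl < w)%R%:R) <=
  u * (stein x (w + u) - stein x w).
Proof.
rewrite ler_norml => /andP[ul uu].
have ind a : (x < a -> x - dl < w) -> (x < a)%R%:R <= (x - dl < w)%R%:R :> R.
  by have [_ ->|] := boolP (x < a); rewrite ?ler0n.
have [u0|/ltW u0] := leP 0 u.
  have wu : w <= w + u by rewrite lerDl.
  have := slope_ge x wu; rewrite (_ : w + u - w = u); last by ring.
  have : steinM x (w - dl) <= steinM x w by apply: steinM_nondec; lra.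
  have : (x < w + u)%R%:R <= (x - dl < w)%R%:R :> R by apply: ind => h; lra.
  move: (steinM x (w - dl)) (steinM x w) (stein x (w + u)) (stein x w) (Q x) ((x - dl < w)%R%:R) ((x < w + u)%R%:R)
  => A B C D E F G *; nra.
have wu : w + u <= w by rewrite gerDl.
have := slope_ge x wu; rewrite (_ : w - (w + u) = - u); last by ring.
have : steinM x (w - dl) <= steinM x (w + u) by apply: steinM_nondec; lra.
have : (x < w)%R%:R <= (x - dl < w)%R%:R :> R by apply: ind => h; lra.
move: (steinM x (w - dl)) (steinM x (w + u)) (stein x (w + u)) (stein x w) (Q x) ((x - dl < w)%R%:R) ((x < w)%R%:R)
  => A B C D E F G *; nra.
Qed.

End SteinSolution.

(** * Averages over a finite sample space *)

Section FiniteMean.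
Variables (R : realType) (T : finType).
Implicit Types f g : T -> R.

Definition mean f : R := (\sum_(w : T) f w) / #|T|%:R.
Definition prob (A : pred T) : R := mean (fun w => (A w)%:R).

Lemma eq_mean f g : f =1 g -> mean f = mean g.
Proof. by move=> fg; rewrite /mean; under eq_bigr do rewrite fg. Qed.

Lemma meanD f g : mean (fun w => f w + g w) = mean f + mean g.
Proof. by rewrite /mean big_split mulrDl. Qed.

Lemma meanZ c f : mean (fun w => c * f w) = c * mean f.
Proof. by rewrite /mean -mulr_sumr mulrA. Qed.

Lemma meanN f : mean (fun w => - f w) = - mean f.
Proof. by rewrite /mean sumrN mulNr. Qed.

Lemma meanB f g : mean (fun w => f w - g w) = mean f - mean g.
Proof. by rewrite meanD meanN. Qed.

Lemma mean_sum (I : finType) (F : I -> T -> R) :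
  mean (fun w => \sum_i F i w) = \sum_i mean (F i).
Proof. by rewrite /mean exchange_big mulr_suml. Qed.

Lemma ler_mean f g : (forall w, f w <= g w) -> mean f <= mean g.
Proof. by move=> fg; rewrite ler_wpM2r ?invr_ge0 ?ler0n// ler_sum. Qed.

Lemma mean_ge0 f : (forall w, 0 <= f w) -> 0 <= mean f.
Proof. by move=> f0; rewrite mulr_ge0 ?invr_ge0 ?ler0n// sumr_ge0. Qed.

Lemma mean_cst (t0 : T) c : mean (fun=> c) = c.
Proof.
rewrite /mean sumr_const -[c *+ _]mulr_natr mulfK// pnatr_eq0 -lt0n.
by apply/card_gt0P; exists t0.
Qed.

End FiniteMean.

Arguments prob {R T}.

(** * Growth of the Stein solution and relative variation of the Gaussian tail *)

Section SteinBound.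
Variable R : realType.
Implicit Types x u w : R.

(* [expR (w ^+ 2 / 2)] is dominated, up to a factor 2, by this sum, whose mean at a random
   variable only involves its moment generating function at the integers [j <= N]. *)
Definition expsum (N : nat) w : R := \sum_(j < N.+1) expR (j%:R * w - j%:R ^+ 2 / 2).

Lemma expsum_nondec N u w : u <= w -> expsum N u <= expsum N w.
Proof.
by move=> uw; apply: ler_sum => j _; rewrite ler_expR lerD2r ler_wpM2l.
Qed.

Lemma expsum_ge0 N w : 0 <= expsum N w.
Proof. by apply: sumr_ge0 => j _; exact: expR_ge0. Qed.

Lemma expsum_shift N w h : 0 <= h -> expsum N (w + h) <= expR (N%:R * h) * expsum N w.
Proof.
move=> h0; rewrite mulr_sumr; apply: ler_sum => j _.
rewrite -expRD ler_expR.
have : j%:R * h <= N%:R * h by rewrite ler_wpM2r// ler_nat -ltnS.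
lra.
Qed.

Lemma nat_above (N : nat) w : 0 <= w -> w <= N%:R ->
  exists2 j : nat, (j <= N)%N & w <= j%:R <= w + 1.
Proof.
move=> w0; elim: N => [|N IH] wN; first by exists 0%N => //; rewrite wN; lra.
have [/IH[j jN jw]|wN'] := leP w N%:R; first by exists j => //; rewrite leqW.
by exists N.+1 => //; rewrite wN -natr1; lra.
Qed.

(** Completing the square, [w ^+ 2 / 2] exceeds [j * w - j ^+ 2 / 2] by [(w - j) ^+ 2 / 2]; an
    integer [j] within 1 of [w] loses a factor of at most [expR (1 / 2) <= 2]. *)
Lemma expR_sqr_le_expsum (N : nat) w : w <= N%:R ->
  expR (pos_part w ^+ 2 / 2) <= 2 * expsum N w.
Proof.
move=> wN.
have term (j : nat) : (j <= N)%N -> expR (j%:R * w - j%:R ^+ 2 / 2) <= expsum N w.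
  move=> jN; have jN' : (j < N.+1)%N by [].
  rewrite /expsum (bigD1 (Ordinal jN'))//= lerDl.
  by apply: sumr_ge0 => i _; exact: expR_ge0.
have [w0|w0] := leP w 0.
  have -> : pos_part w = 0 by rewrite /pos_part max_r.
  have := term 0%N isT; rewrite expr0n/= !mul0r subr0 expR0; lra.
have -> : pos_part w = w by rewrite /pos_part max_l// ltW.
have [j jN /andP[j1 j2]] := nat_above (ltW w0) wN.
have : expR (w ^+ 2 / 2) <= expR (1 / 2) * expR (j%:R * w - j%:R ^+ 2 / 2).
  by rewrite -expRD ler_expR; nra.
have := term j jN; have := expR_half_le2 R; have := expR_ge0 (j%:R * w - j%:R ^+ 2 / 2).
by move: (expR _) (expR (1/2)) => A B *; nra.
Qed.

(** Turns bounds that lack the factor [Q x] into relative ones: for [x >= 1] the density is at most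
    [(1 + x ^+ 2) * Q x], and its inverse at most [3 * expR (x ^+ 2 / 2)]. *)
Lemma Q_lower x : 1 <= x -> 1 <= 3 * ((1 + x ^+ 2) * Q x) * expR (x ^+ 2 / 2).
Proof.
move=> x1; have g0 := gdens_gt0 x.
have gQ : gdens x <= (1 + x ^+ 2) * Q x.
  by apply: le_trans (mills_lower x); rewrite ler_peMl// ltW.
apply: (@le_trans _ _ (3 * gdens x * expR (x ^+ 2 / 2))); last first.
  by rewrite ler_wpM2r ?expR_ge0// ler_wpM2l.
by rewrite mulrAC -ler_pdivrMr// mul1r gdensV_le.
Qed.

(** Left of [x] the factor [Q x] is part of [stein], and 24 is the 12 of [mills_left_slope] doubled
    by [expR_sqr_le_expsum]. Right of [x] the slope is at most 1, and [Q_lower] supplies the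
    factor. *)
Lemma steinM_incr x (N : nat) u w : 1 <= x -> x <= N%:R -> u <= w ->
  steinM x w - steinM x u <= 24 * (1 + x ^+ 2) * Q x * expsum N w * (w - u).
Proof.
move=> x1 xN.
have x2 : 0 <= 1 + x ^+ 2 by rewrite addr_ge0// sqr_ge0.
have Q0 := Q_ge0 x.
have left a b : a <= b -> b <= x ->
    steinM x b - steinM x a <= 24 * (1 + x ^+ 2) * Q x * expsum N b * (b - a).
  move=> ab bx; have [c /andP[ac cb] ->] := steinM_slope_left ab bx.
  rewrite ler_wpM2r ?subr_ge0// mulrAC ler_wpM2r//.
  have := mills_left_slope x1 (le_trans cb bx).
  have := expR_sqr_le_expsum (le_trans cb (le_trans bx xN)).
  have := expsum_nondec N cb.
  move: (expsum N b) (expsum N c) (expR _) => A B E h1 h2 h3.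
  apply: (le_trans h3); rewrite -mulrA -[leRHS]mulrA.
  have : (1 + x ^+ 2) * E <= (1 + x ^+ 2) * (2 * A) by rewrite ler_wpM2l//; lra.
  lra.
have right a b : a <= b -> x <= a ->
    steinM x b - steinM x a <= 24 * (1 + x ^+ 2) * Q x * expsum N b * (b - a).
  move=> ab bx; have [c /andP[ac cb] ->] := steinM_slope_right ab bx.
  rewrite ler_wpM2r ?subr_ge0//.
  have c1 : 1 <= c by lra.
  have := @mills_right_upper R c; rewrite (lt_le_trans ltr01 c1) => /(_ isT).
  have : c^-1 <= 1 by rewrite invf_le1//; lra.
  move=> h1 h2; apply: (@le_trans _ _ 1).
    have := mills_right_lower c; have := Phi_le1 x; have := Phi_ge0 x.
    move: (_ - c) h2 => A; nra.
  apply: (le_trans (Q_lower x1)).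
  have := @expR_sqr_le_expsum N x xN.
  have -> : pos_part x = x by rewrite /pos_part max_l//; lra.
  have := expsum_nondec N (le_trans bx ab); have := expR_ge0 (x ^+ 2 / 2).
  move: (expsum N x) (expsum N b) (expR _) => A B E E0 h3 h4.
  have : ((1 + x ^+ 2) * Q x) * E <= ((1 + x ^+ 2) * Q x) * (2 * B).
    by rewrite ler_wpM2l ?mulr_ge0//; lra.
  have : 0 <= ((1 + x ^+ 2) * Q x) * E by rewrite !mulr_ge0.
  lra.
move=> uw; have [|/ltW xw] := leP w x; first exact: left.
have [|/ltW ux] := leP x u; first exact: right.
have := left _ _ ux (lexx x); have := right _ _ xw (lexx x).
have := expsum_nondec N xw; have : 0 <= 24 * (1 + x ^+ 2) * Q x by rewrite !mulr_ge0.
move: (24 * _ * _) (expsum N x) (expsum N w) (steinM x x) (steinM x u) (steinM x w)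
  => A B C D E F A0 BC.
have : A * B * (x - u) <= A * C * (x - u) by rewrite ler_wpM2r ?subr_ge0// ler_wpM2l.
lra.
Qed.

(** At [x] the density is at most [2 * x * Q x], and over a distance of at most [1 / x] it grows by
    at most [expR 1 <= 4]; hence the 8. *)
Lemma Q_ratio x x' kp : 1 <= x -> 0 <= x' -> `|x' - x| <= kp -> x * kp <= 1 ->
  `|Q x' - Q x| <= 8 * (x * kp) * Q x.
Proof.
move=> x1 x'0 xx' xk; have Q0 := Q_ge0 x.
have kp0 : 0 <= kp by apply: le_trans xx'.
have gQ : gdens x <= 2 * x * Q x.
  have := mills_lower x; have := gdens_gt0 x; nra.
have QM : 0 <= kp * (x * Q x) by rewrite !mulr_ge0//; lra.
have [xx|/ltW xx] := leP x x'.
  rewrite distrC ger0_norm ?subr_ge0 ?Q_noninc//.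
  have [c /andP[c1 c2] e] := MVT_le xx (fun t _ => is_derive_Q t).
  have gc : gdens c <= gdens x by apply: gdens_noninc => //; lra.
  have : gdens c * (x' - x) <= 2 * x * Q x * kp.
    apply: ler_pM => //; [exact/ltW/gdens_gt0|lra|lra|].
    exact: le_trans (ler_norm _) xx'.
  move: e; nra.
rewrite ger0_norm ?subr_ge0 ?Q_noninc//.
have [c /andP[c1 c2] e] := MVT_le xx (fun t _ => is_derive_Q t).
have gc : gdens c <= 4 * gdens x.
  apply: (@le_trans _ _ (gdens x')); first by apply: gdens_noninc.
  have -> : gdens x' = expR ((x ^+ 2 - x' ^+ 2) / 2) * gdens x.
    by rewrite /gdens mulrA -expRD; congr (expR _ / _); field.
  rewrite ler_wpM2r ?(ltW (gdens_gt0 _))//.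
  apply: (@le_trans _ _ (expR (1 / 2 + 1 / 2))).
    rewrite ler_expR; have : x - x' <= kp by apply: le_trans (ler_norm _) _; rewrite distrC.
    nra.
  by rewrite expRD; have := expR_half_le2 R; have := expR_ge0 (1/2 : R); nra.
have : gdens c * (x - x') <= 8 * x * Q x * kp.
  apply: ler_pM => //; [exact/ltW/gdens_gt0|lra|lra|].
  by apply: le_trans (ler_norm _) _; rewrite distrC.
move: e; nra.
Qed.

End SteinBound.

(** * Moderate deviations of sums of bounded independent variables *)

Section ModerateDeviations.
Variables (R : realType) (T : finType) (t0 : T) (m : nat).
Variables (xi : 'I_m -> T -> R) (W : T -> R) (dl : R).
Hypothesis W_sum : forall w, W w = \sum_i xi i w.
Hypothesis xi_indep : forall i (F G : R -> R),
  mean (fun w => F (xi i w) * G (W w - xi i w)) =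
  mean (fun w => F (xi i w)) * mean (fun w => G (W w - xi i w)).
Hypothesis xi_mean0 : forall i, mean (xi i) = 0.
Hypothesis xi_bound : forall i w, `|xi i w| <= dl.
Hypothesis xi_var : \sum_i mean (fun w => xi i w ^+ 2) = 1.

Let dl_ge0 : 0 <= dl.
Proof.
move: xi_var; case: m xi xi_bound => [|k] x hx; first by rewrite big_ord0 => /eqP; rewrite eq_sym oner_eq0.
by move=> _; apply: le_trans (hx ord0 t0).
Qed.

Let v i : R := mean (fun w => xi i w ^+ 2).

Let v_ge0 i : 0 <= v i. Proof. by apply: mean_ge0 => w; rewrite sqr_ge0. Qed.

Let W_loo_le i w : W w - xi i w <= W w + dl.
Proof. by have := xi_bound i w; rewrite ler_norml; lra. Qed.

Let W_loo_ge i w : W w - dl <= W w - xi i w.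
Proof. by have := xi_bound i w; rewrite ler_norml; lra. Qed.

(** [xi i] is centered and independent of [W - xi i], so [xi i w * f (W w - xi i w)] has mean 0 and
    may be subtracted. *)
Lemma mean_sum_mul (f : R -> R) : mean (fun w => W w * f (W w)) =
  \sum_i mean (fun w => xi i w * (f (W w - xi i w + xi i w) - f (W w - xi i w))).
Proof.
transitivity (\sum_i mean (fun w => xi i w * f (W w))).
  rewrite -mean_sum; apply: eq_mean => w.
  by rewrite W_sum mulr_suml -W_sum.
apply: eq_bigr => i _.
have e0 : mean (fun w => xi i w * f (W w - xi i w)) = 0.
  by rewrite (xi_indep i id f) xi_mean0 mul0r.
rewrite -[LHS]subr0 -e0 -meanB; apply: eq_mean => w.
by rewrite subrK mulrBr.
Qed.

Let mean_sqr_mul i (G : R -> R) :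
  mean (fun w => xi i w ^+ 2 * G (W w - xi i w)) = v i * mean (fun w => G (W w - xi i w)).
Proof. exact: (xi_indep i (fun u => u ^+ 2) G). Qed.

(** One [dl] of the shift comes from [stein_diff_upper], the other from replacing [W - xi i] by [W],
    after which the weights [v i] sum to 1. *)
Lemma prob_gt_upper x : prob (fun w => x + 2 * dl < W w) <=
  Q x + mean (fun w => steinM x (W w + 2 * dl) - steinM x (W w)).
Proof.
pose h u := steinM x (u + dl) + Q x - (x + dl < u)%R%:R : R.
pose h' u := steinM x (u + 2 * dl) + Q x - (x + 2 * dl < u)%R%:R : R.
have step i : mean (fun w => xi i w * (stein x (W w - xi i w + xi i w) - stein x (W w - xi i w))) <=
    v i * mean (fun w => h' (W w)).
  apply: (@le_trans _ _ (v i * mean (fun w => h (W w - xi i w)))).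
    rewrite -mean_sqr_mul; apply: ler_mean => w.
    exact: stein_diff_upper.
  rewrite ler_wpM2l//; apply: ler_mean => w; rewrite /h /h'.
  have := W_loo_le i w; have := W_loo_ge i w => h1 h2.
  apply: lerB; last first.
    rewrite ler_nat; have [h3|//] := boolP (_ < W w).
    by have -> : x + dl < W w - xi i w by lra.
  by rewrite lerD2r; apply: steinM_nondec; lra.
have : mean (fun w => steinM x (W w)) <= mean (fun w => h' (W w)).
  have -> : mean (fun w => steinM x (W w)) = mean (fun w => W w * stein x (W w)) by [].
  rewrite mean_sum_mul; apply: (@le_trans _ _ (\sum_i v i * mean (fun w => h' (W w)))).
    exact: ler_sum.
  by rewrite -mulr_suml xi_var mul1r.
rewrite {1}/h' (meanB (fun w => steinM x (W w + 2 * dl) + Q x)).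
by rewrite (meanD _ (fun=> Q x)) (mean_cst t0) meanB /prob; lra.
Qed.

Lemma prob_gt_lower x :
  Q x - mean (fun w => steinM x (W w) - steinM x (W w - 2 * dl)) <=
  prob (fun w => x - 2 * dl < W w).
Proof.
pose h u := steinM x (u - dl) + Q x - (x - dl < u)%R%:R : R.
pose h' u := steinM x (u - 2 * dl) + Q x - (x - 2 * dl < u)%R%:R : R.
have step i : v i * mean (fun w => h' (W w)) <=
   mean (fun w => xi i w * (stein x (W w - xi i w + xi i w) - stein x (W w - xi i w))).
  apply: (@le_trans _ _ (v i * mean (fun w => h (W w - xi i w)))); last first.
    rewrite -mean_sqr_mul; apply: ler_mean => w.
    exact: stein_diff_lower.
  rewrite ler_wpM2l//; apply: ler_mean => w; rewrite /h /h'.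
  have := W_loo_le i w; have := W_loo_ge i w => h1 h2.
  apply: lerB; last first.
    rewrite ler_nat; have [h3|//] := boolP (_ < W w - _).
    by have -> : x - 2 * dl < W w by lra.
  by rewrite lerD2r; apply: steinM_nondec; lra.
have : mean (fun w => h' (W w)) <= mean (fun w => steinM x (W w)).
  have -> : mean (fun w => steinM x (W w)) = mean (fun w => W w * stein x (W w)) by [].
  rewrite mean_sum_mul; apply: (@le_trans _ _ (\sum_i v i * mean (fun w => h' (W w)))).
    by rewrite -mulr_suml xi_var mul1r.
  exact: ler_sum.
rewrite {1}/h' (meanB (fun w => steinM x (W w - 2 * dl) + Q x)).
by rewrite (meanD _ (fun=> Q x)) (mean_cst t0) meanB /prob; lra.
Qed.

Let exp_diff (s a u : R) : 0 <= s -> `|u| <= dl ->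
  u * (expR (s * (a + u)) - expR (s * a)) <= s * (u ^+ 2 * expR (s * (a + dl))).
Proof.
move=> s0; rewrite ler_norml => /andP[ul uu].
have ed : expR (s * a) <= expR (s * (a + dl)) by rewrite ler_expR; nra.
have eu : expR (s * (a + u)) <= expR (s * (a + dl)) by rewrite ler_expR; nra.
have d1 : expR (s * (a + u)) - expR (s * a) <= s * u * expR (s * (a + u)).
  have := expR_ge1Dx (- (s * u)); have -> : expR (s * a) = expR (- (s * u)) * expR (s * (a + u)).
    by rewrite -expRD; congr expR; ring.
  have := expR_ge0 (s * (a + u)); nra.
have d2 : s * u * expR (s * a) <= expR (s * (a + u)) - expR (s * a).
  have := expR_ge1Dx (s * u); have -> : expR (s * (a + u)) = expR (s * u) * expR (s * a).
    by rewrite -expRD; congr expR; ring.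
  have := expR_ge0 (s * a); nra.
have [u0|u0] := leP 0 u.
  have : u * (s * u * expR (s * (a + u))) <= u * (s * u * expR (s * (a + dl))).
    by rewrite ler_wpM2l// ler_wpM2l// mulr_ge0.
  have : u * (expR (s * (a + u)) - expR (s * a)) <= u * (s * u * expR (s * (a + u))).
    by rewrite ler_wpM2l.
  by rewrite expr2; lra.
have : (s * u ^+ 2) * expR (s * a) <= (s * u ^+ 2) * expR (s * (a + dl)).
  by rewrite ler_wpM2l// mulr_ge0// sqr_ge0.
have : u * (expR (s * (a + u)) - expR (s * a)) <= u * (s * u * expR (s * a)).
  by rewrite ler_wnM2l// ltW.
by rewrite expr2; lra.
Qed.

(** The left-hand side is the derivative of the moment generating function. The leave-one-out
    identity, applied to exponentials, gives a differential inequality close to the Gaussian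
    equation [M' = s * M]. *)
Lemma mgf_deriv_bound s : 0 <= s -> mean (fun w => W w * expR (s * W w)) <=
  s * expR (2 * s * dl) * mean (fun w => expR (s * W w)).
Proof.
move=> s0; rewrite (mean_sum_mul (fun u => expR (s * u))).
apply: (@le_trans _ _ (\sum_i v i * (s * expR (2 * s * dl) * mean (fun w => expR (s * W w))))).
  apply: ler_sum => i _.
  apply: (@le_trans _ _ (s * (v i * mean (fun w => expR (s * (W w - xi i w + dl)))))).
    rewrite -(mean_sqr_mul i (fun u => expR (s * (u + dl)))) -meanZ.
    by apply: ler_mean => w; exact: exp_diff.
  rewrite mulrCA ler_wpM2l// -mulrA ler_wpM2l// -meanZ.
  apply: ler_mean => w; rewrite -expRD ler_expR.
  have := W_loo_le i w; nra.
by rewrite -mulr_suml xi_var mul1r.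
Qed.

Let is_derive_mean (s : R) : is_derive s 1 (fun s => mean (fun w => expR (s * W w)))
  (mean (fun w => W w * expR (s * W w))).
Proof.
have d w : is_derive s 1 (fun s : R => expR (s * W w)) (W w * expR (s * W w)).
  by apply: is_derive_eq; rewrite /GRing.scale/=; ring.
have ds : is_derive s 1 (fun s : R => \sum_w expR (s * W w)) (\sum_w W w * expR (s * W w)).
  elim: (index_enum T) => [|w r IH].
    have -> : (fun s : R => \sum_(w <- [::]) expR (s * W w)) = cst 0.
      by apply/funext => z; rewrite big_nil.
    by rewrite big_nil; exact: is_derive_cst.
  have -> : (fun s : R => \sum_(w <- w :: r) expR (s * W w)) =
      (fun s => expR (s * W w)) + (fun s => \sum_(w <- r) expR (s * W w)).
    by apply/funext => z; rewrite big_cons.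
  by rewrite big_cons; apply: is_deriveD.
rewrite /mean; apply: is_derive_eq; rewrite /GRing.scale/=; ring.
Qed.

(** Gronwall's argument: the moment generating function divided by the Gaussian one of variance [K]
    is nonincreasing. *)
Lemma mgf_bound S s : 0 <= s <= S ->
  mean (fun w => expR (s * W w)) <= expR (expR (2 * S * dl) * s ^+ 2 / 2).
Proof.
move=> /andP[s0 sS]; set K := expR (2 * S * dl).
pose F z := mean (fun w => expR (z * W w)) * expR (- (K / 2) * (z * z)).
have dF (z : R) : is_derive z 1 F
   ((mean (fun w => W w * expR (z * W w)) - K * z * mean (fun w => expR (z * W w)))
     * expR (- (K / 2) * (z * z))).
  have := is_derive_mean z.
  by move=> ?; rewrite /F; apply: is_derive_eq; rewrite /GRing.scale/=; field.
have : F s <= F 0.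
  apply: (derive_noninc s0 (fun z _ => dF z)) => z /andP[z0 zs].
  rewrite mulr_le0_ge0 ?expR_ge0// subr_le0.
  apply: (le_trans (mgf_deriv_bound z0)); rewrite ler_wpM2r//.
    by apply: mean_ge0 => w; exact: expR_ge0.
  rewrite mulrC ler_wpM2r// /K ler_expR ler_wpM2r// ler_wpM2l//; lra.
rewrite /F mul0r mulr0 expR0 mulr1.
under [X in _ <= X]eq_mean do rewrite mul0r expR0.
rewrite (mean_cst t0) mulNr expRN ler_pdivrMr ?expR_gt0// mul1r.
by rewrite expr2 mulrAC.
Qed.

Let expR_le_lin (y : R) : 0 <= y <= 1 / 2 -> expR y <= 1 + 2 * y.
Proof.
move=> /andP[y0 y1]; have := expR_ge1Dx (- y); have := expRxMexpNx_1 y.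
have := expR_gt0 y; move: (expR y) (expR (- y)) => a b a0 ab b1.
have : a * (1 - y) <= 1 by rewrite -[leRHS]ab ler_wpM2l// ltW.
by move=> ?; nra.
Qed.

(** Each term has mean at most [expR ((K - 1) * j ^+ 2 / 2)] with [K = expR (2 * N * dl)]. Since
    [K - 1 <= 4 * N * dl], the exponent is at most [2 * N ^+ 3 * dl <= 1 / 2]: this is the origin of
    the cubic smallness condition. *)
Lemma mean_expsum_le (N : nat) : 1 <= N%:R :> R -> N%:R ^+ 3 * dl <= 1 / 4 ->
  mean (fun w => expsum N (W w)) <= 4 * N.+1%:R.
Proof.
move=> N1 Nd; rewrite mean_sum; apply: (@le_trans _ _ (\sum_(j < N.+1) 4)); last first.
  by rewrite sumr_const card_ord mulr_natr.
apply: ler_sum => j _.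
have jN : j%:R <= N%:R :> R by rewrite ler_nat -ltnS.
have j2N : j%:R ^+ 2 <= N%:R ^+ 2 :> R by rewrite ler_pXn2r ?nnegrE.
have e4 : expR 1 <= 4 :> R.
  rewrite (_ : 1 = 1 / 2 + 1 / 2 :> R); last by field.
  by rewrite expRD; have := expR_half_le2 R; have := expR_ge0 (1 / 2 : R); nra.
apply: le_trans e4.
have -> : mean (fun w => expR (j%:R * W w - j%:R ^+ 2 / 2)) =
    expR (- (j%:R ^+ 2 / 2)) * mean (fun w => expR (j%:R * W w)).
  by rewrite -meanZ; apply: eq_mean => w; rewrite -expRD addrC.
have Nd2 : N%:R * dl <= N%:R ^+ 3 * dl by rewrite ler_wpM2r// exprS ler_peMr// expr_ge1.
have K2 : expR (2 * N%:R * dl) <= 1 + 4 * (N%:R * dl).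
  have := @expR_le_lin (2 * N%:R * dl); rewrite -mulrA.
  have z0 : 0 <= N%:R * dl by rewrite mulr_ge0.
  have zi : 0 <= 2 * (N%:R * dl) <= 1 / 2 by lra.
  by move=> /(_ zi); lra.
have := @mgf_bound N%:R j%:R; rewrite ler0n jN => /(_ isT) h.
apply: (le_trans (ler_wpM2l (expR_ge0 _) h)); rewrite -expRD ler_expR.
have : expR (2 * N%:R * dl) * j%:R ^+ 2 <= (1 + 4 * (N%:R * dl)) * j%:R ^+ 2.
  by rewrite ler_wpM2r// sqr_ge0.
have : N%:R * dl * j%:R ^+ 2 <= N%:R * dl * N%:R ^+ 2 by rewrite ler_wpM2l// mulr_ge0.
have -> : N%:R * dl * N%:R ^+ 2 = N%:R ^+ 3 * dl by ring.
lra.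
Qed.

Variable x : R.
Hypotheses (x1 : 1 <= x) (xdl : x ^+ 3 * dl <= 1 / 32).

Let nat_near : exists2 N : nat, x <= N%:R & N%:R <= x + 1.
Proof.
have x0 : 0 <= x := le_trans ler01 x1.
have [N _ /andP[]] := nat_above x0 (ltW (archi_boundP x0)); by exists N.
Qed.

Let steinM_mean_incr (N : nat) (u w : T -> R) B : x <= N%:R ->
  (forall t, u t <= w t) -> (forall t, w t - u t <= 2 * dl) ->
  mean (fun t => expsum N (w t)) <= B ->
  mean (fun t => steinM x (w t) - steinM x (u t)) <= 96 * x ^+ 2 * dl * Q x * B.
Proof.
move=> xN uw wu hB; set C := 24 * (1 + x ^+ 2) * Q x.
have C0 : 0 <= C by rewrite !mulr_ge0 ?Q_ge0// addr_ge0// sqr_ge0.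
apply: (@le_trans _ _ (C * (2 * dl) * mean (fun t => expsum N (w t)))).
  rewrite -meanZ; apply: ler_mean => t; apply: le_trans (steinM_incr x1 xN (uw t)) _.
  by rewrite -/C mulrAC ler_wpM2r ?expsum_ge0// ler_wpM2l.
have B0 : 0 <= B by apply: le_trans hB; apply: mean_ge0 => t; exact: expsum_ge0.
apply: (@le_trans _ _ (C * (2 * dl) * B)); first by rewrite ler_wpM2l// mulr_ge0// mulr_ge0.
have -> : 96 * x ^+ 2 * dl * Q x * B = (48 * (2 * x ^+ 2)) * (dl * Q x * B) by ring.
have -> : C * (2 * dl) * B = (48 * (1 + x ^+ 2)) * (dl * Q x * B) by rewrite /C; ring.
by rewrite ler_wpM2r ?mulr_ge0 ?Q_ge0//; have := x1; nra.
Qed.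

(** With [N <= x + 1 <= 2 * x], the bound 1 / 32 on [x ^+ 3 * dl] becomes [8 / 32 = 1 / 4] for [N],
    as [mean_expsum_le] asks. *)
Let Nbound (N : nat) : x <= N%:R -> N%:R <= x + 1 ->
  [/\ N%:R ^+ 3 * dl <= 1 / 4, 4 * N.+1%:R <= 12 * x & N%:R * (2 * dl) <= 1 / 2].
Proof.
move=> xN Nx; have x1' := x1; have xdl' := xdl.
have N3 : N%:R ^+ 3 <= 8 * x ^+ 3 :> R.
  have -> : 8 * x ^+ 3 = (2 * x) ^+ 3 by ring.
  by rewrite ler_pXn2r ?nnegrE//; lra.
have N1 : 1 <= N%:R :> R by lra.
have Nd : N%:R ^+ 3 * dl <= 1 / 4 by have := ler_wpM2r dl_ge0 N3; lra.
have Nd2 : N%:R * dl <= N%:R ^+ 3 * dl by rewrite ler_wpM2r// exprS ler_peMr// expr_ge1.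
by split => //; [rewrite -natr1; lra|lra].
Qed.

(** Two powers of [x] come from the slope of [steinM], the third from the number of terms of
    [expsum]. The constant is [96 * 2 * 12 = 2304] rounded up, the 2 paying for the shift of [W] by
    [2 * dl]. *)
Lemma moderate_upper : prob (fun w => x + 2 * dl < W w) <= Q x * (1 + 2400 * (x ^+ 3 * dl)).
Proof.
have x1' := x1; have d0 := dl_ge0; have [N xN Nx] := nat_near; have [Nd N4 Nh] := Nbound xN Nx.
apply: (le_trans (prob_gt_upper x)).
have : mean (fun t => expsum N (W t + 2 * dl)) <= 2 * (12 * x).
  apply: (@le_trans _ _ (2 * mean (fun t => expsum N (W t)))); last first.
    by rewrite ler_wpM2l// (le_trans (mean_expsum_le _ Nd))//; lra.
  rewrite -meanZ; apply: ler_mean => t.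
  apply: (le_trans (expsum_shift _ _ _)); first by rewrite mulr_ge0.
  rewrite ler_wpM2r ?expsum_ge0//; apply: le_trans (expR_half_le2 R).
  by rewrite ler_expR.
move=> /(steinM_mean_incr (u := W) xN) h.
have Q0 := Q_ge0 x.
have : mean (fun t => steinM x (W t + 2 * dl) - steinM x (W t)) <=
    96 * x ^+ 2 * dl * Q x * (2 * (12 * x)).
  by apply: h => t; lra.
have -> : 96 * x ^+ 2 * dl * Q x * (2 * (12 * x)) = 2304 * (x ^+ 3 * dl * Q x) by ring.
have : 0 <= x ^+ 3 * dl * Q x by rewrite !mulr_ge0//; lra.
lra.
Qed.

Lemma moderate_lower : Q x * (1 - 2400 * (x ^+ 3 * dl)) <= prob (fun w => x - 2 * dl < W w).
Proof.
have x1' := x1; have d0 := dl_ge0; have [N xN Nx] := nat_near; have [Nd N4 Nh] := Nbound xN Nx.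
apply: le_trans (prob_gt_lower x).
have N1 : 1 <= N%:R :> R by lra.
have h := steinM_mean_incr (u := fun t => W t - 2 * dl) xN _ _
  (le_trans (mean_expsum_le N1 Nd) N4).
have : mean (fun t => steinM x (W t) - steinM x (W t - 2 * dl)) <=
    96 * x ^+ 2 * dl * Q x * (12 * x).
  by apply: h => t; lra.
have Q0 := Q_ge0 x.
have -> : 96 * x ^+ 2 * dl * Q x * (12 * x) = 1152 * (x ^+ 3 * dl * Q x) by ring.
have : 0 <= x ^+ 3 * dl * Q x by rewrite !mulr_ge0//; lra.
lra.
Qed.

End ModerateDeviations.

(** * Bounded differences and influences on the discrete cube *)

Section CauchySchwarz.
Variables (R : realType) (T : finType).
Implicit Types X Y : T -> R.

Lemma mean_cauchy_schwarz X Y : mean (fun w => X w * Y w) ^+ 2 <=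
  mean (fun w => X w ^+ 2) * mean (fun w => Y w ^+ 2).
Proof.
set a := mean (fun w => X w * Y w); set A := mean _; set b := mean (fun w => Y w ^+ 2).
have quad t : 0 <= A - 2 * t * a + t ^+ 2 * b.
  have -> : A - 2 * t * a + t ^+ 2 * b = mean (fun w => (X w - t * Y w) ^+ 2).
    rewrite /A /a /b -!meanZ -meanB -meanD; apply: eq_mean => w; ring.
  by apply: mean_ge0 => w; exact: sqr_ge0.
have b0 : 0 <= b by apply: mean_ge0 => w; exact: sqr_ge0.
have [b00|bp] := eqVneq b 0.
  have [->|a0] := eqVneq a 0; first by rewrite b00 mulr0 expr0n.
  have := quad ((A + 1) / (2 * a)); rewrite b00 mulr0 addr0.
  have -> : 2 * ((A + 1) / (2 * a)) * a = A + 1 by field.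
  lra.
have := quad (a / b); have -> : A - 2 * (a / b) * a + (a / b) ^+ 2 * b = A - a ^+ 2 / b by field.
by rewrite subr_ge0 ler_pdivrMr// lt_neqAle eq_sym bp.
Qed.

End CauchySchwarz.

Section ProductSpace.
Variables (R : realType) (E : finType).
Let Om := {ffun E -> bool}.
Implicit Types (A B C : pred E) (w u : Om) (f g : Om -> R).

Definition cfg0 : Om := [ffun=> false].

Definition mix A w u : Om := [ffun e => if A e then w e else u e].

Definition depends (X : Type) A (f : Om -> X) :=
  forall w u, (forall e, A e -> w e = u e) -> f w = f u.

Definition varies A f (c : R) :=
  forall w u, (forall e, ~~ A e -> w e = u e) -> `|f w - f u| <= c.

(** Exchanging the coordinates outside [A] between two copies is an involution of pairs, hence
    preserves their uniform law. Independence and conditional averaging both reduce to this. *)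
Lemma sum_mix A (F : Om -> Om -> R) :
  \sum_w \sum_u F (mix A w u) (mix A u w) = \sum_w \sum_u F w u.
Proof.
rewrite !pair_bigA /=.
pose h (p : Om * Om) := (mix A p.1 p.2, mix A p.2 p.1).
have hK : involutive h.
  by move=> [w u]; rewrite /h /=; congr pair; apply/ffunP => e; rewrite !ffunE; case: (A e).
by rewrite [RHS](reindex_inj (inv_inj hK)).
Qed.

Lemma mean_mix A (F : Om -> Om -> R) :
  mean (fun w => mean (fun u => F (mix A w u) (mix A u w))) =
  mean (fun w => mean (fun u => F w u)).
Proof. by rewrite /mean -!mulr_suml sum_mix. Qed.

Lemma mean_indep A f g : depends A f -> depends (predC A) g ->
  mean (fun w => f w * g w) = mean f * mean g.
Proof.
move=> df dg; transitivity (mean (fun w : Om => mean (fun _ : Om => f w * g w))).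
  by apply: eq_mean => w; rewrite (mean_cst cfg0).
rewrite -(mean_mix A) mulrC -meanZ; apply: eq_mean => w.
rewrite mulrC -meanZ; apply: eq_mean => u; congr (_ * _).
  by apply: df => e Ae; rewrite ffunE Ae.
by apply: dg => e /= /negbTE Ae; rewrite ffunE Ae.
Qed.

(** Conditional expectation given the coordinates outside [A]. *)
Definition avg A f w : R := mean (fun u => f (mix A u w)).

Lemma mean_avg A f : mean (avg A f) = mean f.
Proof.
rewrite -[RHS](_ : mean (fun w => mean (fun _ : Om => f w)) = _); last first.
  by apply: eq_mean => w; rewrite (mean_cst cfg0).
rewrite -(mean_mix (predC A)); apply: eq_mean => w; apply: eq_mean => u; congr f.
by apply/ffunP => e; rewrite !ffunE /=; case: (A e).
Qed.

Lemma depends_avg A B C f : depends B f -> (forall e, B e -> ~~ A e -> C e) ->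
  depends C (avg A f).
Proof.
move=> df sub w u wu; apply: eq_mean => v; apply: df => e Be; rewrite !ffunE.
by case: ifPn => // Ae; apply/wu/sub.
Qed.

Lemma norm_mean_le (T : finType) (t0 : T) (f : T -> R) (c : R) :
  (forall t, `|f t| <= c) -> `|mean f| <= c.
Proof.
move=> fc; rewrite ler_norml -{1}(mean_cst t0 c) -meanN -{2}(mean_cst t0 c).
by apply/andP; split; apply: ler_mean => t; have := fc t; rewrite ler_norml => /andP[].
Qed.

Lemma varies_avg A B f c : varies B f c -> varies B (avg A f) c.
Proof.
move=> vf w u wu; rewrite -meanB; apply: (norm_mean_le cfg0) => v.
by apply: vf => e Be; rewrite !ffunE; case: ifP => // _; exact: wu.
Qed.

(** The linear term vanishes under a centered mean and leaves a subgaussian bound. The constant is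
    weaker than in Hoeffding's lemma, which keeps the estimates elementary. *)
Lemma expR_le_add_sqr (y : R) : expR y <= y + expR (2 * y ^+ 2).
Proof.
have e2 := expR_ge1Dx (2 * y ^+ 2).
have [y1|y1] := leP 1 y.
  have : expR y <= expR (2 * y ^+ 2) by rewrite ler_expR; nra.
  lra.
have [y0|y0] := leP y 0.
  have [y2|y2] := leP y (- 1).
    have : expR y <= 1 by rewrite -expR0 ler_expR; lra.
    by have := sqr_ge0 (y + 1); nra.
  have ey : expR y * (1 - y) <= 1.
    apply: (@le_trans _ _ (expR y * expR (- y))); last by rewrite expRxMexpNx_1.
    by rewrite ler_wpM2l ?expR_ge0//; apply: expR_ge1Dx.
  suff : expR y <= 1 + y + 2 * y ^+ 2 by lra.
  rewrite -(@ler_pM2r _ (1 - y)); last lra.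
  by apply: (le_trans ey); nra.
have e : expR (y / 2) * (1 - y / 2) <= 1.
  apply: (@le_trans _ _ (expR (y / 2) * expR (- (y / 2)))); last by rewrite expRxMexpNx_1.
  by rewrite ler_wpM2l ?expR_ge0//; apply: expR_ge1Dx.
suff : expR y <= 1 + y + 2 * y ^+ 2 by lra.
have -> : expR y = expR (y / 2) ^+ 2.
  by rewrite expr2 -expRD; congr expR; field.
have h0 : 0 < 1 - y / 2 by lra.
rewrite -(@ler_pM2r _ ((1 - y / 2) ^+ 2)); last by rewrite exprn_gt0.
rewrite -exprMn; apply: (@le_trans _ _ 1).
  by rewrite expr_le1// mulr_ge0// ?expR_ge0 ?ltW.
have : 0 <= y ^+ 2 * ((1 - y) * (5 / 4 - y / 2)).
  by rewrite mulr_ge0 ?sqr_ge0// mulr_ge0//; lra.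
lra.
Qed.

Lemma mean_expR_avg A f c l : varies A f c -> mean (fun w => expR (l * f w)) <=
  expR (2 * (l * c) ^+ 2) * mean (fun w => expR (l * avg A f w)).
Proof.
move=> vf; rewrite -(mean_avg A) -meanZ; apply: ler_mean => w.
rewrite mulrC; set mu := avg A f w.
have dev u : `|f (mix A u w) - mu| <= c.
  have -> : f (mix A u w) - mu = mean (fun v => f (mix A u w) - f (mix A v w)).
    by rewrite meanB (mean_cst cfg0).
  apply: (norm_mean_le cfg0) => v; apply: vf => e /negbTE Ae.
  by rewrite !ffunE Ae.
rewrite [leLHS](_ : _ = expR (l * mu) * mean (fun u => expR (l * (f (mix A u w) - mu)))); last first.
  rewrite -meanZ; apply: eq_mean => u; rewrite -expRD; congr expR; ring.
rewrite ler_wpM2l ?expR_ge0//.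
apply: (@le_trans _ _ (mean (fun u => l * (f (mix A u w) - mu) + expR (2 * (l * c) ^+ 2)))).
  apply: ler_mean => u; apply: (le_trans (expR_le_add_sqr _)); rewrite lerD2l ler_expR.
  rewrite ler_wpM2l// !exprMn ler_wpM2l ?sqr_ge0//.
  have c0 : 0 <= c by apply: le_trans (dev w).
  by rewrite -real_normK ?num_real// ler_pXn2r ?nnegrE.
rewrite (meanD (fun u => l * (f (mix A u w) - mu))) (mean_cst cfg0) meanZ meanB (mean_cst cfg0).
by rewrite subrr mulr0 add0r.
Qed.

(** A martingale argument written as an induction: averaging over the last group leaves a function
    of the earlier groups with the same oscillation bounds, at the cost of one factor
    [expR (2 * (l * c) ^+ 2)]. *)
Lemma bounded_difference_mgf (grp : E -> nat) (N : nat) f c l :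
  depends [pred e | grp e < N]%N f ->
  (forall j, (j < N)%N -> varies [pred e | grp e == j] f c) ->
  mean (fun w => expR (l * (f w - mean f))) <= expR (2 * N%:R * (l * c) ^+ 2).
Proof.
elim: N f => [|N IH] f df vf.
  have fE w : f w = mean f.
    by rewrite -(mean_cst cfg0 (f w)); apply: eq_mean => u; apply: df.
  rewrite mulr0 mul0r expR0 (eq_mean (g := fun=> 1)) ?(mean_cst cfg0)// => w.
  by rewrite fE subrr mulr0 expR0.
pose g := avg [pred e | grp e == N] f.
have := IH g; rewrite mean_avg => h.
have {h} : mean (fun w => expR (l * (g w - mean f))) <= expR (2 * N%:R * (l * c) ^+ 2).
  apply: h => [|j jN].
    by apply: depends_avg df _ => e /=; rewrite ltnS leq_eqVlt => /orP[/eqP ->|//]; rewrite eqxx.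
  by apply: varies_avg; apply: vf; rewrite ltnW.
move=> h; have vN : varies [pred e | grp e == N] f c by exact: vf.
have sh (k : Om -> R) : mean (fun w => expR (l * (k w - mean f))) =
    expR (- (l * mean f)) * mean (fun w => expR (l * k w)).
  by rewrite -meanZ; apply: eq_mean => w; rewrite -expRD; congr expR; ring.
rewrite sh; apply: (le_trans (ler_wpM2l (expR_ge0 _) (mean_expR_avg l vN))).
rewrite mulrCA -sh; apply: (le_trans (ler_wpM2l (expR_ge0 _) h)).
by rewrite -expRD ler_expR -natr1; lra.
Qed.

Lemma prob_markov_exp f (u : R) : prob (fun w => u < f w) <=
  expR (- u) * mean (fun w => expR (f w)).
Proof.
rewrite -meanZ; apply: ler_mean => w; rewrite -expRD.
have [uf|_] := boolP (u < f w); last exact: expR_ge0.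
by rewrite -expR0 ler_expR; lra.
Qed.

Lemma bounded_difference_tail (grp : E -> nat) (N : nat) f c s :
  depends [pred e | grp e < N]%N f ->
  (forall j, (j < N)%N -> varies [pred e | grp e == j] f c) -> (0 < N)%N -> 0 < c -> 0 < s ->
  prob (fun w => 3 * s * (c * Num.sqrt N%:R) < `|f w - mean f|) <= 2 * expR (- s ^+ 2).
Proof.
move=> df vf N0 c0 s0; set r := Num.sqrt _.
have r0 : 0 < r by rewrite sqrtr_gt0 ltr0n.
have r2 : r ^+ 2 = N%:R by rewrite sqr_sqrtr.
(* Chernoff's bound: the moment generating function contributes [2 * s ^+ 2] to the exponent and the
   threshold [- 3 * s ^+ 2]. *)
have half l : `|l| = s / (c * r) ->
    prob (fun w => 3 * s ^+ 2 < l * (f w - mean f)) <= expR (- s ^+ 2).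
  move=> hl; apply: (le_trans (prob_markov_exp _ _)).
  apply: (le_trans (ler_wpM2l (expR_ge0 _) (bounded_difference_mgf l df vf))).
  rewrite -expRD ler_expR exprMn -(real_normK (num_real l)) hl -r2.
  have -> : 2 * r ^+ 2 * ((s / (c * r)) ^+ 2 * c ^+ 2) = 2 * s ^+ 2.
    by field; rewrite !gt_eqF.
  lra.
have cr0 : 0 < c * r by rewrite mulr_gt0.
have hl : 0 < s / (c * r) by rewrite divr_gt0.
apply: (@le_trans _ _ (prob (fun w => (3 * s ^+ 2 < s / (c * r) * (f w - mean f))) +
   prob (fun w => 3 * s ^+ 2 < - (s / (c * r)) * (f w - mean f)))).
  rewrite -meanD; apply: ler_mean => w; rewrite -natrD ler_nat.
  have [|//] := boolP (_ < `|_|); have -> : 3 * s ^+ 2 = s / (c * r) * (3 * s * (c * r)).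
    by field; rewrite !gt_eqF.
  rewrite mulNr -mulrN !ltr_pM2l//; have [d0|d0] := leP 0 (f w - mean f).
    by rewrite ger0_norm// => ->.
  by rewrite ltr0_norm// => ->; rewrite addn1.
have := half (s / (c * r)) (ger0_norm (ltW hl)).
have := half (- (s / (c * r))); rewrite normrN => /(_ (ger0_norm (ltW hl))).
lra.
Qed.

End ProductSpace.

(** * Influences and the variance *)

Section Influence.
Variables (R : realType) (E : finType).
Let Om := {ffun E -> bool}.
Implicit Types (w : Om) (f : Om -> R) (e : E).

Definition flip e w : Om := [ffun e' => if e' == e then ~~ w e' else w e'].
Definition lower e w : Om := [ffun e' => if e' == e then false else w e'].

Lemma flipK e : involutive (flip e).
Proof. by move=> w; apply/ffunP => i; rewrite !ffunE; case: eqP => //; rewrite negbK. Qed.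

Lemma mean_flip e f : mean (fun w => f (flip e w)) = mean f.
Proof. by rewrite /mean [in RHS](reindex_inj (inv_inj (flipK e))). Qed.

Let chi e w : R := if w e then 1 else -1.

Let chi_flip e e' w : chi e (flip e' w) = if e == e' then - chi e w else chi e w.
Proof. by rewrite /chi ffunE; case: eqP => // _; case: (w e) => //=; rewrite opprK. Qed.

Let mean_chi e : mean (chi e) = 0.
Proof.
have : mean (chi e) = - mean (chi e).
  by rewrite -{1}(mean_flip e) -meanN; apply: eq_mean => w; rewrite chi_flip eqxx.
lra.
Qed.

Let mean_chi2 e e' : mean (fun w => chi e w * chi e' w) = (e == e')%:R.
Proof.
have [->|ee'] := eqVneq e e'.
  rewrite -[RHS](mean_cst (cfg0 E)); apply: eq_mean => w.
  by rewrite /chi; case: ifP => _; rewrite ?mulr1 ?mulrNN ?mulr1.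
have : mean (fun w => chi e w * chi e' w) = - mean (fun w => chi e w * chi e' w).
  rewrite -{1}(mean_flip e) -meanN; apply: eq_mean => w.
  by rewrite !chi_flip eqxx eq_sym (negbTE ee') mulNr.
rewrite /=; lra.
Qed.

(** A Fourier coefficient of degree one, the mean of [f * chi e]. Written with [lower], it involves
    only configurations with [e] set to [true], so that savings along a crossing bound it from
    below. *)
Definition influence f e : R := mean (fun w => (w e)%:R * (f w - f (lower e w))).

Let mean_mul_chi f e : mean (fun w => f w * chi e w) = influence f e.
Proof.
pose D w := (w e)%:R * (f w - f (lower e w)).
have sym : mean (fun w => f w * chi e w + f (flip e w) * chi e (flip e w)) =
    mean (fun w => D w + D (flip e w)).
  apply: eq_mean => w; rewrite chi_flip eqxx /chi /D !ffunE eqxx.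
  case we : (w e) => /=.
    rewrite (_ : lower e w = flip e w) ?mul0r; first by ring.
    by apply/ffunP => i; rewrite !ffunE; case: eqP => // ->; rewrite we.
  rewrite (_ : lower e (flip e w) = w) ?mul0r; first by ring.
  by apply/ffunP => i; rewrite !ffunE; case: eqP => // ->; rewrite we.
move: sym; rewrite !meanD (mean_flip e (fun w => f w * chi e w)) (mean_flip e D).
rewrite /influence -/D; lra.
Qed.

(** The characters [chi e] are orthonormal, so their sum has second moment [#|E|]; Cauchy-Schwarz
    pairs it with the centered [f]. *)
Lemma influence_variance f : (\sum_e influence f e) ^+ 2 <=
  #|E|%:R * mean (fun w => (f w - mean f) ^+ 2).
Proof.
pose S w := \sum_e chi e w.
have S2 : mean (fun w => S w ^+ 2) = #|E|%:R.
  have -> : mean (fun w => S w ^+ 2) = \sum_e \sum_e' mean (fun w => chi e w * chi e' w).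
    rewrite (eq_mean (g := fun w => \sum_e \sum_e' chi e w * chi e' w)).
      by rewrite mean_sum; apply: eq_bigr => e _; rewrite mean_sum.
    by move=> w; rewrite expr2 mulr_suml; apply: eq_bigr => e _; rewrite mulr_sumr.
  rewrite -sum1_card natr_sum; apply: eq_bigr => e _.
  rewrite (bigD1 e)//= mean_chi2 eqxx big1 ?addr0// => e' ee'.
  by rewrite mean_chi2 eq_sym (negbTE ee').
have fS : mean (fun w => (f w - mean f) * S w) = \sum_e influence f e.
  rewrite (eq_mean (g := fun w => (\sum_e f w * chi e w) - mean f * \sum_e chi e w)); last first.
    by move=> w; rewrite mulrBl -mulr_sumr.
  rewrite meanB meanZ !mean_sum [X in _ * X]big1 ?mulr0 ?subr0//.
  by apply: eq_bigr => e _; rewrite mean_mul_chi.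
by rewrite -fS mulrC -S2; apply: mean_cauchy_schwarz.
Qed.

End Influence.

(** * Crossing times of strips *)

Lemma nn_adjP (u v : nat * nat) : reflect
  ((u.2 = v.2 /\ (v.1 = u.1.+1 \/ u.1 = v.1.+1)) \/
   (u.1 = v.1 /\ (v.2 = u.2.+1 \/ u.2 = v.2.+1))) (nn_adj u v).
Proof. by rewrite /nn_adj; apply: (iffP eqP); lia. Qed.

Definition ecol (n k : nat) (e : edge n k) : nat :=
  match e with inl (i, _) => i | inr (i, _) => i end.

Definition inside (k c d : nat) (v : nat * nat) : bool := (c <= v.1 < d)%N && (v.2 < k)%N.

Lemma insideW (k c d c' d' : nat) v : (c <= c')%N -> (d' <= d)%N ->
  inside k c' d' v -> inside k c d v.
Proof.
move=> cc dd /andP[/andP[v1 v2] v3]; rewrite /inside v3 (leq_trans cc v1).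
by rewrite (leq_trans v2 dd).
Qed.

(* crossing of the columns [c, d), which are half open *)
Definition crosses (k c d : nat) (x0 : nat * nat) (s : seq (nat * nat)) : Prop :=
  [/\ all (inside k c d) (x0 :: s), path nn_adj x0 s, x0.1 = c & (last x0 s).1.+1 = d].

Lemma first_entry (j : nat) s x0 : path nn_adj x0 s -> (x0.1 < j)%N ->
  (j <= (last x0 s).1)%N ->
  exists s1 y s2, [/\ s = s1 ++ y :: s2, all (fun v => v.1 < j)%N (x0 :: s1),
    (last x0 s1).1.+1 = j & y.1 = j].
Proof.
elim: s x0 => [|y s IH] x0 /=; first by move=> _ h1 h2; lia.
move=> /andP[/nn_adjP xy ys] xj yj.
have [yj'|yj'] := ltnP y.1 j.
  have [s1 [z [s2 [-> h2 h3 h4]]]] := IH y ys yj' yj.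
  by exists (y :: s1), z, s2; split => //=; rewrite xj.
by exists [::], y, s; split => //=; [rewrite xj|lia|lia].
Qed.

Lemma last_entry (j : nat) s x0 : path nn_adj x0 s -> (j <= (last x0 s).1)%N ->
  all (fun v => j <= v.1)%N (x0 :: s) \/
  exists s1 y s2, [/\ s = s1 ++ y :: s2, y.1 = j & all (fun v => j <= v.1)%N (y :: s2)].
Proof.
elim: s x0 => [|y s IH] x0 /=; first by move=> _ ->; left.
move=> /andP[/nn_adjP xy ys] yj; have [h|h] := IH y ys yj.
  have [xj|xj] := leqP j x0.1; first by left; rewrite /= in h *; rewrite h.
  right; exists [::], y, s; split => //.
  by move: h => /= /andP[h _]; lia.
by right; have [s1 [z [s2 [-> h2 h3]]]] := h; exists (y :: s1), z, s2.
Qed.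

Lemma vertical_path (j r1 r2 : nat) : exists t : seq (nat * nat),
  [/\ path nn_adj (j, r1) t, last (j, r1) t = (j, r2), (size t = `|r1%:Z - r2%:Z|)%N &
    all (fun v => (v.1 == j) && (v.2 <= maxn r1 r2)%N) t].
Proof.
have up m r : exists t : seq (nat * nat), [/\ path nn_adj (j, r) t,
    last (j, r) t = (j, (r + m)%N), (size t = m)%N &
    all (fun v => (v.1 == j) && (v.2 <= r + m)%N) t].
  elim: m r => [|m IH] r; first by exists [::]; rewrite addn0.
  have [t [h1 h2 h3 h4]] := IH r.+1.
  exists ((j, r.+1) :: t); split => /=; rewrite ?h1 ?h2 ?h3 ?addSnnS ?andbT//.
    by apply/nn_adjP => /=; lia.
  by rewrite eqxx -addSnnS h4 andbT /=; lia.
have down m r : exists t : seq (nat * nat), [/\ path nn_adj (j, (r + m)%N) t,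
    last (j, (r + m)%N) t = (j, r), (size t = m)%N &
    all (fun v => (v.1 == j) && (v.2 <= r + m)%N) t].
  elim: m => [|m [t [h1 h2 h3 h4]]]; first by exists [::]; rewrite addn0.
  exists ((j, (r + m)%N) :: t); split => /=; rewrite ?h1 ?h2 ?h3 ?andbT//.
    by apply/nn_adjP => /=; lia.
  rewrite eqxx /=; apply/andP; split; first lia.
  by apply: sub_all h4 => v /andP[->] /=; lia.
have [r12|r21] := boolP (r1 <= r2)%N.
  have [t [h1 h2 h3 h4]] := up (r2 - r1)%N r1.
  rewrite subnKC in h2 h4; last by [].
  exists t; split => //; first lia.
  by rewrite (maxn_idPr r12).
have {}r21 : (r2 <= r1)%N by lia.
have [t [h1 h2 h3 h4]] := down (r1 - r2)%N r2.
rewrite subnKC in h1 h2 h4; last by [].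
exists t; split => //; first lia.
by rewrite (maxn_idPl r21).
Qed.

Lemma straight_crossing (k c d : nat) : (0 < k)%N -> (c < d)%N ->
  exists s, crosses k c d (c, 0%N) s /\ (size s <= d - c)%N.
Proof.
move=> k0 cd; rewrite -(subnKC cd); move: (d - c.+1)%N => m.
suff [s [h1 h2]] : exists s, [/\ crosses k c (c.+1 + m) (c, 0%N) s,
    (size s <= c.+1 + m - c)%N & (last (c, 0%N) s).2 = 0%N] by exists s.
elim: m => [|m [s [[h1 h2 h3 h4] h5 h6]]].
  by exists [::]; split => //; split => //=; rewrite /inside /=; lia.
exists (rcons s ((c.+1 + m)%N, 0%N)); split; [|by rewrite size_rcons; lia|by rewrite last_rcons].
split => //.
- rewrite /= all_rcons; apply/and3P; split; [by rewrite /inside /=; lia|by rewrite /inside /=; lia|].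
  by move: h1 => /= /andP[_]; apply: sub_all => v; rewrite /inside; lia.
- rewrite rcons_path h2 /=; apply/nn_adjP; left.
  by rewrite h6 /=; lia.
- by rewrite last_rcons /=; lia.
Qed.

Section Crossing.
Variables (R : realType) (a b : R) (n k : nat).
Hypotheses (a0 : 0 < a) (ab : a < b) (k0 : (0 < k)%N).
Implicit Types (om : config n k) (u v : nat * nat) (s : seq (nat * nat)).

Local Notation PT om := (passage_time a b om).

Lemma edge_weight_ge0 om u v : 0 <= edge_weight a b om u v.
Proof.
have a0' := a0; have ab' := ab.
have wt0 e : 0 <= wt a b om e by rewrite /wt; case: ifP => _; lra.
rewrite /edge_weight; case: ifP => _; first by do 2 case: insub => //.
by case: ifP => // _; do 2 case: insub => //.
Qed.

Lemma edge_weight_le om u v : edge_weight a b om u v <= b.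
Proof.
have a0' := a0; have ab' := ab.
have wt0 e : wt a b om e <= b by rewrite /wt; case: ifP => _; lra.
have b0 : 0 <= b := ltW (lt_trans a0 ab).
rewrite /edge_weight; case: ifP => _; first by do 2 case: insub => //.
by case: ifP => // _; do 2 case: insub => //.
Qed.

Lemma edge_weight_agree om om' u v c d :
  (forall e, (c <= ecol e < d)%N -> om e = om' e) ->
  inside k c d u -> inside k c d v -> edge_weight a b om u v = edge_weight a b om' u v.
Proof.
move=> oo /andP[/andP[u1 u2] u3] /andP[/andP[v1 v2] v3]; rewrite /edge_weight.
case: ifP => _.
  case: insubP => [i _ ii|//]; case: insubP => [j _ jj|//]; rewrite /wt oo//=.
  by rewrite ii; lia.
case: ifP => // _.
case: insubP => [i _ ii|//]; case: insubP => [j _ jj|//]; rewrite /wt oo//=.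
by rewrite ii; lia.
Qed.

Lemma passage_time_nil om u : PT om u [::] = 0.
Proof. by rewrite /passage_time big_nil. Qed.

Lemma passage_time_cons om u v s : PT om u (v :: s) = edge_weight a b om u v + PT om v s.
Proof. by rewrite /passage_time /= big_cons. Qed.

Lemma passage_time_cat om u s1 s2 :
  PT om u (s1 ++ s2) = PT om u s1 + PT om (last u s1) s2.
Proof.
elim: s1 u => [|v s1 IH] u /=; first by rewrite passage_time_nil add0r.
by rewrite !passage_time_cons IH addrA.
Qed.

Lemma passage_time_ge0 om u s : 0 <= PT om u s.
Proof. by apply: sumr_ge0 => e _; exact: edge_weight_ge0. Qed.

Lemma passage_time_le om u s : PT om u s <= b * (size s)%:R.
Proof.
elim: s u => [|v s IH] u; first by rewrite passage_time_nil mulr0.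
by rewrite passage_time_cons /= -natr1; have := IH v; have := edge_weight_le om u v; lra.
Qed.

Lemma passage_time_agree om om' u s c d :
  (forall e, (c <= ecol e < d)%N -> om e = om' e) ->
  all (inside k c d) (u :: s) -> PT om u s = PT om' u s.
Proof.
move=> oo; elim: s u => [|v s IH] u; first by rewrite !passage_time_nil.
move=> /= /and3P[hu hv hs]; rewrite !passage_time_cons IH ?(edge_weight_agree oo)//=.
by rewrite hv.
Qed.

(** The empty window gets the value 0, so that the splitting inequalities also hold at [j = c] and
    [j = d]. *)
Definition crossing_time om (c d : nat) : R :=
  if (c < d)%N then
    inf [set PT om p.1 p.2 | p in [set p | crosses k c d p.1 p.2]]
  else 0.

Lemma tcross_crossing_time om : tcross a b om = crossing_time om 0 n.+1.
Proof.
rewrite /tcross /crossing_time ltn0Sn; congr (inf [set _ | _ in _]).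
apply/funext => -[x0 s] /=; apply/propext; rewrite /crossing_path /crosses /=.
have e : in_rect n k =1 inside k 0 n.+1 by move=> v; rewrite /in_rect /inside ltnS.
by rewrite e (eq_all e); split => -[h1 h2 h3]; [move=> ->|move=> [->]].
Qed.

Let has_inf_crossing om c d : (c < d)%N ->
  has_inf [set PT om p.1 p.2 | p in [set p | crosses k c d p.1 p.2]].
Proof.
move=> cd; split.
  have [s [h _]] := straight_crossing k0 cd.
  by exists (PT om (c, 0%N) s); exists ((c, 0%N), s).
by exists 0 => _ [p _ <-]; exact: passage_time_ge0.
Qed.

Lemma crossing_time_le om c d x0 s : crosses k c d x0 s ->
  crossing_time om c d <= PT om x0 s.
Proof.
move=> h; have cd : (c < d)%N.
  by case: h => /= /andP[+ _] _ <- _; rewrite /inside; lia.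
rewrite /crossing_time cd; apply: ge_inf; first by case: (has_inf_crossing om cd).
by exists (x0, s).
Qed.

Lemma crossing_time_ge om c d B : (c < d)%N ->
  (forall x0 s, crosses k c d x0 s -> B <= PT om x0 s) -> B <= crossing_time om c d.
Proof.
move=> cd h; rewrite /crossing_time cd; apply: lb_le_inf.
  by case: (has_inf_crossing om cd).
by move=> _ [[x0 s] /= p <-]; exact: h.
Qed.

Lemma crossing_time_approx om c d eps : (c < d)%N -> 0 < eps ->
  exists x0 s, crosses k c d x0 s /\ PT om x0 s < crossing_time om c d + eps.
Proof.
move=> cd e0; have := inf_adherent e0 (has_inf_crossing om cd).
by move=> [_ [[x0 s] /= p <-]]; rewrite /crossing_time cd => h; exists x0, s.
Qed.

Lemma crossing_time_ge0 om c d : 0 <= crossing_time om c d.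
Proof.
have [cd|dc] := ltnP c d; last by rewrite /crossing_time ltnNge dc.
by apply: crossing_time_ge => // x0 s _; exact: passage_time_ge0.
Qed.

Lemma crossing_time_ub om c d : crossing_time om c d <= b * (d - c)%:R.
Proof.
have b0 : 0 <= b := ltW (lt_trans a0 ab).
have [cd|dc] := ltnP c d; last by rewrite /crossing_time ltnNge dc /= mulr_ge0.
have [s [h sz]] := straight_crossing k0 cd.
apply: (le_trans (crossing_time_le om h)); apply: (le_trans (passage_time_le _ _ _)).
by rewrite ler_wpM2l// ler_nat.
Qed.

Lemma crossing_time_agree om om' c d :
  (forall e, (c <= ecol e < d)%N -> om e = om' e) ->
  crossing_time om c d = crossing_time om' c d.
Proof.
move=> oo; rewrite /crossing_time; case: ifP => // _; congr inf.
apply/seteqP; split => _ [p pc <-]; exists p => //.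
  by apply: esym; apply: passage_time_agree oo _; case: pc.
by apply: passage_time_agree oo _; case: pc.
Qed.

Lemma crossing_time_col om j : crossing_time om j j.+1 = 0.
Proof.
apply/eqP; rewrite eq_le crossing_time_ge0 andbT.
rewrite -(passage_time_nil om (j, 0%N)); apply: crossing_time_le.
by split => //=; rewrite /inside /= ltnSn leqnn k0.
Qed.

Lemma crossing_time_empty om j : crossing_time om j j = 0.
Proof. by rewrite /crossing_time ltnn. Qed.

(** The part of a crossing before its first entry into column [j] crosses the left window. What
    follows may step back to the left, so the right window is crossed by the part after the last
    such return. The two parts share no step. *)
Lemma crossing_time_superadd om c j d : (c <= j <= d)%N ->
  crossing_time om c j + crossing_time om j d <= crossing_time om c d.
Proof.
move=> /andP[cj jd].
have [->|ncj] := eqVneq c j; first by rewrite crossing_time_empty add0r.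
have [->|njd] := eqVneq j d; first by rewrite crossing_time_empty addr0.
have {}cj : (c < j)%N by lia.
have {}jd : (j < d)%N by lia.
apply: crossing_time_ge; first lia.
move=> x0 s [h1 h2 h3 h4].
have [s1 [y [s2 [es as1 ls1 yj]]]] : exists s1 y s2, [/\ s = s1 ++ y :: s2,
    all (fun v => v.1 < j)%N (x0 :: s1), (last x0 s1).1.+1 = j & y.1 = j].
  by apply: first_entry => //; lia.
move: h1 h2 h4; rewrite es -cat_cons all_cat cat_path last_cat /=.
move=> /and3P[/andP[ix0 is1] iy is2] /and3P[ps1 _ ps2] ls2.
rewrite passage_time_cat passage_time_cons.
have c1 : crosses k c j x0 s1.
  split => //; apply/allP => v vs; have := allP as1 v vs.
  have : inside k c d v by move: vs; rewrite inE => /predU1P[->//|/(allP is1)].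
  by move=> /andP[/andP[v1 v2] v3] vj; rewrite /inside v1 vj v3.
have : exists2 p, crosses k j d p.1 p.2 & PT om p.1 p.2 <= PT om y s2.
  have ins v : inside k c d v -> (j <= v.1)%N -> inside k j d v.
    by move=> /andP[/andP[_ v2] v3] vj; rewrite /inside vj v2 v3.
  have [|h|[s3 [z [s4 [es2 zj h]]]]] := last_entry (j := j) ps2; first lia.
    exists (y, s2) => //; split => //=.
    have /= /andP[_ h'] := h; rewrite ins//= ?yj//; apply/allP => v vs.
    by apply: ins; [exact: (allP is2)|exact: (allP h')].
  exists (z, s4) => /=; last first.
    by rewrite es2 passage_time_cat passage_time_cons; have := passage_time_ge0 om y s3;
      have := edge_weight_ge0 om (last y s3) z; lra.
  move: is2 ps2 ls2; rewrite es2 all_cat cat_path last_cat /=.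
  move=> /andP[_ is4] /and3P[_ _ ps4] ls4; split => //.
  have is4' : all (inside k c d) (z :: s4) by [].
  by apply/allP => v vs; apply: ins; [exact: (allP is4')|exact: (allP h)].
move=> [[z s4] /= c2 le2].
have := crossing_time_le om c1; have := crossing_time_le om c2.
have := edge_weight_ge0 om (last x0 s1) y; lra.
Qed.

(** One step carries the left crossing from column [j - 1] to column [j], where at most [k - 1]
    vertical steps reach the start of the right crossing. *)
Lemma crossing_time_subadd om c j d : (c <= j <= d)%N ->
  crossing_time om c d <= crossing_time om c j + crossing_time om j d + b * k%:R.
Proof.
have b0 : 0 <= b := ltW (lt_trans a0 ab).
have bk : 0 <= b * k%:R by rewrite mulr_ge0.
move=> /andP[cj jd].
have [->|ncj] := eqVneq c j; first by rewrite crossing_time_empty add0r lerDl.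
have [->|njd] := eqVneq j d; first by rewrite crossing_time_empty addr0 lerDl.
have {}cj : (c < j)%N by lia.
have {}jd : (j < d)%N by lia.
suff h x0 s y t : crosses k c j x0 s -> crosses k j d y t ->
    crossing_time om c d <= PT om x0 s + PT om y t + b * k%:R.
  rewrite -lerBlDr -lerBlDr; apply: crossing_time_ge => // x0 s c1.
  have : crossing_time om c d - b * k%:R - PT om x0 s <= crossing_time om j d; last lra.
  by apply: crossing_time_ge => // y t c2; have := h _ _ _ _ c1 c2; lra.
move=> [h1 h2 h3 h4] [g1 g2 g3 g4].
set z := last x0 s.
have zi : inside k c j z by rewrite (allP h1)// mem_last.
have yi : inside k j d y by move: g1 => /= /andP[].
have [v [v1 v2 v3 v4]] := vertical_path j z.2 y.2.
have ey : y = (j, y.2) by rewrite -g3; case: (y).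
have cr : crosses k c d x0 (s ++ (j, z.2) :: v ++ t).
  split => //.
  - rewrite -cat_cons !all_cat /= all_cat; apply/and4P; split.
    + by apply: sub_all h1 => w; apply: insideW (ltnW jd).
    + by case/andP: zi => _ z2; rewrite /inside /= (ltnW cj) jd z2.
    + have z2 : (z.2 < k)%N by case/andP: zi.
      have y2 : (y.2 < k)%N by case/andP: yi.
      apply: sub_all v4 => w /andP[/eqP w1 w2]; rewrite /inside w1 (ltnW cj) jd /=.
      by apply: leq_ltn_trans w2 _; rewrite gtn_max z2 y2.
    + by move: g1 => /= /andP[_]; apply: sub_all => w; apply: insideW => //; exact: ltnW.
  - rewrite cat_path /= cat_path h2 v1 v2 -ey g2 !andbT /=.
    by apply/nn_adjP; left; split => //=; left; rewrite -h4.
  - by rewrite last_cat /= last_cat v2 -ey.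
apply: (le_trans (crossing_time_le om cr)).
rewrite passage_time_cat passage_time_cons passage_time_cat v2 -ey -/z.
have := edge_weight_le om z (j, z.2); have := passage_time_le om (j, z.2) v.
have : (size v).+1%:R <= k%:R :> R.
  rewrite ler_nat v3; case/andP: zi => _ z2; case/andP: yi => _ y2.
  by clear -z2 y2; lia.
rewrite -natr1 => h; have := ler_wpM2l b0 h; lra.
Qed.

End Crossing.

(** * Duality and the lower bound on the variance *)

Definition steps (x : nat * nat) (s : seq (nat * nat)) := zip (x :: s) s.

Lemma steps_cat x s1 s2 : steps x (s1 ++ s2) = steps x s1 ++ steps (last x s1) s2.
Proof. by elim: s1 x => [|y s1 IH] x //=; rewrite /steps /= -/(steps _ _) IH. Qed.

Lemma steps_cons x y s : steps x (y :: s) = (x, y) :: steps y s.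
Proof. by []. Qed.

Lemma path_stepsP x s p : path nn_adj x s -> p \in steps x s -> nn_adj p.1 p.2.
Proof.
elim: s x => [|y s IH] x //= /andP[xy ys]; rewrite steps_cons inE => /predU1P[->//|].
exact: IH.
Qed.

Lemma all_stepsP (P : pred (nat * nat)) x s p : all P (x :: s) -> p \in steps x s ->
  P p.1 /\ P p.2.
Proof.
elim: s x => [|y s IH] x //= /and3P[xy ys yss]; rewrite steps_cons inE => /predU1P[->//|].
by apply: IH; rewrite /= ys.
Qed.

Lemma odd_count_addb (T : Type) (P1 P2 : pred T) (s : seq T) :
  odd (count P1 s) (+) odd (count P2 s) = odd (count (fun p => P1 p (+) P2 p) s).
Proof.
elim: s => [//|x s IH] /=; rewrite !oddD addbACA IH; congr (_ (+) _).
by case: (P1 x); case: (P2 x).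
Qed.

(** The intersection number modulo 2 of a path with the boundary of [X], which sees only the end
    points. It does the work of the Jordan curve theorem in the duality argument. *)
Lemma odd_count_boundary (X : pred (nat * nat)) x s :
  odd (count (fun p => X p.1 (+) X p.2) (steps x s)) = X x (+) X (last x s).
Proof.
elim: s x => [|y s IH] x /=; first by rewrite addbb.
by rewrite oddD IH; case: (X x); case: (X y); case: (X (last y s)).
Qed.

Lemma crosses_sub (k N c d : nat) x0 s : crosses k 0 N x0 s -> (c < d <= N)%N ->
  exists y t, crosses k c d y t /\ {subset steps y t <= steps x0 s}.
Proof.
move=> [h1 h2 h3 h4] /andP[cd dN].
have [y [t [it pt yc lt ts]]] : exists y t, [/\ all (inside k c N) (y :: t),
    path nn_adj y t, y.1 = c, (last y t).1.+1 = N & {subset steps y t <= steps x0 s}].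
  have ins v : inside k 0 N v -> (c <= v.1)%N -> inside k c N v.
    by move=> /andP[/andP[_ v2] v3] vj; rewrite /inside vj v2 v3.
  have [c0|c0] := posnP c; first by move: h3; rewrite c0; exists x0, s; split.
  have [|h|[s1 [y [s2 [es yc h]]]]] := last_entry (j := c) h2; first lia.
    by move: h => /= /andP[]; lia.
  exists y, s2; move: h1 h2 h4; rewrite es -cat_cons all_cat cat_path last_cat /=.
  move=> /andP[_ i2] /and3P[_ _ p2] l2; split => //.
    have i2' : all (inside k 0 N) (y :: s2) by [].
    suff : all (inside k c N) (y :: s2) by [].
    by apply/allP => v vs; apply: ins; [exact: (allP i2' _ vs)|exact: (allP h _ vs)].
  by move=> p pin; rewrite steps_cat steps_cons mem_cat inE pin !orbT.
have ins v : inside k c N v -> (v.1 < d)%N -> inside k c d v.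
  by move=> /andP[/andP[v2 _] v3] vj; rewrite /inside vj v2 v3.
have [dN'|dN'] := eqVneq d N; first by exists y, t; rewrite dN'; split.
have [||s1 [z [s2 [et h l1 zd]]]] := first_entry (j := d) pt; [lia|lia|].
exists y, s1; move: it pt lt ts; rewrite et -cat_cons all_cat cat_path last_cat /=.
move=> /andP[i1 _] /and3P[p1 _ _] _ ts; split.
  have i1' : all (inside k c N) (y :: s1) by [].
  split => //; suff : all (inside k c d) (y :: s1) by [].
  by apply/allP => v vs; apply: ins; [exact: (allP i1' _ vs)|exact: (allP h _ vs)].
by move=> p pin; apply: ts; rewrite steps_cat mem_cat pin.
Qed.

Section ClosedEdges.
Variables (n k : nat).
Implicit Types (om : config n k) (u v : nat * nat) (s : seq (nat * nat)).

Definition edge_of u v : option (edge n k) :=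
  if (u.2 == v.2) && ((v.1 == u.1.+1) || (u.1 == v.1.+1)) then
    match (insub (minn u.1 v.1) : option 'I_n), (insub u.2 : option 'I_k) with
    | Some i, Some j => Some (inl (i, j))
    | _, _ => None
    end
  else if (u.1 == v.1) && ((v.2 == u.2.+1) || (u.2 == v.2.+1)) then
    match (insub u.1 : option 'I_n.+1), (insub (minn u.2 v.2) : option 'I_k.-1) with
    | Some i, Some j => Some (inr (i, j))
    | _, _ => None
    end
  else None.

Lemma edge_weightE (R : realType) (a b : R) om u v : edge_weight a b om u v =
  if edge_of u v is Some e then wt a b om e else 0.
Proof.
rewrite /edge_weight /edge_of; case: ifP => _; first by do 2 case: insub => //.
by case: ifP => // _; do 2 case: insub => //.
Qed.

Definition closed om u v : bool := if edge_of u v is Some e then om e else false.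

Definition hclosed om (x y : nat) : bool :=
  match (insub x : option 'I_n), (insub y : option 'I_k) with
  | Some i, Some j => om (inl (i, j)) | _, _ => false end.

Definition vclosed om (x y : nat) : bool :=
  match (insub x : option 'I_n.+1), (insub y : option 'I_k.-1) with
  | Some i, Some j => om (inr (i, j)) | _, _ => false end.

Lemma closedE om u v : nn_adj u v -> closed om u v =
  if u.2 == v.2 then hclosed om (minn u.1 v.1) u.2 else vclosed om u.1 (minn u.2 v.2).
Proof.
move=> /nn_adjP uv; rewrite /closed /edge_of /hclosed /vclosed.
have [e2|n2] := eqVneq u.2 v.2 => /=.
  have -> : (v.1 == u.1.+1) || (u.1 == v.1.+1) by lia.
  by do 2 case: insub => //.
have -> : (u.1 == v.1) && ((v.2 == u.2.+1) || (u.2 == v.2.+1)) by lia.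
by do 2 case: insub => //.
Qed.

Lemma edge_of_col c d u v e : inside k c d u -> inside k c d v ->
  edge_of u v = Some e -> (c <= ecol e < d)%N.
Proof.
move=> /andP[/andP[u1 u2] _] /andP[/andP[v1 v2] _]; rewrite /edge_of.
case: ifP => _.
  case: insubP => [i _ ii|//]; case: insubP => [j _ jj|//] [<-] /=.
  by rewrite ii; lia.
case: ifP => // _.
case: insubP => [i _ ii|//]; case: insubP => [j _ jj|//] [<-] /=.
by rewrite ii; lia.
Qed.

Definition open_crossing om c d : Prop := exists x0 s, crosses k c d x0 s /\
  forall p, p \in steps x0 s -> ~~ closed om p.1 p.2.

Section Duality.
Variable c : nat.
Hypothesis ckn : (c + k <= n)%N.

(** Horizontal edges of the block form a [k] by [k] array, and vertical edges off its two extreme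
    columns a [k - 1] by [k - 1] array; the map transposes both. Within the block all indices are in
    range, and the defaults of [insubd] make the map total. *)
Definition dual_edge (e : edge n k) : edge n k :=
  match e with
  | inl (i, j) => inl (insubd i (c + j)%N, insubd j (i - c)%N)
  | inr (i, j) => inr (insubd i (c + j).+1, insubd j (i - c).-1)
  end.

Definition in_block (e : edge n k) : bool :=
  match e with
  | inl (i, _) => (c <= i < c + k)%N
  | inr (i, _) => (c < i < c + k)%N
  end.

(* planar duality composed with the reflection in the diagonal of the (self-dual) block;
   edges outside the block are left alone *)
Definition dual om : config n k := [ffun e => if in_block e then ~~ om (dual_edge e) else om e].

Lemma dual_edge_block e : in_block e -> in_block (dual_edge e) /\ dual_edge (dual_edge e) = e.
Proof.
case: e => -[i j] /= h.
  have ji : (c + j < n)%N by have := ltn_ord j; lia.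
  have ij : (i - c < k)%N by lia.
  rewrite !val_insubd ji ij; split; first by have := ltn_ord j; lia.
  congr (inl (_, _)); apply/val_inj; rewrite val_insubd ?ltn_ord.
    by rewrite subnKC; [rewrite ltn_ord|lia].
  by rewrite addKn ltn_ord.
have ji : ((c + j).+1 < n.+1)%N by have := ltn_ord j; lia.
have ij : ((i - c).-1 < k.-1)%N by lia.
rewrite !val_insubd ji ij; split; first by have := ltn_ord j; lia.
congr (inr (_, _)); apply/val_inj; rewrite val_insubd.
  have -> : (c + (i - c).-1).+1 = i by lia.
  by rewrite ltn_ord.
have -> : ((c + j).+1 - c).-1 = j by lia.
by rewrite ltn_ord.
Qed.

Lemma dualK : involutive dual.
Proof.
move=> om; apply/ffunP => e; rewrite ffunE; case: ifPn => he; last first.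
  by rewrite ffunE (negbTE he).
by have [h1 h2] := dual_edge_block he; rewrite ffunE h1 h2 negbK.
Qed.

Lemma hclosed_dual om x y : (c <= x < c + k)%N -> (y < k)%N ->
  hclosed (dual om) x y = ~~ hclosed om (c + y) (x - c).
Proof.
move=> hx hy; rewrite /hclosed.
have xn : (x < n)%N by lia.
have cy : (c + y < n)%N by lia.
have xc : (x - c < k)%N by lia.
rewrite !insubT ffunE /= hx; congr (~~ om (inl (_, _))); apply/val_inj; rewrite val_insubd /=.
  by rewrite cy.
by rewrite xc.
Qed.

Lemma vclosed_dual om x y : (c < x < c + k)%N -> (y < k.-1)%N ->
  vclosed (dual om) x y = ~~ vclosed om (c + y).+1 (x - c).-1.
Proof.
move=> hx hy; rewrite /vclosed.
have xn : (x < n.+1)%N by lia.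
have cy : ((c + y).+1 < n.+1)%N by lia.
have xc : ((x - c).-1 < k.-1)%N by lia.
rewrite !insubT ffunE /= hx; congr (~~ om (inr (_, _))); apply/val_inj; rewrite val_insubd /=.
  by rewrite cy.
by rewrite xc.
Qed.

(** Under duality these are the steps of [t] that cross the horizontal edges of row [j] left of
    column [c + i]. So [side v] below is the parity of the crossings of [t] with the horizontal
    segment from the left end of the block to [v]. *)
Let hstep j i (p : (nat * nat) * (nat * nat)) : bool :=
  [&& p.1.2 == p.2.2, (p.1.2 < i)%N & (minn p.1.1 p.2.1 == c + j)%N].

(* At most one of a configuration and its dual is crossed by open edges: reading the dual
   crossing [(y0, t)] in reflected coordinates, the parity of its steps below a vertex of the
   primal crossing is invariant along the latter, but differs at the two ends. *)
Lemma open_crossing_dual om : open_crossing om c (c + k).+1 ->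
  open_crossing (dual om) c (c + k).+1 -> False.
Proof.
move=> [x0 [s [[s1 s2 s3 s4] so]]] [y0 [t [[t1 t2 t3 t4] to]]].
pose side v := odd (count (hstep v.2 (v.1 - c)) (steps y0 t)).
have tin p : p \in steps y0 t -> [/\ nn_adj p.1 p.2, inside k c (c + k).+1 p.1,
    inside k c (c + k).+1 p.2 & ~~ closed (dual om) p.1 p.2].
  by move=> pt; have [h1 h2] := all_stepsP t1 pt; split => //; [exact: path_stepsP pt|exact: to].
have hside u v : u.2 = v.2 -> v.1 = u.1.+1 -> inside k c (c + k).+1 u ->
    inside k c (c + k).+1 v -> ~~ hclosed om u.1 u.2 -> side u = side v.
  move=> uv2 uv1 /andP[/andP[u1 u1'] u2] /andP[/andP[v1 v1'] v2] hc.
  rewrite /side; congr odd; apply: eq_in_count => p /tin[pa p1 p2].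
  rewrite closedE// /hstep -uv2 uv1 subSn//.
  have [e2|//] := eqVneq p.1.2 p.2.2; rewrite /= ltnS.
  have [e1|] := eqVneq (minn p.1.1 p.2.1) (c + u.2)%N; rewrite ?andbF ?andbT//.
  have y1 : (p.1.2 < k)%N by case/andP: p1.
  have uk : (u.2 < k)%N := u2.
  have [pu|pu] := ltnP p.1.2 (u.1 - c); first by rewrite (ltnW pu).
  move=> h; apply/esym/negbTE/negP => pu'; have pe : p.1.2 = (u.1 - c)%N.
    by apply/eqP; rewrite eqn_leq pu pu'.
  move: h hc; rewrite e1 hclosed_dual; [|lia|by []].
  by rewrite addKn pe subnKC// negbK => ->.
have vside u v : u.1 = v.1 -> v.2 = u.2.+1 -> inside k c (c + k).+1 u ->
    inside k c (c + k).+1 v -> ~~ vclosed om u.1 u.2 -> side u = side v.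
  move=> uv1 uv2 /andP[/andP[u1 u1'] u2] /andP[/andP[v1 v1'] v2] hc.
  rewrite /side -uv1 uv2; set i := (u.1 - c)%N.
  have [i0|i0] := posnP i.
    by rewrite i0 !(eq_count (a2 := pred0)) // => p; rewrite /hstep ltn0 andbF.
  (* The possible steps across the boundary of [X] are those counted by [side u] or [side v], and
     one vertical step, dual to the open edge from [u] to [v] and so not taken by [t]. Both ends of
     [t] lie outside [X]. *)
  pose X (q : nat * nat) := (q.1 == (c + u.2).+1) && (q.2 < i)%N.
  apply/eqP; rewrite -negb_add odd_count_addb.
  have Xy : X y0 = false by rewrite /X t3; apply/negbTE; lia.
  have Xl : X (last y0 t) = false by rewrite /X; apply/negbTE; lia.
  have := odd_count_boundary X y0 t; rewrite Xy Xl /= => h0.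
  rewrite (eq_in_count (a2 := fun p => X p.1 (+) X p.2)) ?h0// => -[[x1 y1] [x2 y2]].
  move=> /tin[/= pa p1 p2]; rewrite closedE// /hstep /X /=.
  have q1 : (y1 < k)%N by case/andP: p1.
  have q2 : (y2 < k)%N by case/andP: p2.
  move/nn_adjP: pa => /=; have [<- pa _|n2 pa] := eqVneq y1 y2.
    case: (y1 < i)%N; last by rewrite !andbF.
    have [->|->] : x2 = x1.+1 \/ x1 = x2.+1 by clear -pa; lia.
      by rewrite !andbT /= (minn_idPl (leqnSn _)) eqSS addnS addbC.
    by rewrite !andbT /= (minn_idPr (leqnSn _)) eqSS addnS.
  have e1 : x1 = x2 by clear -n2 pa; lia.
  rewrite /= -e1; have [e3|] := eqVneq x1 (c + u.2).+1; last by [].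
  move=> h; have hi : (minn y1 y2 != i.-1)%N.
    apply/negP => /eqP e4; move: h hc; rewrite e3 e4 vclosed_dual; last 2 first.
    - by clear -v2 uv2; lia.
    - by clear -e4 pa n2 q1 q2 i0; lia.
    have -> : (c + i.-1).+1 = u.1 by clear -i0 u1; lia.
    have -> : ((c + u.2).+1 - c).-1 = u.2 by clear; lia.
    by rewrite negbK => ->.
  by clear -n2 pa hi i0; rewrite /=; lia.
have side_step u v : inside k c (c + k).+1 u -> inside k c (c + k).+1 v -> nn_adj u v ->
    ~~ closed om u v -> side u = side v.
  move=> iu iv uv; rewrite closedE//; move/nn_adjP: uv => -[[e2 [e1|e1]]|[e1 [e2|e2]]].
  - rewrite e2 eqxx e1 (minn_idPl (leqnSn _)) -e2; exact: hside.
  - rewrite e2 eqxx e1 (minn_idPr (leqnSn _)) -e2 => h; apply/esym/hside; rewrite ?e2//.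
    by rewrite -e2.
  - rewrite e2 (ltn_eqF (leqnn _)) (minn_idPl (leqnSn _)); exact: vside.
  - rewrite e2 (gtn_eqF (leqnn _)) (minn_idPr (leqnSn _)) e1 => h; exact/esym/vside.
have side_path w r : all (inside k c (c + k).+1) (w :: r) -> path nn_adj w r ->
    (forall p, p \in steps w r -> ~~ closed om p.1 p.2) -> side w = side (last w r).
  elim: r w => [//|v r IH] w /= /and3P[hw hv hr] /andP[wv pr] o.
  rewrite (side_step w v)//; last by apply: (o (w, v)); rewrite steps_cons mem_head.
  apply: IH => //=; first by rewrite hv.
  by move=> p pr'; apply: o; rewrite steps_cons inE pr' orbT.
have := side_path _ _ s1 s2 so.
have -> : side x0 = false.
  rewrite /side s3 subnn (eq_count (a2 := pred0)) ?count_pred0//.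
  by move=> p; rewrite /hstep ltn0 andbF.
(* At the right end the segment is a whole row, which [t] crosses an odd number of times: it starts
   in the columns up to [c + j] and ends beyond them. *)
have -> // : side (last x0 s) = true.
have i_k : ((last x0 s).1 - c = k)%N by lia.
have lk : ((last x0 s).2 < k)%N.
  by have /andP[] : inside k c (c + k).+1 (last x0 s) by rewrite (allP s1)// mem_last.
rewrite /side i_k; move: (last x0 s).2 lk => j jk.
pose X (q : nat * nat) := (q.1 <= c + j)%N.
have := odd_count_boundary X y0 t; rewrite [X in _ = X](_ : _ = true); last first.
  by rewrite /X t3 leq_addr /= -ltnNge; lia.
move=> <-; congr odd; apply: eq_in_count => -[[x1 y1] [x2 y2]] /tin[/= /nn_adjP /= pa /andP[_ p1] _ _].
rewrite /hstep /X /= p1 andTb; clear -pa.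
case: pa => [[-> h]|[-> h]]; last by rewrite addbb; apply/negbTE; lia.
rewrite eqxx /=; have [->|->] : x2 = x1.+1 \/ x1 = x2.+1 by lia.
  rewrite (minn_idPl (leqnSn _)); case: ltngtP; lia.
rewrite (minn_idPr (leqnSn _)); case: ltngtP; lia.
Qed.

Lemma prob_open_crossing (R : realType) :
  prob (fun om => `[< open_crossing om c (c + k).+1 >]) <= 1 / 2 :> R.
Proof.
set p := prob _; have pd : p = prob (fun om => `[< open_crossing (dual om) c (c + k).+1 >]).
  by rewrite /p /prob /mean (reindex_inj (inv_inj dualK)).
have : p + p <= 1.
  rewrite {2}pd -meanD -[leRHS](mean_cst (cfg0 (edge n k))); apply: ler_mean => om.
  rewrite -natrD (ler_nat _ _ 1); case: asboolP => // h1; case: asboolP => // h2.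
  by have := open_crossing_dual h1 h2.
lra.
Qed.

End Duality.
End ClosedEdges.

(** * From closed edges on a crossing to the variance *)

Section VarianceLowerBound.
Variables (R : realType) (a b : R) (n k : nat).
Hypotheses (a0 : 0 < a) (ab : a < b) (k0 : (0 < k)%N).
Implicit Types (om : config n k) (u v : nat * nat) (s : seq (nat * nat)).

Local Notation PT om := (passage_time a b om).
Local Notation T om := (tcross a b om).

Let wt_lower om e e' : wt a b (lower e om) e' <= wt a b om e'.
Proof.
have ab' := ab; rewrite /wt ffunE; case: (e' == e); case: (om e'); rewrite ?lexx//.
exact: ltW.
Qed.

Let edge_weight_lower om e u v : edge_weight a b (lower e om) u v <= edge_weight a b om u v.
Proof. by rewrite !edge_weightE; case: edge_of. Qed.

Let passage_time_lower om e x0 s : PT (lower e om) x0 s <= PT om x0 s.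
Proof. by apply: ler_sum => p _; exact: edge_weight_lower. Qed.

Let passage_time_lower_gain om e x0 s (p : (nat * nat) * (nat * nat)) :
  p \in steps x0 s -> edge_of n k p.1 p.2 = Some e ->
  om e -> PT (lower e om) x0 s <= PT om x0 s - (b - a).
Proof.
move=> ps pe oe; rewrite /passage_time !(big_rem p ps) /= !edge_weightE pe.
rewrite {1 2}/wt ffunE eqxx oe.
have : \sum_(q <- rem p (steps x0 s)) edge_weight a b (lower e om) q.1 q.2 <=
  \sum_(q <- rem p (steps x0 s)) edge_weight a b om q.1 q.2.
  by apply: ler_sum => q _; exact: edge_weight_lower.
by rewrite /steps; lra.
Qed.

Definition gain om e : R := (om e)%:R * (T om - T (lower e om)).

Let tcross_lower om e : T (lower e om) <= T om.
Proof.
rewrite !tcross_crossing_time; apply: crossing_time_ge => // x0 s h.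
exact: le_trans (crossing_time_le a0 ab k0 _ h) (passage_time_lower _ _ _ _).
Qed.

Lemma gain_ge0 om e : 0 <= gain om e.
Proof. by rewrite mulr_ge0// subr_ge0. Qed.

(* along an almost optimal crossing, lowering any of its [b]-edges saves nearly [b - a] *)
Lemma block_gain om c d : (c < d <= n.+1)%N -> ~ open_crossing om c d ->
  (b - a) / 2 <= \sum_(e | (c <= ecol e < d)%N) gain om e.
Proof.
move=> cd nop; have ba : 0 < (b - a) / 2 by have ab' := ab; lra.
have [x0 [s [cr hs]]] := crossing_time_approx a0 ab k0 om (ltn0Sn n) ba.
have [y [t [cyt sub]]] := crosses_sub cr cd.
have [p pt pc] : exists2 p, p \in steps y t & closed om p.1 p.2.
  apply: contrapT => h; apply: nop; exists y, t; split => // p pt.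
  by apply/negP => pc; apply: h; exists p.
move: pc; rewrite /closed; case pe : (edge_of n k p.1 p.2) => [e|//] oe.
have [p1 p2] : inside k c d p.1 /\ inside k c d p.2.
  by case: cyt => h _ _ _; exact: all_stepsP pt.
have ecd := edge_of_col p1 p2 pe.
rewrite (bigD1 e)//=; apply: (@le_trans _ _ (gain om e)); last first.
  by rewrite lerDl sumr_ge0// => e' _; exact: gain_ge0.
rewrite /gain oe mul1r.
have := passage_time_lower_gain (sub _ pt) pe oe.
have := crossing_time_le a0 ab k0 (lower e om) cr.
by rewrite -!tcross_crossing_time in hs *; lra.
Qed.

Let block_open om (m : nat) : bool := `[< open_crossing om (m * k.+1) (m * k.+1 + k).+1 >].

Lemma sum_gain om (M : nat) : (M * k.+1 <= n.+1)%N ->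
  \sum_(m < M) (b - a) / 2 * (1 - (block_open om m)%:R)
  <= \sum_e gain om e.
Proof.
move=> Mn.
apply: (@le_trans _ _ (\sum_(m < M) \sum_(e | (ecol e %/ k.+1 == m)%N) gain om e)).
  apply: ler_sum => m _; rewrite /block_open; case: asboolP => [_|nop].
    by rewrite subrr mulr0 sumr_ge0// => e _; exact: gain_ge0.
  rewrite subr0 mulr1.
  have -> : \sum_(e | (ecol e %/ k.+1 == m)%N) gain om e =
      \sum_(e | (m * k.+1 <= ecol e < (m * k.+1 + k).+1)%N) gain om e.
    apply: eq_bigl => e; rewrite eqn_leq leq_divRL// -ltnS ltn_divLR// andbC.
    by rewrite mulSn addnC addnS.
  apply: block_gain nop; rewrite ltnS leq_addr /=.
  have := ltn_ord m; nia.
rewrite (exchange_big_dep xpredT)//=; apply: ler_sum => e _.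
rewrite big_mkcond /=.
have [h|h] := ltnP (ecol e %/ k.+1) M.
  rewrite (bigD1 (Ordinal h))//= eqxx big1 ?addr0// => m /eqP mh.
  by case: eqP => // he; case: mh; apply/val_inj.
rewrite big1 ?gain_ge0// => m _; case: eqP => // he.
by have := ltn_ord m; rewrite -he ltnNge h.
Qed.

Lemma tcross_variance_lower (M : nat) : (M * k.+1 <= n.+1)%N ->
  ((b - a) / 4 * M%:R) ^+ 2 <=
  (n * k + n.+1 * k.-1)%:R * mean (fun om : config n k => (T om - mean (fun om => T om)) ^+ 2).
Proof.
move=> Mn.
have -> : (n * k + n.+1 * k.-1)%N = #|{: edge n k}| by rewrite card_sum !card_prod !card_ord.
apply: le_trans (influence_variance (fun om : config n k => T om)).
have i0 : 0 <= (b - a) / 4 * M%:R by rewrite mulr_ge0//; have := ab; lra.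
suff h : (b - a) / 4 * M%:R <= \sum_e influence (fun om : config n k => T om) e.
  by rewrite ler_pXn2r ?nnegrE// (le_trans i0).
rewrite -(mean_sum (fun e om => gain om e)).
apply: (@le_trans _ _ (mean (fun om : config n k => \sum_(m < M)
  (b - a) / 2 * (1 - (block_open om m)%:R)))); last first.
  by apply: ler_mean => om; exact: sum_gain.
rewrite mean_sum (_ : _ * M%:R = \sum_(m < M) (b - a) / 4); last first.
  by rewrite sumr_const card_ord mulr_natr.
apply: ler_sum => m _; rewrite meanZ meanB (mean_cst (cfg0 (edge n k))).
have mk : (m * k.+1 + k <= n)%N by have := ltn_ord m; nia.
have := @prob_open_crossing _ _ _ mk R; rewrite /prob -/(block_open _ _) => h.
have := ab; move: (mean _) h => z; nra.
Qed.

End VarianceLowerBound.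

(** * Decomposition into blocks *)

Section Perturbation.
Variables (R : realType) (T : finType) (t0 : T).
(** In the application [V] is the centered crossing time up to sign, with standard deviation [sg],
    and [su * W] the sum of the truncated block times, with [W] of unit variance. *)
Variables (V W : T -> R) (sg su rho tau x : R).
Hypotheses (sg0 : 0 < sg) (su0 : 0 < su) (rho0 : 0 <= rho).
Hypothesis V2 : mean (fun w => V w ^+ 2) = sg ^+ 2.
Hypothesis W2 : mean (fun w => W w ^+ 2) = 1.
Hypothesis VW2 : mean (fun w => (V w - su * W w) ^+ 2) <= 9 * rho ^+ 2.
Hypothesis VWtail : prob (fun w => 2 * rho < `|V w - su * W w|) <= tau.

Let dl := 2 * rho / su.

Hypothesis W_upper : forall z, 1 <= z -> z ^+ 3 * dl <= 1 / 32 ->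
  prob (fun w => z + 2 * dl < W w) <= Q z * (1 + 2400 * (z ^+ 3 * dl)).
Hypothesis W_lower : forall z, 1 <= z -> z ^+ 3 * dl <= 1 / 32 ->
  Q z * (1 - 2400 * (z ^+ 3 * dl)) <= prob (fun w => z - 2 * dl < W w).

(** The reverse triangle inequality in mean square: [sg ^+ 2 - su ^+ 2] is the mean of
    [(V - su * W) * (V + su * W)], to which Cauchy-Schwarz applies. *)
Lemma deviation_close : `|sg - su| <= 3 * rho.
Proof.
have t2 : (0 : R) <= 2 by [].
have cs := mean_cauchy_schwarz (fun w => V w - su * W w) (fun w => V w + su * W w).
have e1 : mean (fun w => (V w - su * W w) * (V w + su * W w)) = sg ^+ 2 - su ^+ 2.
  rewrite (eq_mean (g := fun w => V w ^+ 2 - su ^+ 2 * W w ^+ 2)); last by move=> w; ring.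
  by rewrite meanB meanZ V2 W2 mulr1.
have VWc : mean (fun w => V w * W w) <= sg.
  have := mean_cauchy_schwarz V W; rewrite V2 W2 mulr1.
  by move=> h; have sg0' := sg0; rewrite leNgt; apply/negP => ?; nra.
have e2 : mean (fun w => (V w + su * W w) ^+ 2) <= (sg + su) ^+ 2.
  rewrite (eq_mean (g := fun w => (V w ^+ 2 + su ^+ 2 * W w ^+ 2) + 2 * su * (V w * W w))); last first.
    by move=> w; ring.
  rewrite meanD meanD !meanZ V2 W2 mulr1.
  have := ler_wpM2l (mulr_ge0 t2 (ltW su0)) VWc; lra.
have s0 : 0 < sg + su by rewrite addr_gt0.
have : ((sg - su) * (sg + su)) ^+ 2 <= (3 * rho * (sg + su)) ^+ 2.
  have -> : (sg - su) * (sg + su) = sg ^+ 2 - su ^+ 2 by ring.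
  rewrite -e1; apply: (le_trans cs); rewrite exprMn; apply: ler_pM => //.
  - by apply: mean_ge0 => w; exact: sqr_ge0.
  - by apply: mean_ge0 => w; exact: sqr_ge0.
  - by apply: (le_trans VW2); rewrite exprMn; have := sqr_ge0 rho; lra.
rewrite -[in X in X -> _]real_normK ?num_real// ler_pXn2r ?nnegrE//; last first.
  by rewrite !mulr_ge0// ltW.
by rewrite normrM (gtr0_norm s0) ler_pM2r.
Qed.

Hypotheses (x2 : 2 <= x) (xr : x ^+ 3 * (rho / sg) <= 1 / 1000 * (1 / 100)).

Let r := rho / sg.

Let setup : [/\ 0 <= r, su <= 2 * sg, sg <= 2 * su, rho = r * sg & 0 <= dl <= 4 * r].
Proof.
have sg0' := sg0; have su0' := su0; have rho0' := rho0; have x2' := x2.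
have r0 : 0 <= r by rewrite divr_ge0// ltW.
have e : rho = r * sg by rewrite /r divfK// gt_eqF.
have x3 : 8 <= x ^+ 3.
  have -> : (8 : R) = 2 ^+ 3 by ring.
  by rewrite ler_pXn2r ?nnegrE//; lra.
have r1 : r <= 1 / 100 by have : x ^+ 3 * r <= 1 / 1000 * (1 / 100) := xr; nra.
have := deviation_close; rewrite ler_norml => /andP[h1 h2].
have rs : r * sg <= 1 / 100 * sg by rewrite ler_wpM2r// ltW.
have s2 : sg <= 2 * su by lra.
split => //; first lra.
rewrite divr_ge0 ?mulr_ge0//=; last exact: ltW.
by rewrite /dl ler_pdivrMr// e; nra.
Qed.

(** The constants are [32 = 8 * 4], from [z <= 2 * x] and [dl <= 4 * r], and [96 = 8 * 12], from
    [Q_ratio]. *)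
Let near_x z : `|z - x| <= 12 * x * r -> [/\ 1 <= z, z ^+ 3 * dl <= 32 * (x ^+ 3 * r),
  z ^+ 3 * dl <= 1 / 32, 0 <= z ^+ 3 * dl & `|Q z - Q x| <= 96 * (x ^+ 3 * r) * Q x].
Proof.
have [r0 s1 s2 e /andP[d0 d4]] := setup; have x2' := x2; have xr' : x ^+ 3 * r <= 1 / 1000 * (1 / 100) := xr.
have x0 : 0 <= x by lra.
have x1 : 1 <= x by lra.
have k1 : x * r <= x ^+ 3 * r by rewrite ler_wpM2r// !exprS expr0 mulr1; nra.
have k2 : x ^+ 2 * r <= x ^+ 3 * r by rewrite ler_wpM2r// [leRHS]exprS ler_peMl// sqr_ge0.
move=> hz; have := hz; rewrite ler_norml => /andP[z1 z2'].
have z1' : 1 <= z by lra.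
have zx : z <= 2 * x by lra.
have z3 : z ^+ 3 <= 8 * x ^+ 3.
  have -> : 8 * x ^+ 3 = (2 * x) ^+ 3 by ring.
  by rewrite ler_pXn2r ?nnegrE//; lra.
have h32 : z ^+ 3 * dl <= 32 * (x ^+ 3 * r).
  have -> : 32 * (x ^+ 3 * r) = 8 * x ^+ 3 * (4 * r) by ring.
  by apply: ler_pM => //; rewrite exprn_ge0//; lra.
have z0 : 0 <= z by lra.
split => //; [lra|by rewrite mulr_ge0 ?exprn_ge0|].
have := @Q_ratio R x z (12 * x * r) x1 z0 hz.
have e12 : x * (12 * x * r) = 12 * (x ^+ 2 * r) by ring.
rewrite e12 => h; have h1 : 12 * (x ^+ 2 * r) <= 1 by lra.
apply: (le_trans (h h1)); rewrite ler_wpM2r ?Q_ge0//; lra.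
Qed.

(** Off an event of probability at most [tau], comparing [V] with [x * sg] amounts to comparing [W]
    with [x * sg / su] up to [2 * rho / su]. Moving the threshold and applying the bounds for [W]
    costs [96 + 2400 * 32 = 76896] times [x ^+ 3 * (rho / sg)]; the cross term still fits below
    [800 * 100]. *)
Lemma perturbed_deviation :
  `|prob (fun w => x * sg < V w) - Q x| <= (800 * 100) * (x ^+ 3 * (rho / sg)) * Q x + tau.
Proof.
have [r0 s1 s2 e /andP[d0 d4]] := setup; have x2' := x2; have xr' : x ^+ 3 * r <= 1 / 1000 * (1 / 100) := xr.
have sun : su != 0 by rewrite gt_eqF.
have tau' := VWtail; have Q0 := Q_ge0 x.
have xr0 : 0 <= x ^+ 3 * r by rewrite mulr_ge0// exprn_ge0//; lra.
have shift (sgn : R) : `|sgn| <= 1 ->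
    `|(x * sg - 2 * sgn * rho) / su - sgn * (2 * dl) - x| <= 12 * x * r.
  move=> hs; have -> : (x * sg - 2 * sgn * rho) / su - sgn * (2 * dl) - x =
      (x * (sg - su) - 2 * sgn * rho) / su - sgn * (2 * dl) by field.
  apply: (le_trans (ler_normB _ _)); rewrite normrM [X in _ + X]normrM.
  rewrite (ger0_norm (_ : 0 <= 2 * dl)); last by apply: mulr_ge0.
  have n1 : `|x * (sg - su) - 2 * sgn * rho| <= (3 * x + 2) * rho.
    apply: (le_trans (ler_normB _ _)); rewrite !normrM (ger0_norm rho0) (ger0_norm (_ : 0 <= x)); last lra.
    rewrite (ger0_norm (_ : 0 <= 2))//; have := deviation_close; have := normr_ge0 sgn.
    have rho0' := rho0; move: `|sgn| `|_| hs => A B *; nra.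
  have n2 : `|x * (sg - su) - 2 * sgn * rho| * `|su^-1| <= (3 * x + 2) * (2 * r).
    rewrite [X in _ * X]gtr0_norm ?invr_gt0// ler_pdivrMr//; apply: (le_trans n1).
    have : 0 <= (3 * x + 2) * (r * (2 * su - sg)) by apply: mulr_ge0; [lra|apply: mulr_ge0 => //; lra].
    by rewrite e; lra.
  have : `|sgn| * (2 * dl) <= 8 * r by have := normr_ge0 sgn; nra.
  move: n2; nra.
rewrite -/r ler_norml; apply/andP; split.
- have := shift (-1); rewrite normrN normr1 => /(_ (lexx 1)).
  rewrite mulN1r mulrN1 opprK; set z := _ + 2 * dl => hz.
  have [z1 z2 z3 z4 z5] := near_x hz; have := W_lower z1 z3.
  move: z5; rewrite ler_norml => /andP[z5 _].
  have : prob (fun w => z - 2 * dl < W w) <= prob (fun w => x * sg < V w) +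
      prob (fun w => 2 * rho < `|V w - su * W w|) :> R.
    rewrite /prob -meanD; apply: ler_mean => w; rewrite -natrD ler_nat /z addrK.
    have [h|//] := boolP (_ < W w); have [//|] := ltP (x * sg) (V w).
    move: h; rewrite mulNr opprK ltr_pdivrMr// => h h'.
    by rewrite ltr0_norm; [have -> : 2 * rho < - (V w - su * W w) by lra|have := rho0; lra].
  move: z4 z2; move: (z ^+ 3 * dl) => u u0 u1 h1 h2.
  have : Q x * (1 - 96 * (x ^+ 3 * r)) * (1 - 2400 * u) <= Q z * (1 - 2400 * u).
    by apply: ler_wpM2r; lra.
  have : Q x * (1 - (800 * 100) * (x ^+ 3 * r)) <= Q x * ((1 - 96 * (x ^+ 3 * r)) * (1 - 2400 * u)).
    by apply: ler_wpM2l; [exact: Q0|have := mulr_ge0 xr0 u0; lra].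
  lra.
- have := shift 1; rewrite normr1 => /(_ (lexx 1)).
  rewrite mul1r mulr1; set z := _ - 2 * dl => hz.
  have [z1 z2 z3 z4 z5] := near_x hz; have := W_upper z1 z3.
  move: z5; rewrite ler_norml => /andP[_ z5].
  have : prob (fun w => x * sg < V w) <= prob (fun w => z + 2 * dl < W w) +
      prob (fun w => 2 * rho < `|V w - su * W w|) :> R.
    rewrite /prob -meanD; apply: ler_mean => w; rewrite -natrD ler_nat /z subrK.
    have [h|//] := boolP (_ < V w); have [//|] := ltP _ (W w).
    rewrite ler_pdivlMr// => h'.
    by rewrite gtr0_norm; [have -> : 2 * rho < V w - su * W w by lra|have := rho0; lra].
  move: z4 z2; move: (z ^+ 3 * dl) => u u0 u1 h1 h2.
  have : Q z * (1 + 2400 * u) <= Q x * (1 + 96 * (x ^+ 3 * r)) * (1 + 2400 * u).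
    by apply: ler_wpM2r; lra.
  have : Q x * ((1 + 96 * (x ^+ 3 * r)) * (1 + 2400 * u)) <= Q x * (1 + (800 * 100) * (x ^+ 3 * r)).
    have u2 : u <= 1 / 1000 by lra.
    by apply: ler_wpM2l; [exact: Q0|have := ler_wpM2l xr0 u2; lra].
  lra.
Qed.

End Perturbation.

Section Blocks.
Variables (R : realType) (a b : R) (n k q : nat).
Hypotheses (a0 : 0 < a) (ab : a < b) (k0 : (0 < k)%N) (q0 : (0 < q)%N).
Hypotheses (qn : (q * q <= n.+1)%N) (nq : (n.+1 < q.+1 * q.+1)%N).
Implicit Types (om : config n k).

Let b0 : 0 < b. Proof. exact: lt_trans ab. Qed.
Let c0 : R := 2 * b * k%:R.
Let c0_gt0 : 0 < c0. Proof. by rewrite !mulr_gt0// ltr0n. Qed.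

Local Notation CT om c d := (crossing_time a b om c d).

Lemma crossing_time_window om c j1 j2 d : (c <= j1)%N -> (j1 <= j2)%N -> (j2 <= d)%N ->
  let S := CT om c j1 + CT om j1 j2 + CT om j2 d in S <= CT om c d <= S + c0.
Proof.
move=> h1 h2 h3 /=.
have h12 : (c <= j2 <= d)%N by rewrite (leq_trans h1 h2).
have h11 : (c <= j1 <= j2)%N by rewrite h1.
have := crossing_time_superadd a0 ab k0 om h12; have := crossing_time_subadd a0 ab k0 om h12.
have := crossing_time_superadd a0 ab k0 om h11; have := crossing_time_subadd a0 ab k0 om h11.
by rewrite /c0 => *; apply/andP; split; lra.
Qed.

Lemma crossing_time_agree_window om om' c d c' d' :
  (forall e, ~~ (c' <= ecol e < d')%N -> om e = om' e) ->
  (d' <= c)%N \/ (d <= c')%N \/ (d' <= c')%N -> CT om c d = CT om' c d.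
Proof.
move=> oo h; apply: crossing_time_agree => // e ecd; apply: oo; lia.
Qed.

(** Cut out the single column [j], whose own crossing costs 0. The pieces on either side do not see
    the change, and two cuts cost at most [c0]. *)
Lemma crossing_time_column om om' c d j :
  (forall e, ~~ (ecol e == j)%N -> om e = om' e) -> `|CT om c d - CT om' c d| <= c0.
Proof.
move=> oo; have oo' e : ~~ (j <= ecol e < j.+1)%N -> om e = om' e.
  by move=> h; apply: oo; apply: contra h => /eqP ->; rewrite leqnn /=.
have [cj|cj] := boolP (c <= j < d)%N; last first.
  rewrite (@crossing_time_agree_window om om' c d j j.+1)//; last lia.
  by rewrite subrr normr0 ltW.
move/andP: cj => [cj jd].
have := crossing_time_window om cj (leqnSn j) jd.
have := crossing_time_window om' cj (leqnSn j) jd.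
rewrite /= !(crossing_time_col a0 ab k0).
rewrite (@crossing_time_agree_window om om' c j j j.+1)//; last lia.
rewrite (@crossing_time_agree_window om om' j.+1 d j j.+1)//; last lia.
by move=> /andP[h1 h2] /andP[h3 h4]; rewrite ler_norml; apply/andP; split; lra.
Qed.

(** The last block absorbs the leftover columns; since [n.+1 < q.+1 * q.+1] it still has at most
    [3 * q] of them. *)
Definition block_start (i : nat) : nat := if (i < q)%N then (i * q)%N else n.+1.
Definition block_index (c : nat) : nat := minn (c %/ q) q.-1.

Lemma block_start_le i : (i < q)%N -> (block_start i <= block_start i.+1 <= n.+1)%N.
Proof.
move=> iq; rewrite /block_start iq; case: ifP => h; last by rewrite leqnn andbT; nia.
by rewrite leq_mul2r leqnSn orbT /=; nia.
Qed.

Lemma block_length i : (i < q)%N -> (block_start i.+1 - block_start i <= 3 * q)%N.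
Proof.
move=> iq; rewrite /block_start iq; case: ifP => h; first by rewrite mulSn addnK; lia.
have -> : i = q.-1 by lia.
by nia.
Qed.

Lemma block_indexP i c : (i < q)%N -> (c <= n)%N ->
  (block_start i <= c < block_start i.+1)%N = (block_index c == i).
Proof.
move=> iq cn; rewrite /block_start /block_index iq -leq_divRL//.
case: ifP => h; first by rewrite -ltn_divLR//; lia.
by rewrite ltnS cn; lia.
Qed.

Lemma block_index_lt c : (block_index c < q)%N.
Proof. by rewrite /block_index; lia. Qed.

Lemma ecol_le (e : edge n k) : (ecol e <= n)%N.
Proof. by case: e => -[i j] /=; have := ltn_ord i; lia. Qed.

Let T (i : 'I_q) om : R := CT om (block_start i) (block_start i.+1).
Let Tot om : R := CT om 0 n.+1.
Let Rem om : R := Tot om - \sum_i T i om.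

Let in_block (i : 'I_q) : pred (edge n k) := fun e => block_index (ecol e) == i.

Lemma T_agree (i : 'I_q) om om' : (forall e, in_block i e -> om e = om' e) -> T i om = T i om'.
Proof.
move=> oo; apply: crossing_time_agree => // e; rewrite block_indexP ?ecol_le//.
exact: oo.
Qed.

Lemma T_range (i : 'I_q) om : 0 <= T i om <= b * n.+1%:R.
Proof.
rewrite /T crossing_time_ge0//=; apply: (le_trans (crossing_time_ub a0 ab k0 _ _ _)).
rewrite ler_pM2l// ler_nat; have := block_start_le (ltn_ord i); lia.
Qed.

Lemma Tot_range om : 0 <= Tot om <= b * n.+1%:R.
Proof.
rewrite /Tot crossing_time_ge0//=; apply: (le_trans (crossing_time_ub a0 ab k0 _ _ _)).
by rewrite subn0.
Qed.

Variable s : R.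
Hypothesis s0 : 0 < s.
Let rho : R := 3 * s * (c0 * Num.sqrt (3 * q)%:R).
Let tau1 : R := 2 * expR (- s ^+ 2).

Let rho_gt0 : 0 < rho.
Proof. by rewrite /rho !mulr_gt0// ?sqrtr_gt0 ltr0n ?muln_gt0//= ltr0n. Qed.

Lemma T_tail (i : 'I_q) : prob (fun om => rho < `|T i om - mean (T i)|) <= tau1.
Proof.
(* Edges outside the block go to group [3 * q], beyond the groups on which [T i] depends. *)
pose grp (e : edge n k) := if in_block i e then (ecol e - block_start i)%N else (3 * q)%N.
apply: (@bounded_difference_tail _ _ grp) => //; last by rewrite muln_gt0.
- move=> om om' oo; apply: T_agree => e ie; apply: oo; rewrite /= /grp ie.
  have := ie; rewrite /in_block -block_indexP ?ecol_le// => /andP[h1 h2].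
  have := block_length (ltn_ord i); move: h1 h2; move: (block_start _) (block_start _); lia.
- move=> j jq om om' oo.
  pose om'' : config n k := [ffun e => if in_block i e then om' e else om e].
  have -> : T i om' = T i om'' by apply: T_agree => e ie; rewrite ffunE ie.
  apply: (@crossing_time_column _ _ _ _ (block_start i + j)%N) => e ej; rewrite ffunE.
  case: ifPn => // ie; apply: oo; rewrite /= /grp ie.
  apply: contra ej => /eqP <-; rewrite subnKC//.
  by move: ie; rewrite /in_block -block_indexP ?ecol_le// => /andP[].
Qed.

(** Changing one block changes [Tot] by the change of that block's own crossing time up to [c0], and
    [Rem] subtracts the latter. Hence whole blocks can serve as groups. *)
Lemma Rem_tail : prob (fun om => rho < `|Rem om - mean Rem|) <= tau1.
Proof.
pose grp (e : edge n k) := block_index (ecol e).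
apply: (@le_trans _ _ (prob (fun om => 3 * s * (c0 * Num.sqrt q%:R) < `|Rem om - mean Rem|))).
  apply: ler_mean => om; rewrite ler_nat.
  have [h|//] := boolP (rho < _); rewrite (le_lt_trans _ h)//.
  apply: ler_wpM2l; first by rewrite mulr_ge0// ltW.
  by apply: ler_wpM2l; [exact: ltW|apply: ler_wsqrtr; rewrite ler_nat; lia].
apply: (@bounded_difference_tail _ _ grp) => //.
- move=> om om' oo; congr (_ - _).
    by apply: crossing_time_agree => // e _; apply: oo; rewrite /= /grp block_index_lt.
  by apply: eq_bigr => i _; apply: T_agree => e _; apply: oo; rewrite /= /grp block_index_lt.
- move=> j jq om om' oo; pose i := Ordinal jq.
  have /andP[le1 le2] := block_start_le jq.
  have := crossing_time_window om (leq0n _) le1 le2.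
  have := crossing_time_window om' (leq0n _) le1 le2.
  have oo' e : ~~ (block_start j <= ecol e < block_start j.+1)%N -> om e = om' e.
    by rewrite block_indexP ?ecol_le//; exact: oo.
  rewrite (crossing_time_agree_window oo' (c := 0) (d := block_start j)); last by right; left.
  rewrite (crossing_time_agree_window oo' (c := block_start j.+1) (d := n.+1)); last by left.
  have D om0 : Rem om0 = CT om0 0 n.+1 - (CT om0 (block_start j) (block_start j.+1) +
      \sum_(i0 < q | i0 != i) CT om0 (block_start i0) (block_start i0.+1)).
    by rewrite /Rem (bigD1 i).
  rewrite !D.
  have -> : \sum_(i0 < q | i0 != i) CT om (block_start i0) (block_start i0.+1) =
      \sum_(i0 < q | i0 != i) CT om' (block_start i0) (block_start i0.+1).
    apply: eq_bigr => l li; apply: (@T_agree l) => e; rewrite /in_block => /eqP le.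
    by apply: oo; rewrite /= /grp le; apply: contra li => /eqP ll; apply/eqP/val_inj.
  by move=> /andP[h1 h2] /andP[h3 h4]; rewrite ler_norml; apply/andP; split; lra.
Qed.

Let dev (i : 'I_q) om : R := T i om - mean (T i).
(** Stein's bound needs summands with a deterministic bound: truncation at [rho] provides it, and
    centering again restores mean 0. *)
Let trunc (i : 'I_q) om : R := if `|dev i om| <= rho then dev i om else 0.
Let cent (i : 'I_q) om : R := trunc i om - mean (trunc i).
Let U om : R := \sum_i cent i om.
Let V om : R := Tot om - mean Tot.
Let bound : R := b * n.+1%:R.

Let om0 := cfg0 (edge n k).

Let bound_ge0 : 0 <= bound. Proof. by rewrite mulr_ge0// ltW. Qed.

Let mean_range (f : config n k -> R) : (forall om, 0 <= f om <= bound) -> 0 <= mean f <= bound.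
Proof.
move=> h; rewrite mean_ge0 => [|om]; last by case/andP: (h om).
by rewrite -(mean_cst om0 bound) ler_mean// => om; case/andP: (h om).
Qed.

Let dev_bound i om : `|dev i om| <= bound.
Proof.
have /andP[h1 h2] := T_range i om; have /andP[h3 h4] := mean_range (T_range i).
by rewrite /dev ler_norml; apply/andP; split; rewrite /bound in h3 h4 *; lra.
Qed.

Let V_bound om : `|V om| <= bound.
Proof.
have /andP[h1 h2] := Tot_range om; have /andP[h3 h4] := mean_range Tot_range.
by rewrite /V ler_norml; apply/andP; split; rewrite /bound in h3 h4 *; lra.
Qed.

Let trunc_rho i om : `|trunc i om| <= rho.
Proof. by rewrite /trunc; case: ifPn => [//|_]; rewrite normr0; exact: ltW. Qed.

Let trunc_bound i om : `|trunc i om| <= bound.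
Proof. by rewrite /trunc; case: ifPn => [_|_]; rewrite ?normr0. Qed.

Let cent_rho i om : `|cent i om| <= 2 * rho.
Proof.
have h1 := trunc_rho i om; have h2 := norm_mean_le om0 (trunc_rho i).
by rewrite /cent (le_trans (ler_normB _ _))//; lra.
Qed.

Let cent_bound i om : `|cent i om| <= 2 * bound.
Proof.
have h1 := trunc_bound i om; have h2 := norm_mean_le om0 (trunc_bound i).
by rewrite /cent (le_trans (ler_normB _ _))//; lra.
Qed.

Let U_bound om : `|U om| <= 2 * q%:R * bound.
Proof.
apply: (le_trans (ler_norm_sum _ _ _)); apply: (@le_trans _ _ (\sum_(i < q) 2 * bound)).
  by apply: ler_sum.
by rewrite sumr_const card_ord -[_ *+ q]mulr_natr mulrAC.
Qed.

(** [dev i] has mean 0, so the mean of its truncation is minus that of the discarded part, at most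
    [bound] on an event of probability at most [tau1]. *)
Let mean_trunc i : `|mean (trunc i)| <= bound * tau1.
Proof.
have m0 : mean (dev i) = 0 by rewrite /dev meanB (mean_cst om0) subrr.
rewrite -normrN -[- _]add0r -m0 -meanB.
apply: (@le_trans _ _ (mean (fun om => bound * (rho < `|dev i om|)%R%:R))); last first.
  by rewrite meanZ ler_wpM2l//; exact: T_tail.
have h om : `|dev i om - trunc i om| <= bound * (rho < `|dev i om|)%R%:R.
  rewrite /trunc; case: leP => _; first by rewrite subrr normr0 mulr0.
  by rewrite subr0 mulr1.
rewrite ler_norml -meanN; apply/andP; split; apply: ler_mean => om; have := h om;
  by rewrite ler_norml => /andP[].
Qed.

Let cent_agree i om om' : (forall e, in_block i e -> om e = om' e) -> cent i om = cent i om'.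
Proof. by move=> oo; rewrite /cent /trunc /dev (T_agree oo). Qed.

Let cent_indep i (F G : R -> R) : mean (fun om => F (cent i om) * G (U om - cent i om)) =
  mean (fun om => F (cent i om)) * mean (fun om => G (U om - cent i om)).
Proof.
apply: (mean_indep (A := in_block i)) => om om' oo; first by rewrite (cent_agree oo).
have D om1 : U om1 - cent i om1 = \sum_(j | j != i) cent j om1.
  by rewrite /U (bigD1 i)//= addrAC subrr add0r.
rewrite !D; congr G; apply: eq_bigr => j ji; apply: cent_agree => e.
rewrite /in_block => /eqP ej; apply: oo; rewrite /= /in_block ej.
by apply: contra ji => /eqP ji; apply/eqP/val_inj.
Qed.

Let cent_mean i : mean (cent i) = 0.
Proof. by rewrite /cent meanB (mean_cst om0) subrr. Qed.

Let var : R := \sum_i mean (fun om => cent i om ^+ 2).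

Let U_var : mean (fun om => U om ^+ 2) = var.
Proof.
rewrite (eq_mean (g := fun om => \sum_i cent i om * U om)); last first.
  by move=> om; rewrite expr2 mulr_suml.
rewrite mean_sum; apply: eq_bigr => i _.
rewrite (eq_mean (g := fun om => cent i om ^+ 2 + cent i om * (U om - cent i om))); last first.
  by move=> om; ring.
by rewrite meanD (cent_indep i id id) cent_mean mul0r addr0.
Qed.

(** [3 * q * bound] dominates [|V - U|] everywhere. Both conditions will hold because [tau1] decays
    faster than any power of [n]. *)
Hypothesis trunc_small : q%:R * (bound * tau1) <= rho.
Hypothesis tail_small : (3 * q%:R * bound) ^+ 2 * (q.+1%:R * tau1) <= 5 * rho ^+ 2.

(** Unless one of [q.+1] tail events occurs, no block is truncated and [V - U] is the centered
    remainder plus the sum of the means of [trunc], each at most [rho]. *)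
Let VU_tail : prob (fun om => 2 * rho < `|V om - U om|) <= q.+1%:R * tau1.
Proof.
have mT : mean Tot = \sum_i mean (T i) + mean Rem.
  by rewrite -mean_sum -meanD; apply: eq_mean => om; rewrite addrC subrK.
have e om : V om - U om =
    \sum_i (dev i om - trunc i om) + (Rem om - mean Rem) + \sum_i mean (trunc i).
  rewrite /V mT /U /cent /dev !big_split /= !sumrN /Rem; ring.
have mt : `|\sum_i mean (trunc i)| <= rho.
  apply: (le_trans (ler_norm_sum _ _ _)); apply: le_trans trunc_small.
  apply: (@le_trans _ _ (\sum_(i < q) bound * tau1)); first by apply: ler_sum => i _; exact: mean_trunc.
  by rewrite sumr_const card_ord mulr_natl.
apply: (@le_trans _ _ (mean (fun om => \sum_i (rho < `|dev i om|)%R%:R +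
    (rho < `|Rem om - mean Rem|)%R%:R))); last first.
  rewrite meanD mean_sum -natr1 mulrDl mul1r lerD ?Rem_tail//.
  apply: (@le_trans _ _ (\sum_(i < q) tau1)); first by apply: ler_sum => i _; exact: T_tail.
  by rewrite sumr_const card_ord mulr_natl.
apply: ler_mean => om.
have s1 : 0 <= \sum_i (rho < `|dev i om|)%R%:R :> R by apply: sumr_ge0.
have [h|_] := boolP (2 * rho < _); last by rewrite addr_ge0.
have [r1|r1] := ltP rho `|Rem om - mean Rem|; first by rewrite lerDr.
rewrite addr0; have [/existsP[i di]|] := boolP [exists i, rho < `|dev i om|].
  by rewrite (bigD1 i)//= di lerDl sumr_ge0.
rewrite negb_exists => /forallP nd; move: h; rewrite e big1 ?add0r => [h|i _].
  have := ler_normD (Rem om - mean Rem) (\sum_i mean (trunc i)); lra.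
by rewrite /trunc leNgt nd subrr.
Qed.

(** Off the exceptional event the square is at most [4 * rho ^+ 2]; on it, the uniform bound
    weighted by its probability contributes at most [5 * rho ^+ 2]. *)
Let VU2 : mean (fun om => (V om - U om) ^+ 2) <= 9 * rho ^+ 2.
Proof.
have q1 : 1 <= q%:R :> R by rewrite ler1n.
apply: (@le_trans _ _ (4 * rho ^+ 2 + (3 * q%:R * bound) ^+ 2 *
    prob (fun om => 2 * rho < `|V om - U om|))); last first.
  have := ler_wpM2l (sqr_ge0 (3 * q%:R * bound)) VU_tail.
  move: tail_small; lra.
rewrite /prob -meanZ -(mean_cst om0 (4 * _)) -meanD; apply: ler_mean => om.
have [h|h] := ltP (2 * rho) `|V om - U om|.
  rewrite mulr1 -real_normK ?num_real//.
  have : `|V om - U om| <= 3 * q%:R * bound.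
    apply: (le_trans (ler_normB _ _)); have := V_bound om; have := U_bound om.
    have := ler_wpM2r bound_ge0 q1; lra.
  move=> h1; have : `|V om - U om| ^+ 2 <= (3 * q%:R * bound) ^+ 2.
    by rewrite ler_pXn2r ?nnegrE// (le_trans _ h1).
  have := sqr_ge0 rho; lra.
rewrite mulr0 addr0 -real_normK ?num_real//.
have -> : 4 * rho ^+ 2 = (2 * rho) ^+ 2 by ring.
by rewrite ler_pXn2r ?nnegrE// mulr_ge0// ltW.
Qed.

Variable x : R.
Let sg : R := Num.sqrt (mean (fun om => V om ^+ 2)).
Hypotheses (sg0 : 0 < sg) (x2 : 2 <= x) (xr : x ^+ 3 * (rho / sg) <= 1 / 1000 * (1 / 100)).

Let su : R := Num.sqrt var.

(** Were it zero, [U] would vanish in mean square and [VU2] would give [sg <= 3 * rho], against the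
    smallness of [rho / sg]. *)
Let var_gt0 : 0 < var.
Proof.
rewrite lt_neqAle sumr_ge0 ?andbT => [|i _]; last by apply: mean_ge0 => om; exact: sqr_ge0.
apply/eqP => v0.
have sg2 : mean (fun om => V om ^+ 2) = sg ^+ 2.
  by rewrite sqr_sqrtr//; apply: mean_ge0 => om; exact: sqr_ge0.
have : mean (fun om => V om * U om) = 0.
  have := mean_cauchy_schwarz V U; rewrite U_var -v0 mulr0 => h.
  by apply/eqP; rewrite -sqrf_eq0 eq_le h sqr_ge0.
have := VU2; rewrite (eq_mean (g := fun om => (V om ^+ 2 + U om ^+ 2) + (- 2) * (V om * U om))).
  rewrite meanD meanD meanZ U_var -v0 sg2 => h e; move: h; rewrite e mulr0 !addr0.
  have e9 : 9 * rho ^+ 2 = (3 * rho) ^+ 2 by ring.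
  have r30 : 0 <= 3 * rho by apply: mulr_ge0 => //; exact: ltW.
  rewrite e9 ler_pXn2r ?nnegrE//; last exact: ltW.
  move=> h.
  have r3 : 1 <= 3 * (rho / sg) by rewrite mulrA ler_pdivlMr// mul1r.
  have x3 : 8 <= x ^+ 3.
    have -> : (8 : R) = 2 ^+ 3 by ring.
    by rewrite ler_pXn2r ?nnegrE//; move: x2; lra.
  have : 8 * (rho / sg) <= x ^+ 3 * (rho / sg) by rewrite ler_wpM2r// divr_ge0 ?ltW.
  move: xr; lra.
by move=> om; ring.
Qed.

Lemma block_deviation (sgn : R) : sgn ^+ 2 = 1 ->
  `|prob (fun om => x * sg < sgn * V om) - Q x| <=
  800 * 100 * (x ^+ 3 * (rho / sg)) * Q x + q.+1%:R * tau1.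
Proof.
move=> sgn2.
have su0 : 0 < su by rewrite sqrtr_gt0 var_gt0.
have su2 : su ^+ 2 = var by rewrite sqr_sqrtr// ltW// var_gt0.
have sun : su != 0 by rewrite gt_eqF.
have sgn1 : `|sgn| = 1.
  by apply/eqP; rewrite -(@eqrXn2 _ 2)// ?normr_ge0// real_normK ?num_real// sgn2 expr1n.
pose xi (i : 'I_q) om : R := sgn * cent i om / su.
pose W om : R := sgn * U om / su.
have W_sum om : W om = \sum_i xi i om by rewrite /W mulr_sumr mulr_suml.
have Wxi i om : W om - xi i om = sgn * (U om - cent i om) / su by rewrite /W /xi; field.
have xi_indep i (F G : R -> R) : mean (fun om => F (xi i om) * G (W om - xi i om)) =
    mean (fun om => F (xi i om)) * mean (fun om => G (W om - xi i om)).
  under eq_mean do rewrite Wxi; under [X in _ = _ * X]eq_mean do rewrite Wxi.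
  exact: (cent_indep i (fun u => F (sgn * u / su)) (fun u => G (sgn * u / su))).
have xi_mean i : mean (xi i) = 0.
  rewrite (eq_mean (g := fun om => (sgn / su) * cent i om)); last by move=> om; rewrite /xi mulrAC.
  by rewrite meanZ cent_mean mulr0.
have xi_bound i om : `|xi i om| <= 2 * rho / su.
  by rewrite /xi !normrM sgn1 mul1r (gtr0_norm (_ : 0 < su^-1)) ?invr_gt0// ler_pM2r ?invr_gt0.
have xi_var : \sum_i mean (fun om => xi i om ^+ 2) = 1.
  rewrite (eq_bigr (fun i => (su ^+ 2)^-1 * mean (fun om => cent i om ^+ 2))); last first.
    move=> i _; rewrite -meanZ; apply: eq_mean => om.
    by rewrite /xi !exprMn sgn2 mul1r exprVn mulrC.
  by rewrite -mulr_sumr su2 mulVf// gt_eqF// var_gt0.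
apply: (@perturbed_deviation _ _ (fun om => sgn * V om) W sg su rho) => //.
- exact: ltW.
- rewrite (eq_mean (g := fun om => V om ^+ 2)); last by move=> om; rewrite exprMn sgn2 mul1r.
  by rewrite sqr_sqrtr//; apply: mean_ge0 => om; exact: sqr_ge0.
- rewrite (eq_mean (g := fun om => (su ^+ 2)^-1 * U om ^+ 2)); last first.
    by move=> om; rewrite /W !exprMn sgn2 mul1r exprVn mulrC.
  by rewrite meanZ U_var su2 mulVf// gt_eqF// var_gt0.
- rewrite (eq_mean (g := fun om => (V om - U om) ^+ 2)) ?VU2// => om.
  have -> : sgn * V om - su * W om = sgn * (V om - U om) by rewrite /W; field.
  by rewrite exprMn sgn2 mul1r.
- apply: le_trans VU_tail; apply: ler_mean => om.
  have -> : sgn * V om - su * W om = sgn * (V om - U om) by rewrite /W; field.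
  by rewrite normrM sgn1 mul1r.
- by move=> z z1 zd; apply: (@moderate_upper _ _ om0 q xi).
- by move=> z z1 zd; apply: (@moderate_lower _ _ om0 q xi).
Qed.

End Blocks.

(** * Choice of the scales *)

Lemma exists_isqrt (m : nat) : exists q, (q * q <= m)%N && (m < q.+1 * q.+1)%N.
Proof.
elim: m => [|m [q /andP[h1 h2]]]; first by exists 0%N.
have [h|h] := ltnP m.+1 (q.+1 * q.+1)%N; first by exists q; rewrite h leqW.
by exists q.+1; rewrite h /=; nia.
Qed.

(* Here [w] stands for [n ^ ((1 - 10 alpha) / 72)]: the hypotheses of the theorem give
   [x <= w ^+ 4] and [k ^+ 5 * w ^+ 36 <= sqrt n], the error is measured in [x ^+ 3 / w ^+ 12], and
   fluctuations are truncated at [s = x * w] times their bounded-difference scale. *)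
Section SingleScale.
Variables (R : realType) (a b : R) (n k : nat) (x w : R).
Hypotheses (a0 : 0 < a) (ab : a < b) (k0 : (0 < k)%N) (kn : (k <= n)%N).
Hypotheses (x2 : 2 <= x) (w1 : 1 <= w) (xw : x <= w ^+ 4).
Hypothesis kw : k%:R ^+ 5 * w ^+ 36 <= Num.sqrt n%:R.

Let V (om : config n k) : R := tcross a b om - mean (tcross a b (n := n) (k := k)).
Let sg : R := Num.sqrt (mean (fun om => V om ^+ 2)).
Let K : R := 500 * (b / (b - a)).
Let s : R := x * w.
(** A common majorant for the tail terms; the fifth power of [n] is that of [tail_small], where the
    square of [q * n] meets the number of tail events. *)
Let En : R := n%:R ^+ 5 * expR (- (w ^+ 2 / 2)).
Let b0 : 0 < b := lt_trans a0 ab.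
Let n0 : (0 < n)%N := leq_trans k0 kn.

Let mV2_ge0 : 0 <= mean (fun om => V om ^+ 2).
Proof. by apply: mean_ge0 => om; exact: sqr_ge0. Qed.

(** [768 = 16 * 16 * 3]: from the square of [(b - a) / 4], from [n <= 4 * M * k], and from the at
    most [3 * n * k] edges. *)
Lemma variance_lower : (b - a) ^+ 2 * n%:R <= 768 * k%:R ^+ 3 * sg ^+ 2.
Proof.
have k1 : 0 < k%:R :> R by rewrite ltr0n.
have n1 : 0 < n%:R :> R by rewrite ltr0n.
pose M := (n.+1 %/ k.+1)%N.
have Mn : (M * k.+1 <= n.+1)%N by exact: leq_trunc_div.
have h := tcross_variance_lower a0 ab k0 Mn.
rewrite sqr_sqrtr// -(ler_pM2l n1); rewrite -/V in h.
have M4 : n%:R <= 4 * M%:R * k%:R :> R.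
  rewrite -!natrM ler_nat; have : (n.+1 < M.+1 * k.+1)%N by rewrite ltn_ceil.
  have : (0 < M)%N by rewrite divn_gt0.
  by clear -k0; nia.
have E3 : (n * k + n.+1 * k.-1)%:R <= 3 * (n%:R * k%:R) :> R.
  by rewrite -!natrM ler_nat; clear -k0 n0; nia.
have M16 : n%:R ^+ 2 <= 16 * M%:R ^+ 2 * k%:R ^+ 2 :> R.
  have -> : 16 * M%:R ^+ 2 * k%:R ^+ 2 = (4 * M%:R * k%:R) ^+ 2 :> R by ring.
  by rewrite ler_pXn2r ?nnegrE ?mulr_ge0.
have h1 := ler_wpM2l (sqr_ge0 (b - a)) M16.
have h2 := ler_wpM2r mV2_ge0 E3.
have k2 : 0 <= 256 * k%:R ^+ 2 :> R.
  by apply: mulr_ge0; [exact: ler0n|apply: exprn_ge0; exact: ltW].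
have h3 := ler_wpM2l k2 (le_trans h h2).
move: (mean _) h1 h3 => v h1 h3.
have -> : n%:R * ((b - a) ^+ 2 * n%:R) = (b - a) ^+ 2 * n%:R ^+ 2 by ring.
apply: (le_trans h1).
have -> : (b - a) ^+ 2 * (16 * M%:R ^+ 2 * k%:R ^+ 2) =
  256 * k%:R ^+ 2 * ((b - a) / 4 * M%:R) ^+ 2 by field.
apply: (le_trans h3); rewrite le_eqVlt; apply/orP; left; apply/eqP; ring.
Qed.

Let w0 : 0 < w. Proof. exact: lt_le_trans w1. Qed.
Let x0 : 0 < x. Proof. exact: lt_le_trans x2. Qed.
Let s1 : 1 <= s.
Proof. by rewrite /s; have w1' := w1; have x2' := x2; nra. Qed.
Let n1 : 1 <= n%:R :> R. Proof. by rewrite ler1n. Qed.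
Let w12n : w ^+ 12 <= n%:R.
Proof.
have wp j : 1 <= w ^+ j by exact: exprn_ege1.
apply: (@le_trans _ _ (w ^+ 36)).
  by rewrite -[36%N]/((12 + 24)%N) exprD ler_peMr// exprn_ge0// ltW.
apply: (@le_trans _ _ (k%:R ^+ 5 * w ^+ 36)).
  by rewrite ler_peMl ?exprn_ge0 ?(ltW w0)// exprn_ege1// ler1n.
apply: (le_trans kw); rewrite -[leRHS]sqr_sqrtr// expr2 ler_peMr ?sqrtr_ge0//.
by rewrite -[leLHS]sqrtr1; apply: ler_wsqrtr.
Qed.

Variables (q : nat).
Hypotheses (qn : (q * q <= n.+1)%N) (nq : (n.+1 < q.+1 * q.+1)%N).
Let rho : R := 3 * s * (2 * b * k%:R * Num.sqrt (3 * q)%:R).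

Let q0 : (0 < q)%N. Proof. by case: q nq. Qed.
Let qn' : (q <= n)%N.
Proof. by have := n0; have := q0; have := qn; clear; nia. Qed.

Let s0 : 0 < s. Proof. exact: lt_le_trans s1. Qed.

Let rho_ge : 6 * b <= rho.
Proof.
have r1 : 1 <= Num.sqrt (3 * q)%:R :> R.
  by rewrite -[leLHS]sqrtr1; apply: ler_wsqrtr; rewrite ler1n muln_gt0.
have k1 : 1 <= k%:R :> R by rewrite ler1n.
have p1 : 1 <= s * (k%:R * Num.sqrt (3 * q)%:R).
  rewrite -[leLHS]mulr1; apply: ler_pM => //.
  by rewrite -[leLHS]mulr1; apply: ler_pM.
have -> : rho = 6 * b * (s * (k%:R * Num.sqrt (3 * q)%:R)) by rewrite /rho; ring.
by rewrite ler_peMr// mulr_ge0// ltW.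
Qed.

Let rho_gt0 : 0 < rho.
Proof. by apply: lt_le_trans rho_ge; apply: mulr_gt0. Qed.

Let sg_gt0 : 0 < sg.
Proof.
rewrite lt_neqAle sqrtr_ge0 andbT; apply/eqP => sg0.
have := variance_lower; rewrite -sg0 expr0n mulr0 leNgt mulr_gt0 ?ltr0n//.
by rewrite exprn_gt0// subr_gt0.
Qed.

Let K_ge0 : 0 <= K.
Proof.
apply: mulr_ge0; first exact: ler0n.
by apply: divr_ge0; rewrite ?subr_ge0; exact: ltW.
Qed.

(** After squaring, [s ^+ 2 <= w ^+ 10] and the hypothesis [kw] leave [w ^+ 26] out of [w ^+ 36],
    that is [w ^+ 13] for the ratio. The numerical factor [108 * 2 * 768] is below the square of the
    500 in [K]. *)
Lemma rho_sg_small : w ^+ 12 * (rho / sg) <= K / w.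
Proof.
have sq_w e : 0 <= w ^+ e by rewrite exprn_ge0// ltW.
have ba : 0 < b - a by rewrite subr_gt0.
have k3 : 0 < k%:R ^+ 3 :> R by rewrite exprn_gt0// ltr0n.
have sq : s ^+ 2 <= w ^+ 10.
  have -> : w ^+ 10 = (w ^+ 4) ^+ 2 * w ^+ 2 by ring.
  rewrite /s exprMn ler_wpM2r ?sq_w//.
  by rewrite ler_pXn2r ?nnegrE ?sq_w// ltW.
have qr : Num.sqrt n%:R * q%:R <= 2 * n%:R :> R.
  have q2 : q%:R <= 2 * Num.sqrt n%:R :> R.
    rewrite -(@ler_pXn2r _ 2) ?nnegrE ?mulr_ge0 ?sqrtr_ge0// exprMn sqr_sqrtr//.
    rewrite -natrX -natrX -natrM ler_nat; have := n0; have := qn; clear; nia.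
  have := ler_wpM2l (sqrtr_ge0 n%:R) q2; rewrite mulrCA -expr2 sqr_sqrtr//.
have main : w ^+ 26 * (k%:R ^+ 5 * s ^+ 2 * q%:R) <= 2 * n%:R.
  apply: le_trans qr; apply: (@le_trans _ _ (w ^+ 26 * (k%:R ^+ 5 * w ^+ 10 * q%:R))).
    by rewrite ler_wpM2l// ler_wpM2r// ler_wpM2l// exprn_ge0.
  have -> : w ^+ 26 * (k%:R ^+ 5 * w ^+ 10 * q%:R) = k%:R ^+ 5 * w ^+ 36 * q%:R by ring.
  by rewrite ler_wpM2r.
have rho2 : rho ^+ 2 = 108 * b ^+ 2 * k%:R ^+ 2 * s ^+ 2 * q%:R.
  by rewrite /rho !exprMn sqr_sqrtr// natrM; ring.
have goal2 : w ^+ 26 * rho ^+ 2 * (b - a) ^+ 2 <= (500 * b) ^+ 2 * sg ^+ 2.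
  rewrite -(ler_pM2r k3) rho2.
  have -> : w ^+ 26 * (108 * b ^+ 2 * k%:R ^+ 2 * s ^+ 2 * q%:R) * (b - a) ^+ 2 * k%:R ^+ 3 =
    (108 * (b ^+ 2 * (b - a) ^+ 2)) * (w ^+ 26 * (k%:R ^+ 5 * s ^+ 2 * q%:R)) by ring.
  have c1 : 0 <= 108 * (b ^+ 2 * (b - a) ^+ 2).
    by apply: mulr_ge0; [exact: ler0n|rewrite mulr_ge0// sqr_ge0].
  apply: (le_trans (ler_wpM2l c1 main)).
  have c2 : 0 <= 216 * b ^+ 2 by apply: mulr_ge0; [exact: ler0n|exact: sqr_ge0].
  have := ler_wpM2l c2 variance_lower.
  have : 0 <= b ^+ 2 * k%:R ^+ 3 * sg ^+ 2.
    by rewrite mulr_ge0 ?sqr_ge0// mulr_ge0 ?sqr_ge0// ltW.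
  move: (sg ^+ 2) => v; lra.
rewrite ler_pdivlMr// mulrA mulrAC ler_pdivrMr//.
have -> : K * sg = 500 * b * sg / (b - a) by rewrite /K; field; rewrite gt_eqF.
rewrite ler_pdivlMr//.
have A0 : w ^+ 12 * rho * w * (b - a) \is Num.nneg.
  by rewrite nnegrE !mulr_ge0// ltW.
have B0 : 500 * b * sg \is Num.nneg.
  by rewrite nnegrE; apply: mulr_ge0; [apply: mulr_ge0; [exact: ler0n|exact: ltW]|exact: ltW].
rewrite -(ler_pXn2r (n := 2) _ A0 B0); last by [].
have -> : (w ^+ 12 * rho * w * (b - a)) ^+ 2 = w ^+ 26 * rho ^+ 2 * (b - a) ^+ 2 by ring.
by rewrite [leRHS]exprMn.
Qed.

Hypotheses (Kw : K / w <= 1 / 1000 * (1 / 100)) (En1 : En <= 1).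

Let tau1 : R := 2 * expR (- s ^+ 2).

(** Since [x] and [w] are at least 1, [(x * w) ^+ 2 >= (x ^+ 2 + w ^+ 2) / 2]. The part in [w] pays
    for powers of [n]; the part in [x] is compared with [Q x]. *)
Let expR_s_le : expR (- s ^+ 2) <= expR (- (w ^+ 2 / 2)) * expR (- (x ^+ 2 / 2)).
Proof.
rewrite -expRD ler_expR /s exprMn.
have h1 : 1 <= w ^+ 2 by exact: exprn_ege1.
have h2 : 1 <= x ^+ 2 by apply: exprn_ege1; move: x2; lra.
have := mulr_ge0 (_ : 0 <= x ^+ 2 - 1) (_ : 0 <= w ^+ 2 - 1).
rewrite !subr_ge0 => /(_ h2 h1); lra.
Qed.

Let tau1_le : tau1 <= 2 * expR (- (w ^+ 2 / 2)).
Proof.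
rewrite ler_pM2l//; apply: (le_trans expR_s_le).
by rewrite ler_piMr ?expR_ge0// -expR0 ler_expR oppr_le0 divr_ge0 ?sqr_ge0.
Qed.

Let n_sum : n.+1%:R <= 2 * n%:R :> R. Proof. by rewrite -natr1; have := n1; lra. Qed.
Let q_n : q%:R <= n%:R :> R. Proof. by rewrite ler_nat. Qed.

Let trunc_small : q%:R * (b * n.+1%:R * tau1) <= rho.
Proof.
apply: le_trans rho_ge; set e := expR (- (w ^+ 2 / 2)).
have e0 : 0 <= e by exact: expR_ge0.
apply: (@le_trans _ _ (n%:R * (b * (2 * n%:R) * (2 * e)))).
  apply: ler_pM => //; first by rewrite !mulr_ge0 ?expR_ge0// ltW.
  apply: ler_pM => //; [by rewrite mulr_ge0// ltW|by rewrite mulr_ge0 ?expR_ge0|].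
  by rewrite ler_pM2l.
have -> : n%:R * (b * (2 * n%:R) * (2 * e)) = 4 * b * (n%:R ^+ 2 * e) by ring.
have : n%:R ^+ 2 * e <= En.
  by rewrite /En ler_wpM2r// -[5%N]/((2 + 3)%N) exprD ler_peMr ?exprn_ge0// exprn_ege1.
move=> h; have {}h : n%:R ^+ 2 * e <= 1 by apply: le_trans En1.
have := ler_wpM2l (ltW b0) h; have := b0; lra.
Qed.

Let tail_small : (3 * q%:R * (b * n.+1%:R)) ^+ 2 * (q.+1%:R * tau1) <= 5 * rho ^+ 2.
Proof.
set e := expR (- (w ^+ 2 / 2)).
have e0 : 0 <= e by exact: expR_ge0.
have b0' := ltW b0; have n0' : 0 <= n%:R :> R by [].
have t0 : 0 <= tau1 by rewrite mulr_ge0 ?expR_ge0.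
apply: (@le_trans _ _ ((3 * n%:R * (b * (2 * n%:R))) ^+ 2 * (2 * n%:R * (2 * e)))).
  apply: ler_pM; [exact: sqr_ge0|by rewrite mulr_ge0| |].
    rewrite ler_pXn2r ?nnegrE ?mulr_ge0//; apply: ler_pM => //; rewrite ?mulr_ge0//.
      by rewrite ler_wpM2l.
    by rewrite ler_wpM2l.
  apply: ler_pM => //; apply: le_trans n_sum; rewrite ler_nat ltnS; exact: qn'.
have -> : (3 * n%:R * (b * (2 * n%:R))) ^+ 2 * (2 * n%:R * (2 * e)) =
  144 * b ^+ 2 * En by rewrite /En -/e; ring.
have c : 0 <= 144 * b ^+ 2 by apply: mulr_ge0; [exact: ler0n|exact: sqr_ge0].
have h := ler_wpM2l c En1.
have : (6 * b) ^+ 2 <= rho ^+ 2.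
  have r60 : 0 <= 6 * b by apply: mulr_ge0.
  by rewrite ler_pXn2r ?nnegrE ?(ltW rho_gt0) ?r60//; exact: rho_ge.
have := sqr_ge0 b; rewrite exprMn; move: h; rewrite mulr1; lra.
Qed.

Let x3w : x ^+ 3 <= w ^+ 12.
Proof.
have -> : w ^+ 12 = (w ^+ 4) ^+ 3 by ring.
by rewrite ler_pXn2r ?nnegrE ?exprn_ge0// ltW.
Qed.

Let x3_rho : x ^+ 3 * (rho / sg) <= x ^+ 3 / w ^+ 12 * (K / w).
Proof.
have w12 : 0 < w ^+ 12 by rewrite exprn_gt0.
rewrite -mulrA ler_wpM2l ?exprn_ge0 ?(ltW x0)//.
by rewrite ler_pdivlMl// rho_sg_small.
Qed.

(** Puts the exceptional probability in the form of a relative error: [Q_lower] trades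
    [expR (- (x ^+ 2 / 2))] for [Q x] times powers of [x], and [w ^+ 12 <= n] is absorbed by
    [En]. *)
Let tail_small2 : q.+1%:R * tau1 <= x ^+ 3 / w ^+ 12 * (72 * En) * Q x.
Proof.
have w12 : 0 < w ^+ 12 by rewrite exprn_gt0.
have x1 : 1 <= x by move: x2; lra.
have Q0 := Q_ge0 x; have Ql := Q_lower x1.
set e := expR (- (w ^+ 2 / 2)); set e' := expR (- (x ^+ 2 / 2)).
have e0 : 0 <= e by exact: expR_ge0.
have e'Q : e' <= 3 * ((1 + x ^+ 2) * Q x).
  by rewrite /e' expRN -[leLHS]mul1r ler_pdivrMr ?expR_gt0.
have x3 : 1 + x ^+ 2 <= 2 * x ^+ 3.
  have : 1 <= x ^+ 2 by exact: exprn_ege1.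
  have : x ^+ 2 <= x ^+ 3 by rewrite [leRHS]exprS ler_peMl ?sqr_ge0.
  lra.
have e'Q2 : e' <= 6 * x ^+ 3 * Q x by have := ler_wpM2r Q0 x3; lra.
have t1 : tau1 <= 2 * (e * (6 * x ^+ 3 * Q x)).
  by rewrite ler_pM2l// (le_trans expR_s_le)// ler_wpM2l.
have q2 : q.+1%:R <= 2 * n%:R :> R.
  by apply: le_trans n_sum; rewrite ler_nat ltnS; exact: qn'.
have h1 : q.+1%:R * tau1 <= 2 * n%:R * (2 * (e * (6 * x ^+ 3 * Q x))).
  by apply: ler_pM => //; rewrite mulr_ge0 ?expR_ge0.
apply: (le_trans h1).
have h2 : n%:R * w ^+ 12 * e <= En.
  rewrite /En ler_wpM2r//; apply: (@le_trans _ _ (n%:R * n%:R)); first by rewrite ler_wpM2l.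
  by rewrite -expr2 -[5%N]/((2 + 3)%N) exprD ler_peMr ?exprn_ge0// exprn_ege1.
have -> : x ^+ 3 / w ^+ 12 * (72 * En) * Q x = 72 * (x ^+ 3 * Q x) * (En / w ^+ 12) by ring.
have -> : 2 * n%:R * (2 * (e * (6 * x ^+ 3 * Q x))) = 24 * (x ^+ 3 * Q x) * (n%:R * e) by ring.
apply: ler_pM.
- by rewrite mulr_ge0// mulr_ge0// exprn_ge0// ltW.
- by rewrite mulr_ge0.
- have : 0 <= x ^+ 3 * Q x by rewrite mulr_ge0// exprn_ge0// ltW.
  lra.
- by rewrite ler_pdivlMr// mulrAC.
Qed.

Lemma single_scale (sgn : R) : sgn ^+ 2 = 1 ->
  `|prob (fun om => x * sg < sgn * V om) / Q x - 1| <=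
  x ^+ 3 / w ^+ 12 * (800 * 100 * (K / w) + 72 * En).
Proof.
move=> sgn2; have Q0 := Q_gt0 x.
have VE : V = fun om => crossing_time a b om 0 n.+1 -
    mean (fun om : config n k => crossing_time a b om 0 n.+1).
  apply/funext => om; rewrite /V tcross_crossing_time; congr (_ - _).
  by apply: eq_mean => om'; rewrite tcross_crossing_time.
have xr : x ^+ 3 * (rho / sg) <= 1 / 1000 * (1 / 100).
  have w12 : 0 < w ^+ 12 by rewrite exprn_gt0.
  apply: (le_trans x3_rho); apply: le_trans Kw; rewrite ler_piMl//.
    by apply: divr_ge0; [exact: K_ge0|exact: ltW].
  by rewrite ler_pdivrMr// mul1r.
have h : `|prob (fun om => x * sg < sgn * V om) - Q x| <=
    800 * 100 * (x ^+ 3 * (rho / sg)) * Q x + q.+1%:R * tau1.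
  have sgE := sg_gt0; have xr' := xr; rewrite /sg VE in sgE xr' *.
  exact: (block_deviation a0 ab k0 q0 qn nq s0 trunc_small tail_small sgE x2 xr' sgn2).
have -> : prob (fun om => x * sg < sgn * V om) / Q x - 1 =
    (prob (fun om => x * sg < sgn * V om) - Q x) / Q x by field; rewrite gt_eqF.
rewrite normrM (gtr0_norm (_ : 0 < (Q x)^-1)) ?invr_gt0// ler_pdivrMr//.
apply: (le_trans h).
have -> : x ^+ 3 / w ^+ 12 * (800 * 100 * (K / w) + 72 * En) * Q x =
  800 * 100 * (x ^+ 3 / w ^+ 12 * (K / w)) * Q x + x ^+ 3 / w ^+ 12 * (72 * En) * Q x by ring.
apply: lerD; last exact: tail_small2.
rewrite ler_wpM2r ?(ltW Q0)//.
by apply: ler_wpM2l; [apply: mulr_ge0; exact: ler0n|exact: x3_rho].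
Qed.

End SingleScale.

(** * Passage to the limit *)

Section Asymptotics.
Variable R : realType.

Lemma near_powR_ge (c A : R) : 0 < c -> \forall n \near \oo, A <= n%:R `^ c.
Proof.
move=> c0; near=> n.
have A1 : 1 <= Num.max A 1 by rewrite le_max lexx orbT.
apply: (@le_trans _ _ (Num.max A 1)); first by rewrite le_max lexx.
have -> : Num.max A 1 = (Num.max A 1 `^ c^-1) `^ c.
  by rewrite -powRrM mulVf ?powRr1// ?gt_eqF// (le_trans ler01).
apply: ge0_ler_powR; rewrite ?nnegrE ?powR_ge0//; first exact: ltW.
by near: n; exact: nbhs_infty_ger.
Unshelve. all: by end_near. Qed.

Lemma expR_ge_exprn (p : nat) (y : R) : (0 < p)%N -> 0 <= y -> (y / p%:R) ^+ p <= expR y.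
Proof.
move=> p0 y0; have pn0 : p%:R != 0 :> R by rewrite pnatr_eq0 -lt0n.
have -> : expR y = expR (y / p%:R) ^+ p.
  by rewrite -expRM_natl; congr expR; field.
have h : y / p%:R <= expR (y / p%:R) by apply: le_trans (expR_ge1Dx _); lra.
by rewrite ler_pXn2r ?nnegrE ?expR_ge0// divr_ge0.
Qed.

(** The choice [p > 3 / c] makes the [p]-th power lower bound of the exponential exceed [n ^ 6] up
    to a constant, one power more than the factor to be beaten. *)
Lemma near_stretched_exp (c e : R) : 0 < c -> 0 < e ->
  \forall n \near \oo, n%:R ^+ 5 * expR (- ((n%:R `^ c) ^+ 2 / 2)) <= e.
Proof.
move=> c0 e0; have c3 : 0 <= 3 / c by rewrite divr_ge0// ltW.
pose p := Num.bound (3 / c); have p3 : 3 / c < p%:R := archi_boundP c3.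
have p0 : (0 < p)%N by rewrite -(ltr0n R) (le_lt_trans _ p3).
near=> n; have n1 : 1 <= n%:R :> R by near: n; exact: nbhs_infty_ger.
have n0 : 0 < n%:R :> R by apply: lt_le_trans n1.
set w := n%:R `^ c; have w0 : 0 < w by rewrite powR_gt0.
have wp : n%:R ^+ 6 <= (w ^+ 2) ^+ p.
  rewrite -exprM -!powR_mulrn ?(ltW n0) ?(ltW w0)// /w -powRrM; apply: ler_powR => //.
  by rewrite natrM; have := p3; rewrite ltr_pdivrMr//; lra.
have y0 : 0 <= w ^+ 2 / 2 by rewrite divr_ge0// sqr_ge0.
have := expR_ge_exprn p0 y0; set E := expR (w ^+ 2 / 2) => hE.
rewrite expRN ler_pdivrMr ?expR_gt0// -/E.
have pp : 0 < (2 * p%:R) ^+ p :> R by rewrite exprn_gt0// mulr_gt0// ltr0n.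
have hE2 : n%:R ^+ 6 <= (2 * p%:R) ^+ p * E.
  apply: (le_trans wp); apply: le_trans (ler_wpM2l (ltW pp) hE).
  rewrite -exprMn le_eqVlt; apply/orP; left; apply/eqP; congr (_ ^+ p); field.
  by rewrite pnatr_eq0 -lt0n.
have nbig : (2 * p%:R) ^+ p / e <= n%:R by near: n; exact: nbhs_infty_ger.
have E0 : 0 < E by exact: expR_gt0.
rewrite -(ler_pM2l n0) -exprS; apply: (le_trans hE2).
rewrite mulrA ler_pM2r// -ler_pdivrMr//.
Unshelve. all: by end_near. Qed.

Lemma prob_card (n k : nat) (A : pred (config n k)) : Prob A = prob A :> R.
Proof.
rewrite /Prob /prob /mean; congr (_ / _).
rewrite -natr_sum; congr (_%:R); rewrite -sum1_card big_mkcond /=.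
apply: eq_bigr => om _.
have -> : (om \in [set om | A om]) = A om.
  by apply/idP/idP; rewrite in_setE.
by case: (A om).
Qed.

Variables (a b alpha : R) (k : nat -> nat) (x : nat -> R).
Hypotheses (a0 : 0 < a) (ab : a < b) (alpha_lt : alpha < 1 / 10).
Hypothesis k0 : forall n, (0 < k n)%N.
Hypothesis k_small : (fun n => (k n)%:R / (n%:R `^ alpha)) @ \oo --> (0 : R).
Hypothesis x_large : x @ \oo --> +oo.
Hypothesis x_small : (fun n => x n / (n%:R `^ ((1 - 10 * alpha) / 18))) @ \oo --> (0 : R).

Let th := 1 - 10 * alpha.
Let V n (om : config n (k n)) : R := tcross a b om - mean (tcross a b (n := n) (k := k n)).
Let sg n : R := Num.sqrt (mean (fun om => V (n := n) om ^+ 2)).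

Lemma moderate_deviation (sgn : R) : sgn ^+ 2 = 1 ->
  (fun n => (prob (fun om => x n * sg n < sgn * V (n := n) om) / Q (x n) - 1) /
    (x n ^+ 3 / (n%:R `^ (th / 6)))) @ \oo --> (0 : R).
Proof.
move=> sgn2; have th0 : 0 < th by rewrite /th; have := alpha_lt; lra.
have nx : \forall n \near \oo, x n <= n%:R `^ (th / 18).
  have /cvgr0Pnorm_le /(_ 1 ltr01) := x_small; apply: filterS2 (nbhs_infty_gt 0%N) => n n0.
  move=> /(le_trans (ler_norm _)); rewrite ler_pdivrMr ?mul1r//.
  by rewrite powR_gt0// ltr0n.
have nk : \forall n \near \oo, (k n)%:R <= n%:R `^ alpha.
  have /cvgr0Pnorm_le /(_ 1 ltr01) := k_small; apply: filterS2 (nbhs_infty_gt 0%N) => n n0.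
  move=> /(le_trans (ler_norm _)); rewrite ler_pdivrMr ?mul1r//.
  by rewrite powR_gt0// ltr0n.
have nx2 : \forall n \near \oo, 2 <= x n by exact: (cvgryPge _).1.
apply/cvgr0Pnorm_le => eps eps0; pose C : R := 800 * 100 + 72.
have C0 : 0 < C by apply: addr_gt0; rewrite -?natrM ltr0n.
pose K : R := 500 * (b / (b - a)).
pose c : R := 1 / 1000 * (1 / 100).
have cp : 0 < c by apply: mulr_gt0; apply: divr_gt0; rewrite ?ltr01 ?ltr0n.
(* [e] serves twice: [C * e <= eps] controls the final error, and [e <= c] meets the smallness
   conditions of [single_scale]. *)
pose e := Num.min (eps / C) c.
have e0 : 0 < e by rewrite lt_min cp divr_gt0.
have ec : e <= c by rewrite ge_min lexx orbT.
have eC : C * e <= eps by rewrite mulrC -ler_pdivlMr// ge_min lexx.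
have c1 : c <= 1 by rewrite /c; lra.
have e1 : e <= 1 by exact: le_trans c1.
have c0 : 0 < th / 72 by rewrite divr_gt0.
near=> n.
have n1 : 1 <= n%:R :> R by near: n; exact: nbhs_infty_ger.
have n0 : 0 < n%:R :> R by apply: lt_le_trans n1.
have w1 : 1 <= n%:R `^ (th / 72) by near: n; exact: near_powR_ge.
have wK : K / e <= n%:R `^ (th / 72) by near: n; exact: near_powR_ge.
have En : n%:R ^+ 5 * expR (- ((n%:R `^ (th / 72)) ^+ 2 / 2)) <= e.
  by near: n; exact: near_stretched_exp.
have xth : x n <= n%:R `^ (th / 18) by near: n.
set w := n%:R `^ (th / 72) in w1 wK En *; have w0 : 0 < w by rewrite powR_gt0.
have wE m (r : R) : r = m%:R * th / 72 -> w ^+ m = n%:R `^ r.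
  by move=> ->; rewrite -powR_mulrn ?(ltW w0)// /w -powRrM; congr (_ `^ _); field.
have x2 : 2 <= x n by near: n.
have xw : x n <= w ^+ 4.
  by rewrite (wE 4%N (th / 18)); last by field.
have kal : (k n)%:R <= n%:R `^ alpha by near: n.
(* The exponents add up to [5 * alpha + (1 - 10 * alpha) / 2 = 1 / 2]. *)
have kw : (k n)%:R ^+ 5 * w ^+ 36 <= Num.sqrt n%:R.
  rewrite (wE 36%N (th / 2)); last by field.
  rewrite -powR12_sqrt ?(ltW n0)//.
  rewrite [X in _ <= _ `^ X](_ : _ = alpha * 5%:R + th / 2); last by rewrite /th; field.
  rewrite powRD; last by rewrite (gt_eqF n0) implybT.
  rewrite ler_wpM2r ?powR_ge0// powRrM powR_mulrn ?powR_ge0//.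
  by rewrite ler_pXn2r ?nnegrE ?powR_ge0.
have kn : (k n <= n)%N.
  rewrite -(ler_nat R); have k1 : 1 <= (k n)%:R :> R by rewrite ler1n.
  apply: (@le_trans _ _ ((k n)%:R ^+ 5 * w ^+ 36)).
    rewrite exprS -mulrA ler_peMr// -[leLHS]mulr1; apply: ler_pM => //; exact: exprn_ege1.
  apply: (le_trans kw); rewrite -[leRHS]sqr_sqrtr ?(ltW n0)// expr2 ler_peMr ?sqrtr_ge0//.
  by rewrite -[leLHS]sqrtr1; apply: ler_wsqrtr.
have [q /andP[q1 q2]] := exists_isqrt n.+1.
have Kw : K / w <= e by rewrite ler_pdivrMr// mulrC -ler_pdivrMr.
have := single_scale a0 ab (k0 n) kn x2 w1 xw kw q1 q2 (le_trans Kw ec) (le_trans En e1) sgn2.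
rewrite -/(V (n := n)) -/(sg n) => h.
have D : n%:R `^ (th / 6) = w ^+ 12 by rewrite (wE 12%N (th / 6)); last by field.
have xd : 0 < x n ^+ 3 / w ^+ 12.
  by rewrite divr_gt0 ?exprn_gt0// (lt_le_trans _ x2).
rewrite D normrM normfV (gtr0_norm xd) ler_pdivrMr// [leRHS]mulrC.
apply: (le_trans h); rewrite ler_pM2l//.
apply: le_trans eC; rewrite /C [leRHS]mulrDl; apply: lerD.
  by apply: ler_wpM2l; rewrite -?natrM ?ler0n.
by apply: ler_wpM2l; rewrite ?ler0n.
Unshelve. all: by end_near. Qed.

End Asymptotics.

Theorem theorem4p1 (R : realType) (a b alpha : R) (k : nat -> nat) (x : nat -> R) :
  0 < a -> a < b -> alpha < 1 / 10 ->
  (forall n, (0 < k n)%N) ->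
  (fun n => (k n)%:R / (n%:R `^ alpha)) @ \oo --> (0 : R) ->
  x @ \oo --> +oo ->
  (fun n => x n / (n%:R `^ ((1 - 10 * alpha) / 18))) @ \oo --> (0 : R) ->
  (fun n =>
     (Prob (n:=n) (k:=k n) [pred om | tcross a b om - Expect (tcross a b (n:=n) (k:=k n))
                        < - (x n * Num.sqrt (Var (tcross a b (n:=n) (k:=k n))))]
        / (1 - Phi (x n)) - 1)
     / (x n ^+ 3 / (n%:R `^ ((1 - 10 * alpha) / 6)))) @ \oo --> (0 : R)
  /\
  (fun n =>
     (Prob (n:=n) (k:=k n) [pred om | tcross a b om - Expect (tcross a b (n:=n) (k:=k n))
                        > x n * Num.sqrt (Var (tcross a b (n:=n) (k:=k n)))]
        / (1 - Phi (x n)) - 1)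
     / (x n ^+ 3 / (n%:R `^ ((1 - 10 * alpha) / 6)))) @ \oo --> (0 : R).
Proof.
move=> a0 ab al k0 kc xy xc.
have md := moderate_deviation a0 ab al k0 kc xy xc.
split.
- apply: cvg_trans (md (-1) _); last by rewrite sqrrN expr1n.
  apply: near_eq_cvg; near=> n; congr ((_ / _ - 1) / _).
  rewrite prob_card; apply: eq_mean => om; congr (_%:R); rewrite /=.
  by rewrite mulN1r ltrNr.
- apply: cvg_trans (md 1 _); last by rewrite expr1n.
  apply: near_eq_cvg; near=> n; congr ((_ / _ - 1) / _).
  by rewrite prob_card; apply: eq_mean => om; rewrite mul1r.
Unshelve. all: by end_near. Qed.
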